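(* Let $V$ be a pure representation of a torus $T$ such that $V/T$ is singular. Then $V/T$ has worse than finite quotient singularities, i.e. $V/T$ does not have (only) finite quotient singularities.
   Context: Work over an algebraically closed field $K$ of characteristic $0$; a torus is $T\cong\mathbb{G}_m^r$ and representations are finite-dimensional and rational. Write $V/T=\operatorname{Spec} K[V]^T$ and let $\pi\colon V\to V/T$ be the quotient map. A vector $v\in V$ is $T$-stable if the orbit $Tv$ is closed and $v$ is not contained in the closure of any other orbit. The set $V^s$ of stable vectors is Zariski open; $V$ is a stable representation if $V^s\neq\varnothing$. The closed set $V^{\mathrm{sss}}=V\setminus V^s$ is the strictly semi-stable locus. A stable representation $V$ is pure if $\pi(V^{\mathrm{sss}})$ is pure of codimension one in $V/T$, in the sense that every irreducible component of $V^{\mathrm{sss}}$ maps under $\pi$ to a divisor of $V/T$ (vacuously true if $V^{\mathrm{sss}}=\varnothing$). *)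

(* Defs.v *)
From mathcomp Require Import all_boot all_order all_algebra all_fingroup all_character.
From mathcomp Require Import mpoly.
From mathcomp Require Import boolp classical_sets.

Set Implicit Arguments.
Unset Strict Implicit.
Unset Printing Implicit Defensive.

Import GRing.Theory.
Local Open Scope ring_scope.
Local Open Scope classical_set_scope.

(* c 0 `<` c 1 `<` ... `<` c d is a chain of length d of sets satisfying P;
   the values of c beyond d are irrelevant. *)
Definition strict_chain (X : Type) (P : set X -> Prop) (d : nat)
    (c : nat -> set X) : Prop :=
  (forall i, (i <= d)%N -> P (c i)) /\
  (forall i, (i < d)%N -> c i `<` c i.+1).

(* A topology is given here by its closed sets. *)
Section Topology.
Variables (X : Type) (closed : set X -> Prop).

Definition closure_of (S : set X) : set X :=
  [set x | forall Z, closed Z -> S `<=` Z -> Z x].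

Definition irreducible (S : set X) : Prop :=
  S !=set0 /\
  forall Z1 Z2, closed Z1 -> closed Z2 ->
    S `<=` Z1 `|` Z2 -> S `<=` Z1 \/ S `<=` Z2.

Definition irreducible_component (Y C : set X) : Prop :=
  [/\ irreducible C, C `<=` Y &
      forall D, irreducible D -> D `<=` Y -> C `<=` D -> D `<=` C].

Definition irreducible_closed (Z : set X) : Prop := closed Z /\ irreducible Z.

Definition has_codim (Z : set X) (d : nat) : Prop :=
  (exists c, strict_chain irreducible_closed d c /\ c 0%N = Z) /\
  (forall e c, strict_chain irreducible_closed e c -> c 0%N = Z -> (e <= d)%N).

Definition divisor (Z : set X) : Prop :=
  irreducible_closed Z /\ has_codim Z 1.

End Topology.

(* Ideal theory of a subring R of an ambient commutative ring L. *)
Section Ideals.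
Variables (L : comNzRingType) (R : set L).

Definition is_ideal (I : set L) : Prop :=
  [/\ I `<=` R, I 0, (forall x y, I x -> I y -> I (x + y)) &
      (forall a x, R a -> I x -> I (a * x))].

Definition prime_ideal (P : set L) : Prop :=
  [/\ is_ideal P, ~ P 1 &
      forall x y, R x -> R y -> P (x * y) -> P x \/ P y].

Definition maximal_ideal (M : set L) : Prop :=
  [/\ is_ideal M, ~ M 1 &
      forall J, is_ideal J -> ~ J 1 -> M `<=` J -> J `<=` M].

Definition ideal_gen (S : set L) : set L :=
  [set x | exists s : seq (L * L),
     (forall p, p \in s -> R p.1 /\ S p.2) /\ x = \sum_(p <- s) p.1 * p.2].

Definition ideal_exp (I : set L) (k : nat) : set L :=
  ideal_gen [set x | exists y : 'I_k -> L,
     (forall i, I (y i)) /\ x = \prod_(i < k) y i].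

Definition krull_dim (d : nat) : Prop :=
  (exists c, strict_chain prime_ideal d c) /\
  (forall e c, strict_chain prime_ideal e c -> (e <= d)%N).

(* R is regular local with maximal ideal m: the ideal m is generated by
   dim R elements. *)
Definition regular_local (m : set L) : Prop :=
  exists d, krull_dim d /\
    exists s : 'I_d -> L, m = ideal_gen (range s).

End Ideals.

Section AffineVarieties.
Variables (K : fieldType) (n : nat).

Definition peval (p : {mpoly K[n]}) (v : 'cV[K]_n) : K := p.@[fun i => v i 0].

Definition zclosed (Z : set 'cV[K]_n) : Prop :=
  exists S : set {mpoly K[n]}, Z = [set v | forall p, S p -> peval p v = 0].

Definition ratfun : fieldType := {fraction {mpoly K[n]}}.

(* The affine variety with coordinate ring A, for a subalgebra A of
   K[x_1, ..., x_n]; its points are the maximal ideals of A. *)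
Section Coordinate.
Variable A : set {mpoly K[n]}.

Definition point : Type := {m : set {mpoly K[n]} | maximal_ideal A m}.

Definition vclosed (Z : set point) : Prop :=
  exists S : set {mpoly K[n]}, S `<=` A /\ Z = [set x | S `<=` proj1_sig x].

(* As A is a domain, its localization at x is a subring of the field of
   fractions of A, itself a subfield of K(x_1, ..., x_n). *)
Definition local_ring (x : point) : set ratfun :=
  [set h | exists f g, [/\ A f, A g, ~ proj1_sig x g & h = tofrac f / tofrac g]].

Definition local_max (x : point) : set ratfun :=
  [set h | exists f g,
     [/\ proj1_sig x f, A g, ~ proj1_sig x g & h = tofrac f / tofrac g]].

Definition singular : Prop :=
  exists x : point, ~ regular_local (local_ring x) (local_max x).

(* The completion lim_k O/m^k of the local ring (O, m) at x: its elements are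
   represented by the sequences u in O with u_k = u_(k+1) modulo m^k, two such
   sequences being identified by completion_eq. *)
Definition completion (x : point) : set (nat -> ratfun) :=
  [set u | forall k, local_ring x (u k) /\
     ideal_exp (local_ring x) (local_max x) k (u k.+1 - u k)].

Definition completion_eq (x : point) (u w : nat -> ratfun) : Prop :=
  forall k, ideal_exp (local_ring x) (local_max x) k (u k - w k).

End Coordinate.

Definition scalar (c : K) : nat -> ratfun := fun=> tofrac (c%:MP : {mpoly K[n]}).

Definition invariants (H : set 'M[K]_n) : set {mpoly K[n]} :=
  [set p | forall g v, H g -> peval p (g *m v) = peval p v].

Definition eval_ideal (H : set 'M[K]_n) (v : 'cV[K]_n) : set {mpoly K[n]} :=
  [set p | invariants H p /\ peval p v = 0].

Lemma eval_ideal_maximal H v : maximal_ideal (invariants H) (eval_ideal H v).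
Proof.
have evD p q w : peval (p + q) w = peval p w + peval q w by rewrite /peval mevalD.
have evM p q w : peval (p * q) w = peval p w * peval q w by rewrite /peval mevalM.
have evC c w : peval c%:MP w = c by rewrite /peval mevalC.
have invC c : invariants H c%:MP by move=> g w _; rewrite !evC.
split.
- split; first by move=> p [].
  + by rewrite -mpolyC0; split=> //; rewrite evC.
  + move=> p q [Hp p0] [Hq q0]; split; last by rewrite evD p0 q0 addr0.
    by move=> g w Hg; rewrite !evD Hp ?Hq.
  + move=> a p Ha [Hp p0]; split; last by rewrite evM p0 mulr0.
    by move=> g w Hg; rewrite !evM Hp ?Ha.
- by case=> _; rewrite -mpolyC1 evC => /eqP; rewrite oner_eq0.
- move=> J [JA J0 JD JM] J1 sMJ p Jp; split; first exact: JA.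
  apply/eqP/negP => /negP pv0; apply: J1.
  have Hp := JA _ Jp.
  have JN : J ((- 1)%:MP * p + (peval p v)%:MP).
    apply: sMJ; split; last by rewrite evD evM !evC mulN1r addNr.
    by move=> g w Hg; rewrite !evD !evM !evC Hp.
  have := JM ((peval p v)^-1)%:MP _ (invC _) (JD _ _ Jp JN).
  by rewrite mpolyCN mulN1r addrA subrr add0r -mpolyCM mulVf // mpolyC1.
Qed.

(* The quotient map from K^n to the variety with coordinate ring K[x]^H. *)
Definition quot_map (H : set 'M[K]_n) (v : 'cV[K]_n) : point (invariants H) :=
  exist _ (eval_ideal H v) (eval_ideal_maximal H v).

End AffineVarieties.

(* Isomorphism, as K-algebras, of the completed local rings at x and y. *)
Definition formally_isomorphic (K : fieldType) (n1 n2 : nat)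
    (A1 : set {mpoly K[n1]}) (A2 : set {mpoly K[n2]})
    (x : point A1) (y : point A2) : Prop :=
  exists phi : (nat -> ratfun K n1) -> (nat -> ratfun K n2),
    [/\ (forall u, completion x u -> completion y (phi u)),
        (forall u w, completion x u -> completion x w ->
           completion_eq x u w <-> completion_eq y (phi u) (phi w)) &
        (forall z, completion y z ->
           exists2 u, completion x u & completion_eq y (phi u) z)] /\
    [/\ (forall u w, completion x u -> completion x w ->
           completion_eq y (phi (fun k => u k + w k))
                           (fun k => phi u k + phi w k)),
        (forall u w, completion x u -> completion x w ->
           completion_eq y (phi (fun k => u k * w k))
                           (fun k => phi u k * phi w k)) &
        (forall c, completion_eq y (phi (scalar n1 c)) (scalar n2 c))].

(* Every point is formally locally isomorphic to the image of the origin in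
   the quotient of an affine space by a linear action of a finite group. *)
Definition finite_quotient_singularities (K : fieldType) (n : nat)
    (A : set {mpoly K[n]}) : Prop :=
  forall x : point A,
    exists (d : nat) (gT : finGroupType) (G : {group gT})
           (rG : mx_representation K G d),
      formally_isomorphic x
        (quot_map [set M | exists2 g, g \in G & M = rG g] 0).

Section TorusRepresentations.
Variables (K : fieldType) (r n : nat).

Definition torus : set ('I_r -> K) := [set t | forall i, t i != 0].

(* The matrix entries are regular functions on the torus, that is Laurent
   polynomials in t_1, ..., t_r.  The values of rho off the torus are
   irrelevant. *)
Definition rational_representation (rho : ('I_r -> K) -> 'M[K]_n) : Prop :=
  [/\ rho (fun=> 1) = 1%:M,
      (forall t u, torus t -> torus u ->
         rho (fun i => t i * u i) = rho t *m rho u) &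
      (forall i j, exists (p : {mpoly K[r]}) (N : nat),
         forall t, torus t -> rho t i j = p.@[t] / (\prod_l t l) ^+ N)].

Variable rho : ('I_r -> K) -> 'M[K]_n.

Definition torus_image : set 'M[K]_n := rho @` torus.

Definition orbit_of (v : 'cV[K]_n) : set 'cV[K]_n :=
  [set g *m v | g in torus_image].

Definition stable_vector (v : 'cV[K]_n) : Prop :=
  zclosed (orbit_of v) /\
  forall w, orbit_of w <> orbit_of v ->
    ~ closure_of (@zclosed K n) (orbit_of w) v.

Definition stable_locus : set 'cV[K]_n := [set v | stable_vector v].

Definition strictly_semistable_locus : set 'cV[K]_n := ~` stable_locus.

Definition stable_representation : Prop := stable_locus !=set0.

(* K[V]^T, the coordinate ring of V/T *)
Definition torus_invariants : set {mpoly K[n]} := invariants torus_image.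

Definition pure_representation : Prop :=
  stable_representation /\
  forall C, irreducible_component (@zclosed K n) strictly_semistable_locus C ->
    divisor (@vclosed K n torus_invariants) (quot_map torus_image @` C).

End TorusRepresentations.

(* Main.v *)
From HB Require Import structures.
From mathcomp Require Import all_boot all_order all_algebra all_fingroup all_character.
From mathcomp Require Import ssrcomplements mpoly zify ring.
From mathcomp Require Import boolp classical_sets.
Require Import Defs.

(** In a basis of weight vectors with weights a_1, ..., a_n, the invariant ring
    K[V]^T is spanned by the monomials x^u whose exponent lies in the monoid M
    of the u in N^n with \sum_i u_i a_i = 0 ([torus_invariantsE]).  The proof
    shows that M is a free commutative monoid as soon as V is pure and V/T has
    finite quotient singularities.  Then K[V]^T is a polynomial ring and V/T
    is not singular.

    Purity enters through the faces of M, which are the sets of the u in M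
    that vanish on a given set of coordinates.  A one-parameter subgroup under
    which a stable vector has a limit acts trivially ([stable_pairing]); by
    Stiemke's theorem ([stiemke]) this yields an element of M with positive
    coordinates ([positive_relation]).  If no stable vector lies on the
    hyperplane x_i = 0, this hyperplane is a component of the strictly
    semistable locus, hence maps to a divisor of V/T; otherwise u_i is the
    only coordinate that vanishes on the face u_i = 0 of M.  In both cases, if
    u_j vanishes on the face u_i = 0, then u_i vanishes on the face u_j = 0
    ([closure_symmetric]).

    Finite quotient singularities enter at the image of the origin only,
    except for the remark that all residue fields are then K
    ([formal_residue]).  There the completed local ring is that of K[z]^G at
    the origin, for a finite group G acting linearly on the variables
    z_1, ..., z_d.  In the regular ring K[z] the codimension of an intersection
    of two closed subsets through the origin is at most the sum of their
    codimensions, and this inequality descends to K[z]^G, over which K[z] is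
    finite.  Applied to the closed strata of the toric variety V/T, which
    correspond to the faces F_S of M, it says that
    dim F_S + dim F_T <= dim (F_S :&: F_T) + dim M ([delta_submodular]).
    All of this is done by counting: a formal isomorphism gives isomorphisms
    of the jet rings A / m^N ([formal_jet_iso]), the dimension of a stratum is
    the growth exponent of the number of monomials on a face ([card_face_le],
    [card_face_ge], [leq_growth]), and the inequality in K[z] is a bound for
    the lengths of quotients by ideals that contain a power of (z), proved by
    reduction to the diagonal ([intersection_codim]).

    With both inputs, the facets of M meet as coordinate hyperplanes do: a
    coordinate that vanishes on an intersection of facets vanishes on one of
    them ([clos_facets]).  So each facet has an opposite generator, and these
    generate M freely ([free_monoid]).  Regularity of the polynomial ring
    K[V]^T at a point with residue field K is [polynomial_subalgebra_regular];
    its dimension is bounded by comparing the lengths of chains of primes with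
    algebraic dependence ([chain_independent], [algebraic_dependence]). *)

Set Implicit Arguments.
Unset Strict Implicit.
Unset Printing Implicit Defensive.

Import GRing.Theory.
Local Open Scope ring_scope.
Local Open Scope classical_set_scope.

(** * Polynomials over an infinite field *)

Section MpolyMorphisms.
Variables (n : nat) (R : comNzRingType).

Lemma rmorph_mpoly_eq (S : comNzRingType) (f g : {rmorphism {mpoly R[n]} -> S}) :
  (forall c, f c%:MP = g c%:MP) -> (forall i, f 'X_i = g 'X_i) -> f =1 g.
Proof.
move=> fgC fgX p; rewrite (mpolyE p) !rmorph_sum; apply: eq_bigr => m _.
rewrite -mul_mpolyC !rmorphM fgC /=; congr (_ * _).
rewrite mpolyXE_id !rmorph_prod; apply: eq_bigr => i _.
by rewrite !rmorphXn /= fgX.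
Qed.

(** Such expansions are stable under sums and products, and exist for the
    constants and the variables. *)
Lemma taylor (c : 'I_n -> R) (q : {mpoly R[n]}) :
  exists h : 'I_n -> {mpoly R[n]}, q = q.@[c]%:MP + \sum_i ('X_i - (c i)%:MP) * h i.
Proof.
pose S : set {mpoly R[n]} := [set q : {mpoly R[n]} | exists h : 'I_n -> {mpoly R[n]},
  q = q.@[c]%:MP + \sum_i ('X_i - (c i)%:MP) * h i].
rewrite -/(S q).
have SC a : S a%:MP.
  exists (fun=> 0); rewrite mevalC big1 ?addr0 // => i _.
  by rewrite mulr0.
have SD u v : S u -> S v -> S (u + v).
  move=> [h uh] [h' vh']; exists (fun i => h i + h' i).
  rewrite {1}uh {1}vh' addrACA; congr (_ + _).
    by rewrite mevalD mpolyCD.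
  by rewrite -big_split; apply: eq_bigr => i _; rewrite mulrDr.
have SM u v : S u -> S v -> S (u * v).
  move=> [h uh] [h' vh']; exists (fun i => u.@[c]%:MP * h' i + h i * v).
  rewrite {1}uh mulrDl {1}vh' mulrDr -addrA; congr (_ + _).
    by rewrite mevalM mpolyCM.
  rewrite mulr_suml mulr_sumr -big_split; apply: eq_bigr => i _ /=.
  by rewrite mulrDr mulrA mulrCA !mulrA.
have SX i : S 'X_i.
  exists (fun j => (j == i)%:R); rewrite (bigD1 i) //= eqxx mulr1 big1.
    by rewrite addr0 mevalXU addrC subrK.
  by move=> j /negPf->; rewrite mulr0.
rewrite (mpolyE q); elim/big_ind: _ => [||u _]; [by rewrite -mpolyC0; apply: SC | exact: (SD) | ].
rewrite -mul_mpolyC mpolyXE_id; apply: (SM) => //.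
elim/big_ind: _ => [||i _]; [by rewrite -mpolyC1; apply: SC | exact: (SM) | ].
elim: (u i) => [|k IH]; first by rewrite expr0 -mpolyC1; apply: (SC).
by rewrite exprS; apply: (SM).
Qed.

End MpolyMorphisms.

Section Vanishing.
Variables (K : fieldType) (charK0 : [pchar K] =i pred0).

Lemma natr_inj_pchar0 : injective (fun k : nat => k%:R : K).
Proof.
have cmp a b : (a <= b)%N -> a%:R = b%:R :> K -> a = b.
  move=> le_ab /eqP eq_ab; apply/eqP; rewrite eqn_leq le_ab /= -subn_eq0.
  have /pcharf0P P := charK0.
  by rewrite -P natrB // subr_eq0 eq_sym.
move=> a b /= eq_ab; case/orP: (leq_total a b) => /cmp E; first exact: E.
by apply/esym/E.
Qed.

(** The coefficients lie in a domain R above K so that the variables of a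
    polynomial can be specialised one after the other. *)
Lemma poly_vanish (R : idomainType) (f : {rmorphism K -> R}) (p : {poly R}) :
  (forall s : K, s != 0 -> p.[f s] = 0) -> p = 0.
Proof.
move=> p0; apply/eqP/negP => /negP p_n0.
pose rs := [seq f k.+1%:R | k <- iota 0 (size p)].
have := @max_poly_roots _ p rs p_n0; rewrite size_map size_iota ltnn => E.
suff: false by []; apply: E.
  apply/allP => _ /mapP[k _ ->]; apply/eqP/p0.
  by move/pcharf0P: charK0 => ->.
rewrite map_inj_uniq ?iota_uniq // => a b /fmorph_inj.
by move/natr_inj_pchar0; case.
Qed.

(** Specialise the variables one by one; each step is [poly_vanish] over the
    ring of polynomials in the variables. *)
Lemma mpoly_vanish_torus n (p : {mpoly K[n]}) :
  (forall c : 'I_n -> K, (forall i, c i != 0) -> p.@[c] = 0) -> p = 0.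
Proof.
move=> p0.
pose h k (c : 'I_n -> K) (i : 'I_n) : {mpoly K[n]} :=
  if (i < k)%N then (c i)%:MP else 'X_i.
have step k c : (k < n)%N ->
    (forall c', (forall i, c' i != 0) -> mmap (@mpolyC n K) (h k.+1 c') p = 0) ->
    (forall i, c i != 0) -> mmap (@mpolyC n K) (h k c) p = 0.
  move=> lt_kn IH c_n0; set q := mmap _ _ _.
  pose j := Ordinal lt_kn.
  pose g i : {poly {mpoly K[n]}} := if i == j then 'X else (h k c i)%:P.
  pose G := mmap (polyC \o @mpolyC n K) g.
  have Gev (s : {mpoly K[n]}) : forall u, (G u).[s] =
      mmap (@mpolyC n K) (fun i => if i == j then s else h k c i) u.
    apply: (@rmorph_mpoly_eq _ _ _ (horner_eval s \o G)) => [a|i] /=.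
      by rewrite /G !mmapC /= /horner_eval hornerC.
    rewrite /G !mmapX !mmap1U /g /horner_eval.
    by case: eqP => _; rewrite ?hornerX ?hornerC.
  have -> : q = (G p).['X_j].
    rewrite Gev; apply: eq_bigr => m _; congr (_ * _); apply: mmap1_eq => i.
    by case: eqP => // ->; rewrite /h /= ltnn.
  rewrite (_ : G p = 0) ?horner0 //.
  apply: (@poly_vanish _ (@mpolyC n K)) => s s_n0; rewrite Gev.
  rewrite -[RHS](IH (fun i => if i == j then s else c i)); last by move=> i; case: ifP.
  apply: eq_bigr => m _; congr (_ * _); apply: mmap1_eq => i; rewrite /h ltnS.
  by rewrite -val_eqE /=; case: ltngtP.
have H : forall k, (k <= n)%N ->
    forall c, (forall i, c i != 0) -> mmap (@mpolyC n K) (h (n - k)%N c) p = 0.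
  elim=> [_ c c_n0|k IH lt_kn c c_n0]; last first.
    apply: step => //; first by rewrite -subSn // subSS leq_subr.
    by move=> c'; rewrite -subSn // subSS; apply: IH; apply: ltnW.
  rewrite subn0 -(mpolyC0 n K) -(p0 c c_n0) /meval /mmap rmorph_sum.
  apply: eq_bigr => m _; rewrite rmorphM; congr (_ * _).
  rewrite /mmap1 rmorph_prod; apply: eq_bigr => i _.
  by rewrite rmorphXn /h ltn_ord.
have := H n (leqnn _) (fun=> 1) (fun=> oner_neq0 _); rewrite subnn.
have /= -> // := @rmorph_mpoly_eq _ _ _ (mmap (@mpolyC n K) (h 0%N (fun=> 1))) idfun.
  by move=> c; rewrite /= mmapC.
by move=> i; rewrite /= mmapX mmap1U.
Qed.

Lemma mpoly_vanish n (p : {mpoly K[n]}) : (forall c, p.@[c] = 0) -> p = 0.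
Proof. by move=> p0; apply: mpoly_vanish_torus => c _; apply: p0. Qed.

End Vanishing.

(** * Subspaces of finite codimension *)

Lemma sum_enum_val (V : nmodType) (T : finType) (F : T -> V) :
  \sum_t F t = \sum_(i < #|T|) F (enum_val i).
Proof. by rewrite (reindex (@enum_val T T)) //; apply: onW_bij (enum_val_bij T). Qed.

Section FiniteCodimension.
Variables (K : fieldType) (E : lmodType K).
Implicit Types (U : set E).

Definition subspace U : Prop := U 0 /\ forall a x y, U x -> U y -> U (a *: x + y).

Lemma subspaceD U x y : subspace U -> U x -> U y -> U (x + y).
Proof. by case=> _ H Ux Uy; rewrite -[x]scale1r; apply: H. Qed.

Lemma subspaceZ U a x : subspace U -> U x -> U (a *: x).
Proof. by case=> U0 H Ux; rewrite -[_ *: _]addr0; apply: H. Qed.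

Lemma subspaceN U x : subspace U -> U x -> U (- x).
Proof. by move=> sU Ux; rewrite -scaleN1r; apply: subspaceZ. Qed.

Lemma subspaceB U x y : subspace U -> U x -> U y -> U (x - y).
Proof. by move=> sU Ux Uy; apply: subspaceD => //; apply: subspaceN. Qed.

Definition spanned U (T : finType) (s : T -> E) : Prop :=
  forall x, exists c : T -> K, U (x - \sum_t c t *: s t).

Definition independent_mod U (T : finType) (w : T -> E) : Prop :=
  forall c : T -> K, U (\sum_t c t *: w t) -> forall t, c t = 0.

(** U has codimension e: the functionals lam i are a basis of the dual of the
    quotient by U, with dual basis d. *)
Definition has_dual U e : Prop :=
  exists (d : 'I_e -> E) (lam : 'I_e -> {linear E -> K^o}),
    (forall i j, lam i (d j) = (i == j)%:R) /\
    (forall x, U x <-> forall i, lam i x = 0).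

(** Induction on s: if its first vector h is not in U, the functionals that cut
    out U + K h are completed by the one that reads off the coefficient of h. *)
Lemma exists_dual_seq U (s : seq E) : subspace U ->
  (forall x, exists c : nat -> K, U (x - \sum_(i < size s) c i *: s`_i)) ->
  exists e, has_dual U e.
Proof.
elim: s U => [|h s IH] U sU Us.
  exists 0%N, (fun=> 0), (fun=> \0%R : {linear E -> K^o}); split=> [[]//|x]; split=> [_ []//|_].
  by have [c] := Us x; rewrite big_ord0 subr0.
pose U' : set E := [set x : E | exists c, U (x - c *: h)].
have sU' : subspace U'.
  split; first by exists 0; rewrite scale0r subr0; case: sU.
  move=> a x y [c Uc] [c' Uc']; exists (a * c + c').
  rewrite scalerDl -scalerA opprD addrACA -scalerBr.
  by case: sU => _; apply.
have [] := IH U' sU'.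
  move=> x; have [c] := Us x; rewrite big_ord_recl /= => Uc.
  exists (fun i => c i.+1), (c 0%N).
  by rewrite -addrA -opprD addrC addrC [X in _ - X]addrC.
move=> e [d [lam [dE UE]]].
have [Uh|Uh] := EM (U h).
  exists e, d, lam; split=> // x; rewrite -UE; split=> [Ux|[c Uc]].
    by exists 0; rewrite scale0r subr0.
  by rewrite -[x](subrK (c *: h)); apply: subspaceD => //; apply: subspaceZ.
pose r x := x - \sum_i lam i x *: d i.
have rlin a x y : r (a *: x + y) = a *: r x + r y.
  rewrite /r scalerBr addrACA -opprD; congr (_ - _).
  rewrite scaler_sumr -big_split; apply: eq_bigr => i _ /=.
  by rewrite linearP scalerDl scalerA.
have U'r x : U' (r x).
  apply/UE => i; rewrite /r linearB linear_sum (bigD1 i) //= linearZ /= dE eqxx.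
  rewrite big1 ?addr0 => [|j /negPf ji]; first by rewrite /GRing.scale /= mulr1 subrr.
  by rewrite linearZ /= dE eq_sym ji /GRing.scale /= mulr0.
have [f fP] := choice U'r.
(* f is well defined: h is not in U. *)
have fU x c : U (r x - c *: h) -> f x = c.
  move=> Uc; apply/eqP/negP => /negP; rewrite eq_sym -subr_eq0 => nz.
  apply: Uh; rewrite -[h](scalerK nz); apply: subspaceZ => //.
  have := subspaceB sU (fP x) Uc.
  by rewrite opprB addrC addrA subrK -scalerBl.
have f_lin : linear (f : E -> K^o).
  move=> a x y; apply: fU; rewrite rlin scalerDl opprD addrACA.
  rewrite [X in _ - X *: h + _](_ : _ = a * f x) // -scalerA -scalerBr.
  by case: sU => _; apply; apply: fP.
pose fL := GRing.isLinear.Build K E K^o *:%R f f_lin.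
pose F : {linear E -> K^o} := HB.pack f fL.
exists e.+1, (fun i => if unlift ord0 i is Some j then d j else h),
  (fun i => if unlift ord0 i is Some j then lam j else F).
have lamh i : lam i h = 0.
  by move: i; apply/UE; exists 1; rewrite scale1r subrr; case: sU.
have Fh : F h = 1.
  apply: fU; rewrite /r big1 ?subr0 ?scale1r ?subrr; first by case: sU.
  by move=> i _; rewrite lamh scale0r.
have Fd j : F (d j) = 0.
  apply: fU; rewrite /r (bigD1 j) //= dE eqxx scale1r big1 ?addr0 ?subrr ?scale0r.
    by rewrite subrr; case: sU.
  by move=> i /negPf ij; rewrite dE ij scale0r.
split=> [i j|x].
  case: unliftP => [i' ->|->]; case: unliftP => [j' ->|->].
  - by rewrite dE (inj_eq lift_inj).
  - by rewrite lamh eq_sym (negPf (neq_lift _ _)).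
  - by rewrite Fd (negPf (neq_lift _ _)).
  - by rewrite Fh eqxx.
have rE : (forall i, lam i x = 0) -> r x = x.
  by move=> l0; rewrite /r big1 ?subr0 // => i _; rewrite l0 scale0r.
split=> [Ux i|l0].
  have l0 : forall i, lam i x = 0.
    by apply/UE; exists 0; rewrite scale0r subr0.
  by case: unliftP => [j _|_]; rewrite ?l0 //; apply: fU; rewrite scale0r subr0 rE.
have l0' : forall i, lam i x = 0.
  by move=> i; have := l0 (lift ord0 i); rewrite liftK.
have := l0 ord0; rewrite unlift_none => F0.
by have := fP x; rewrite rE // (_ : f x = 0) ?scale0r ?subr0.
Qed.

Lemma exists_dual U (T : finType) (s : T -> E) :
  subspace U -> spanned U s -> exists e, has_dual U e.
Proof.
move=> sU Us; apply: (@exists_dual_seq _ [seq s t | t <- enum T]) => // x.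
have [c Uc] := Us x.
pose c' i := if insub i is Some j then c (enum_val (j : 'I_#|T|)) else 0.
exists c'; move: Uc; rewrite sum_enum_val.
rewrite size_map -cardE; congr (U (_ - _)); apply: eq_bigr => i _.
rewrite /c' valK; congr (_ *: _).
by rewrite (nth_map (enum_default i)) -?cardE // -[nth _ _ _]/(enum_val i).
Qed.

(** The identity matrix of size e factors through the coefficients on s. *)
Lemma has_dual_le_span U e (T : finType) (s : T -> E) :
  has_dual U e -> spanned U s -> (e <= #|T|)%N.
Proof.
move=> [d [lam [dE UE]]] Us.
have [c cP] := choice (fun j => Us (d j)).
pose C := \matrix_(j < e, a < #|T|) c j (enum_val a).
pose L := \matrix_(a < #|T|, i < e) (lam i (s (enum_val a)) : K).
have CL : C *m L = 1%:M.
  apply/matrixP => j i; rewrite !mxE.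
  have /UE/(_ i) := cP j; rewrite linearB linear_sum dE => /eqP.
  rewrite subr_eq0 (eq_sym j) => /eqP ->.
  rewrite [RHS]sum_enum_val; apply: eq_bigr => a _.
  by rewrite !mxE linearZ.
have := mulmx_max_rank C L; rewrite CL mxrank1 => /leq_trans; apply.
exact: leqnn.
Qed.

Lemma has_dual_ge_indep U e (T : finType) (w : T -> E) :
  has_dual U e -> independent_mod U w -> (#|T| <= e)%N.
Proof.
move=> [d [lam [dE UE]]] ind.
pose L := \matrix_(a < #|T|, i < e) (lam i (w (enum_val a)) : K).
suff: row_free L by move/eqP=> <-; apply: rank_leq_col.
rewrite -kermx_eq0; apply/eqP/row_matrixP => i; rewrite row0.
have : row i (kermx L) *m L = 0 by apply/sub_kermxP/row_sub.
set u := row _ _ => uL; apply/rowP => a; rewrite [RHS]mxE.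
have := ind (fun t => u 0 (enum_rank t)) _ (enum_val a); rewrite enum_valK; apply.
apply/UE => j; rewrite linear_sum.
have := congr1 (fun M : 'rV_e => M 0 j) uL; rewrite !mxE => E0; rewrite -[RHS]E0.
rewrite [LHS]sum_enum_val.
by apply: eq_bigr => b _; rewrite linearZ /= enum_valK mxE [L b j]mxE.
Qed.

End FiniteCodimension.

(** Dimensions are compared through numbers of monomials of bounded degree, which
    are known up to constant factors only. *)
Lemma leq_growth a b C : (forall k, 0 < k -> k ^ a <= C * k ^ b)%N -> (a <= b)%N.
Proof.
move=> H; rewrite leqNgt; apply/negP => lt_ba.
have := H C.+1 isT; apply/negP; rewrite -ltnNge.
apply: (@leq_trans (C.+1 ^ b.+1)); last exact: leq_pexp2l.
by rewrite expnS ltn_pmul2r // expn_gt0.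
Qed.

(** * Intersection of two thickened subschemes of an affine space *)

Lemma mcoeffMXU (n : nat) (R : nzRingType) (p : {mpoly R[n]}) i m :
  (p * 'X_i)@_m = if m i == 0%N then 0 else p@_(m - U_(i))%MM.
Proof.
case: eqP => mi; last first.
  have {1}-> : m = (U_(i) + (m - U_(i)))%MM.
    by rewrite addmC submK // lep1mP; apply/eqP.
  by rewrite mcoeffMX.
apply: memN_msupp_eq0; rewrite (perm_mem (msuppMX _ _)); apply/negP => /mapP[m' _].
by move/mnmP/(_ i); rewrite mnmDE mnm1E eqxx mi.
Qed.

Section OrderAtOrigin.
Variables (n : nat) (R : comNzRingType).

(** The k-th power of the ideal of the origin. *)
Definition ord_ge (k : nat) : set {mpoly R[n]} :=
  [set p | forall m, (mdeg m < k)%N -> p@_m = 0].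

Lemma ord_ge_ideal k : is_ideal setT (ord_ge k).
Proof.
split=> //.
- by move=> m _; rewrite mcoeff0.
- by move=> x y x0 y0 m mk; rewrite mcoeffD x0 ?y0 ?addr0.
- move=> a x _ x0 m mk; rewrite mcoeffM big1 // => -[m1 m2] /= /eqP E.
  have := congr1 (@mdeg n) E; rewrite mdegD => Em.
  by rewrite x0 ?mulr0 //; lia.
Qed.

Lemma ord_geX k m : (k <= mdeg m)%N -> ord_ge k 'X_[m].
Proof.
move=> km m' m'k; rewrite mcoeffX; case: eqP => // E.
by move: km; rewrite E leqNgt m'k.
Qed.

Lemma ord_geM a b p q : ord_ge a p -> ord_ge b q -> ord_ge (a + b) (p * q).
Proof.
move=> pa qb m mab; rewrite mcoeffM big1 // => -[m1 m2] /= /eqP E.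
have [m1a|am1] := ltnP (mdeg m1) a; first by rewrite pa ?mul0r.
have := congr1 (@mdeg n) E; rewrite mdegD => Em.
by rewrite qb ?mulr0 //; lia.
Qed.

End OrderAtOrigin.
Arguments ord_ge {n R} k.

Lemma ideal_subspace (K : fieldType) n (I : set {mpoly K[n]}) :
  is_ideal setT I -> subspace I.
Proof.
case=> _ I0 ID IM; split=> // a x y Ix Iy; apply: ID => //.
by rewrite -mul_mpolyC; apply: IM.
Qed.

Lemma spanned_ord_ge (K : fieldType) n N :
  spanned (ord_ge N) (fun m : 'X_{1..n < N} => 'X_[m] : {mpoly K[n]}).
Proof.
move=> p; exists (fun m : 'X_{1..n < N} => p@_m) => m lt_m.
rewrite mcoeffB raddf_sum /= (bigD1 (BMultinom lt_m)) //= mcoeffZ mcoeffX eqxx mulr1.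
rewrite big1 ?addr0 ?subrr // => m' mm'; rewrite mcoeffZ mcoeffX.
case: eqP => [E|_]; last by rewrite mulr0.
by case/eqP: mm'; apply: val_inj.
Qed.

Section LinearExtension.
Variables (n : nat) (R : nzRingType) (V : zmodType).
Variable F : 'X_{1..n} -> {additive R -> V}.

Definition lin_ext (p : {mpoly R[n]}) : V := \sum_(m <- msupp p) F m p@_m.

Lemma lin_extE p k : (msize p <= k)%N ->
  lin_ext p = \sum_(m : 'X_{1..n < k}) F m p@_m.
Proof.
move=> le_pk; pose I := 'X_{1..n < k}.
rewrite /lin_ext (big_mksub I) //=; first last.
  by move=> x /msize_mdeg_lt /leq_trans; apply.
  by rewrite msupp_uniq.
rewrite big_rmcond //= => j /memN_msupp_eq0 ->.
by rewrite raddf0.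
Qed.

Lemma lin_extB p q : lin_ext (p - q) = lin_ext p - lin_ext q.
Proof.
pose k := maxn (msize (p - q)) (maxn (msize p) (msize q)).
rewrite !(@lin_extE _ k) ?leq_max ?leqnn ?orbT // -sumrB.
by apply: eq_bigr => m _; rewrite mcoeffB raddfB.
Qed.

End LinearExtension.

Section Intersection.
Variables (K : fieldType) (d N : nat).
Notation D := {mpoly K[d]}.
Notation B := {mpoly D[d]}.

(** B is the ring of polynomials in two groups of variables, z and z': the
    variables z' are those of the coefficients. The map [inl_var] writes a
    polynomial in the variables z, and [on_diag] restricts to the diagonal z = z'. *)
Definition inl_var : D -> B := map_mpoly (@mpolyC d K).
Definition diff_var (i : 'I_d) : B := 'X_i - ('X_i : D)%:MP.
Definition on_diag : B -> D := meval (fun i => 'X_i : D).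

Lemma on_diag_inl p : on_diag (inl_var p) = p.
Proof.
apply: (@rmorph_mpoly_eq d K D (on_diag \o inl_var) idfun) => [c|i].
  by rewrite /= /inl_var map_mpolyC /on_diag mevalC.
by rewrite /= /inl_var map_mpolyX /on_diag mevalXU.
Qed.

Lemma diag_decomp (b : B) :
  exists c : 'I_d -> B, b = (on_diag b)%:MP + \sum_i diff_var i * c i.
Proof. exact: taylor. Qed.

Variables (U1 U2 : set D).
Hypotheses (I1 : is_ideal setT U1) (I2 : is_ideal setT U2).
Hypotheses (N1 : ord_ge N `<=` U1) (N2 : ord_ge N `<=` U2).

Section Forms.
Variables (e1 e2 : nat).
Variables (lam : 'I_e1 -> {linear D -> K^o}) (mu : 'I_e2 -> {linear D -> K^o}).
Hypotheses (lamE : forall x, U1 x <-> forall i, lam i x = 0).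
Hypotheses (muE : forall x, U2 x <-> forall i, mu i x = 0).

Definition form_term (m : 'X_{1..d}) (g : D) : 'M[K]_(e1, e2) :=
  \matrix_(i, j) (lam i 'X_[m] * mu j g).

Lemma form_term_additive m : additive (form_term m).
Proof. by move=> x y; apply/matrixP => i j; rewrite !mxE linearB mulrBr. Qed.

HB.instance Definition _ m :=
  GRing.isAdditive.Build D 'M[K]_(e1, e2) (form_term m) (@form_term_additive m).

(** The tensor product of the two families of functionals, on B seen as the tensor
    square of D; it vanishes on the ideal generated by U1 in the variables z and by
    U2 in the variables z'. *)
Definition form (b : B) : 'M[K]_(e1, e2) := lin_ext form_term b.

Lemma form_additive : additive form.
Proof. by move=> x y; apply: lin_extB. Qed.

HB.instance Definition _ :=
  GRing.isAdditive.Build B 'M[K]_(e1, e2) form form_additive.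

Lemma form_tensor h g :
  form (inl_var h * g%:MP) = \matrix_(i, j) (lam i h * mu j g).
Proof.
rewrite mulrC mul_mpolyC /form.
pose k := maxn (msize (g *: inl_var h)) (msize h).
rewrite (@lin_extE _ _ _ _ _ k) ?leq_maxl //.
apply/matrixP => i j; rewrite summxE mxE.
rewrite [in RHS](mpolywE (leq_maxr (msize (g *: inl_var h)) (msize h))) -/k.
rewrite [in RHS]linear_sum mulr_suml; apply: eq_bigr => m _.
rewrite mxE mcoeffZ mcoeff_map_mpoly [g * _]mulrC mul_mpolyC !linearZ /=.
by rewrite /GRing.scale /= -!mulrA mulrCA.
Qed.

Lemma form_left u b : U1 u -> form (inl_var u * b) = 0.
Proof.
move=> Uu; rewrite (mpolyE b) mulr_sumr raddf_sum big1 // => m _.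
rewrite -mul_mpolyC mulrCA mulrC.
rewrite (_ : 'X_[m] = inl_var 'X_[m]); last by rewrite /inl_var map_mpolyX.
rewrite /inl_var -rmorphM /= -/(inl_var _) form_tensor; apply/matrixP => i j; rewrite !mxE.
by case: I1 => _ _ _ IM; have := IM 'X_[m] u I Uu; rewrite mulrC => /lamE ->; rewrite mul0r.
Qed.

Lemma form_right u b : U2 u -> form (u%:MP * b) = 0.
Proof.
move=> Uu; rewrite mul_mpolyC /form /lin_ext big1 // => m _.
rewrite mcoeffZ; apply/matrixP => i j; rewrite !mxE.
case: I2 => _ _ _ IM; have := IM (b@_m) u I Uu; rewrite mulrC => /muE ->.
by rewrite mulr0.
Qed.

(** The order at the origin with respect to z and z' together. *)
Definition total_ord (s : nat) : set B :=
  [set b | forall m, ord_ge (s - mdeg m) b@_m].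

Lemma total_ord_diff s i b : total_ord s b -> total_ord s.+1 (diff_var i * b).
Proof.
move=> sb m; rewrite /diff_var mulrBl mcoeffB mcoeffCM mulrC mcoeffMXU.
have [_ _ ID IM] := @ord_ge_ideal d K (s.+1 - mdeg m).
apply: ID; last first.
  rewrite -mulN1r; apply: IM => // m' m'k; rewrite mulrC mcoeffMXU.
  case: eqP => // /eqP m'i; apply: sb.
  have := lep1mP i m'; rewrite m'i => le.
  have := congr1 (@mdeg d) (submK le); rewrite mdegD mdeg1 addn1 => E.
  by move: m'k; rewrite -E; lia.
case: eqP => [_|/eqP mi]; first by move=> m' _; rewrite mcoeff0.
move=> m' m'k; apply: sb; apply: leq_trans m'k _.
have := lep1mP i m; rewrite mi => le.
have := congr1 (@mdeg d) (submK le); rewrite mdegD mdeg1 addn1 => <-.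
by rewrite subSS.
Qed.

(** A monomial of degree N + N has degree at least N in z or in z'. *)
Lemma form_total_ord b : total_ord (N + N) b -> form b = 0.
Proof.
move=> b0; rewrite /form /lin_ext big1 // => m _.
apply/matrixP => i j; rewrite !mxE.
have [le_Nm|lt_mN] := leqP N (mdeg m).
  by have /N1/lamE -> := @ord_geX d K N m le_Nm; rewrite mul0r.
suff /N2/muE -> : ord_ge N b@_m by rewrite mulr0.
by move=> m' m'N; apply: b0; lia.
Qed.

End Forms.

(** The tensor product of the quotients by U1 and by U2 has dimension e1 * e2.
    Filter it by the powers of the ideal of the diagonal: on the diagonal it becomes
    the quotient by U1 + U2, which s spans, hence it is spanned by the multiples of
    s by monomials in the differences z_i - z'_i, and those of degree at least N + N
    vanish. In terms of dimensions this is the inequality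
    codim (X :&: Y) <= codim X + codim Y of regular rings. *)
Lemma intersection_codim (T : finType) (s : T -> D) e1 e2 :
  has_dual U1 e1 -> has_dual U2 e2 ->
  (forall x, exists c : T -> K, exists u1 u2,
     [/\ U1 u1, U2 u2 & x = \sum_t c t *: s t + u1 + u2]) ->
  (e1 * e2 <= (N + N) ^ d * #|T|)%N.
Proof.
move=> [d1 [lam [d1E lamE]]] [d2 [mu [d2E muE]]] sP.
pose W := 'M[K]_(e1, e2).
pose om : {additive B -> W} := form lam mu.
have omL u b : U1 u -> om (inl_var u * b) = 0 by exact: form_left.
have omR u b : U2 u -> om (u%:MP * b) = 0 by exact: form_right.
have omT h g : om (inl_var h * g%:MP) = \matrix_(i, j) (lam i h * mu j g).
  exact: form_tensor.
have omO b : total_ord (N + N) b -> om b = 0 by exact: form_total_ord.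
pose J := ({ffun 'I_d -> 'I_(N + N)} * T)%type.
pose xp (m : 'X_{1..d}) := mmap1 diff_var m.
pose gen (a : J) : W := om (xp [multinom (a.1 i : nat) | i < d] * (s a.2)%:MP).
pose Sp : set W := [set w : W | exists c : J -> K, w = \sum_a c a *: gen a].
have SpD x y : Sp x -> Sp y -> Sp (x + y).
  move=> [c ->] [c' ->]; exists (fun a => c a + c' a).
  by rewrite -big_split; apply: eq_bigr => a _; rewrite scalerDl.
have SpN x : Sp x -> Sp (- x).
  move=> [c ->]; exists (fun a => - c a).
  by rewrite -sumrN; apply: eq_bigr => a _; rewrite scaleNr.
have Sp0 : Sp 0 by exists (fun=> 0); rewrite big1 // => a _; rewrite scale0r.
have Sp_sum (I : finType) (F : I -> W) : (forall i, Sp (F i)) -> Sp (\sum_i F i).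
  by move=> SF; elim/big_ind: _; [exact: Sp0 | exact: (SpD) | ].
have omZ c b : om (c%:MP *: b) = c *: om b.
  apply/matrixP => i j; rewrite mxE /om /= /form /lin_ext.
  have [->|c_n0] := eqVneq c 0.
    by rewrite mpolyC0 scale0r msupp0 big_nil mxE mul0r.
  rewrite (perm_big _ (msuppZ _ _)) ?mpolyC_eq0 // !summxE mulr_sumr.
  apply: eq_bigr => m _; rewrite !mxE mcoeffZ mul_mpolyC linearZ /=.
  by rewrite /GRing.scale /= mulrCA.
have xpS m i : xp (U_(i) + m)%MM = diff_var i * xp m.
  rewrite /xp commr_mmap1_M ?mmap1U // => *; exact: mulrC.
have xp_ord k m b : mdeg m = k -> total_ord k (xp m * b).
  elim: k m => [|k IH] m mk; first by move=> m' m''; rewrite sub0n.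
  have [i mi] : exists i, m i != 0%N.
    apply/existsP; rewrite -negb_forall; apply/negP => /forallP m0.
    move: mk; rewrite mdegE big1 // => i _; exact/eqP.
  have le : (U_(i) <= m)%MM by rewrite lep1mP.
  rewrite -(submK le) addmC xpS -mulrA; apply: total_ord_diff; apply: (IH).
  by have := congr1 (@mdeg d) (submK le); rewrite mdegD mdeg1 mk addn1 => -[].
(* Descending induction on the degree of m. *)
have Sp_xp k m b : (N + N <= mdeg m + k)%N -> Sp (om (xp m * b)).
  elim: k m b => [|k IH] m b.
    rewrite addn0 => le; rewrite omO //.
    move=> m' m'' lt; apply: (xp_ord _ _ _ erefl); apply: leq_trans lt _; exact: leq_sub2r.
  move=> le; have [/IH//|lt] := leqP (N + N) (mdeg m + k).
  have IH' i c : Sp (om (xp m * (diff_var i * c))).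
    rewrite mulrCA mulrA -xpS; apply: (IH); rewrite mdegD mdeg1; lia.
  have SpX (c : 'I_d -> B) : Sp (om (xp m * \sum_i diff_var i * c i)).
    by rewrite mulr_sumr raddf_sum; apply: (Sp_sum).
  have [c ->] := diag_decomp b; rewrite mulrDr raddfD; apply: (SpD) => //.
  have [a [u1 [u2 [Uu1 Uu2 ->]]]] := sP (on_diag b).
  rewrite !mpolyCD !mulrDr !raddfD; apply: (SpD); last first.
    by rewrite mulrC omR.
  apply: (SpD); last first.
    (* Up to differences z_i - z'_i, u1 may be written in z instead of z'. *)
    have [c' E] := diag_decomp (inl_var u1).
    have -> : u1%:MP = inl_var u1 - \sum_i diff_var i * c' i.
      by rewrite {1}E on_diag_inl addrK.
    rewrite mulrBr raddfB; apply: (SpD); last exact: (SpN).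
    by rewrite mulrC omL.
  rewrite rmorph_sum mulr_sumr raddf_sum; apply: (Sp_sum) => t.
  have mlt i : (m i < N + N)%N.
    apply: leq_ltn_trans (_ : (mdeg m < _)%N); last lia.
    by rewrite mdegE (bigD1 i) //= leq_addr.
  pose al : {ffun 'I_d -> 'I_(N + N)} := [ffun i => Ordinal (mlt i)].
  exists (fun j => if j == (al, t) then a t else 0).
  rewrite (bigD1 (al, t)) //= eqxx big1 ?addr0; last first.
    by move=> j /negPf->; rewrite scale0r.
  rewrite /gen /= -omZ; congr (om _).
  rewrite -!mul_mpolyC mpolyCM mulrCA; congr (_ * (xp _ * _)).
  by apply/mnmP => i; rewrite mnmE ffunE.
have sub0 : subspace [set w : W | w = 0].
  by split=> // a x y -> ->; rewrite scaler0 addr0.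
have spW : spanned [set w : W | w = 0] gen.
  move=> w.
  pose b : B := \sum_i \sum_j (inl_var (d1 i) * (w i j *: d2 j)%:MP).
  have -> : w = om b.
    apply/matrixP => i j; rewrite raddf_sum summxE (bigD1 i) //= [X in _ + X]big1.
      rewrite addr0 raddf_sum summxE (bigD1 j) //= big1.
        rewrite addr0 omT mxE d1E linearZ /= d2E !eqxx.
        by rewrite /GRing.scale /= mul1r mulr1.
      move=> j' /negPf jj; rewrite omT mxE linearZ /= d2E eq_sym jj.
      by rewrite /GRing.scale /= !mulr0.
    move=> i' /negPf ii; rewrite raddf_sum summxE big1 // => j' _.
    by rewrite omT mxE d1E eq_sym ii mul0r.
  have [c E] := @Sp_xp (N + N) 0%MM b (leq_addl _ _).
  exists c; apply/eqP; rewrite subr_eq0; apply/eqP; rewrite -E.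
  by rewrite /xp mmap11 mul1r.
have [e he] := exists_dual sub0 spW.
have le_e : (e <= (N + N) ^ d * #|T|)%N.
  by have := has_dual_le_span he spW; rewrite card_prod card_ffun !card_ord.
apply: leq_trans le_e.
have := @has_dual_ge_indep _ _ _ _ ('I_e1 * 'I_e2)%type
  (fun ij => delta_mx ij.1 ij.2 : W) he.
rewrite card_prod !card_ord; apply => c E [i j].
have := congr1 (fun M : W => M i j) E; rewrite mxE summxE (bigD1 (i, j)) //=.
rewrite !mxE !eqxx mulr1 big1 ?addr0 // => -[i' j'].
rewrite xpair_eqE !mxE /= !(eq_sym i) !(eq_sym j) => /negPf.
by case: (i' == i); case: (j' == j) => //=; rewrite mulr0.
Qed.

End Intersection.

(** * Powers of ideals *)

Section IdealPowers.
Variables (L : comNzRingType) (R : set L).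

Definition subring_set : Prop :=
  [/\ R 1, (forall x y, R x -> R y -> R (x - y)) &
      (forall x y, R x -> R y -> R (x * y))].

Hypothesis subR : subring_set.

Lemma sub_R1 : R 1. Proof. by case: subR. Qed.
Lemma sub_RB x y : R x -> R y -> R (x - y). Proof. by case: subR => _ + _; apply. Qed.
Lemma sub_RM x y : R x -> R y -> R (x * y). Proof. by case: subR => _ _; apply. Qed.
Lemma sub_R0 : R 0. Proof. by rewrite -(subrr 1); apply: sub_RB; apply: sub_R1. Qed.
Lemma sub_RN x : R x -> R (- x).
Proof. by move=> Rx; rewrite -sub0r; apply: sub_RB => //; apply: sub_R0. Qed.
Lemma sub_RD x y : R x -> R y -> R (x + y).
Proof. by move=> Rx Ry; rewrite -[y]opprK; apply: sub_RB => //; apply: sub_RN. Qed.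
Lemma sub_R_sum (I : Type) (r : seq I) (P : pred I) (F : I -> L) :
  (forall i, P i -> R (F i)) -> R (\sum_(i <- r | P i) F i).
Proof. by move=> RF; elim/big_ind: _ => //; [exact: sub_R0 | exact: sub_RD]. Qed.
Lemma sub_R_prod (I : Type) (r : seq I) (P : pred I) (F : I -> L) :
  (forall i, P i -> R (F i)) -> R (\prod_(i <- r | P i) F i).
Proof. by move=> RF; elim/big_ind: _ => //; [exact: sub_R1 | exact: sub_RM]. Qed.
Lemma sub_RX x k : R x -> R (x ^+ k).
Proof.
by move=> Rx; elim: k => [|k IH]; rewrite ?expr0 ?exprS; [exact: sub_R1 | exact: sub_RM].
Qed.

Implicit Types (I J : set L).

Lemma idealR I x : is_ideal R I -> I x -> R x. Proof. by case=> s _ _ _; apply: s. Qed.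
Lemma ideal0 I : is_ideal R I -> I 0. Proof. by case. Qed.
Lemma idealD I x y : is_ideal R I -> I x -> I y -> I (x + y).
Proof. by case=> _ _ + _; apply. Qed.
Lemma idealMl I a x : is_ideal R I -> R a -> I x -> I (a * x).
Proof. by case=> _ _ _; apply. Qed.
Lemma idealMr I a x : is_ideal R I -> R a -> I x -> I (x * a).
Proof. by rewrite mulrC; apply: idealMl. Qed.
Lemma idealN I x : is_ideal R I -> I x -> I (- x).
Proof.
move=> idI Ix; rewrite -mulN1r; apply: idealMl => //; apply: sub_RN.
exact: sub_R1.
Qed.
Lemma idealB I x y : is_ideal R I -> I x -> I y -> I (x - y).
Proof. by move=> idI Ix Iy; apply: idealD => //; apply: idealN. Qed.
Lemma ideal_sum I (T : Type) (r : seq T) (P : pred T) (F : T -> L) :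
  is_ideal R I -> (forall i, P i -> I (F i)) -> I (\sum_(i <- r | P i) F i).
Proof.
move=> idI IF; elim/big_ind: _ => //; first exact: ideal0.
by move=> x y; apply: idealD.
Qed.

Lemma ideal_gen_ideal (S : set L) : S `<=` R -> is_ideal R (ideal_gen R S).
Proof.
move=> SR; split.
- move=> x [s [sP ->]]; rewrite big_seq; apply: sub_R_sum => p /sP[Rp Sp].
  by apply: sub_RM => //; apply: SR.
- by exists [::]; rewrite big_nil.
- move=> x y [s [sP ->]] [t [tP ->]]; exists (s ++ t); rewrite big_cat; split=> // p.
  by rewrite mem_cat => /orP[/sP|/tP].
- move=> a x Ra [s [sP ->]]; exists [seq (a * p.1, p.2) | p <- s]; split.
    by move=> _ /mapP[p /sP[Rp Sp] ->]; split=> //=; apply: sub_RM.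
  by rewrite big_map mulr_sumr; apply: eq_bigr => p _; rewrite mulrA.
Qed.

Lemma sub_ideal_gen (S : set L) : S `<=` ideal_gen R S.
Proof.
move=> x Sx; exists [:: (1, x)]; rewrite big_seq1 mul1r; split=> // p.
by rewrite inE => /eqP ->; split=> //; apply: sub_R1.
Qed.

Lemma ideal_gen_min J (S : set L) : is_ideal R J -> S `<=` J -> ideal_gen R S `<=` J.
Proof.
move=> idJ SJ x [s [sP ->]]; rewrite big_seq; apply: ideal_sum => // p /sP[Rp Sp].
by apply: idealMl => //; apply: SJ.
Qed.

Lemma ideal_gen_range (T : finType) (a : T -> L) x : ideal_gen R (range a) x ->
  exists c : T -> L, (forall t, R (c t)) /\ x = \sum_t a t * c t.
Proof.
move=> [s [+ ->]]; elim: s => [_|p s IH sP].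
  exists (fun=> 0); rewrite big_nil big1 => [|t _]; rewrite ?mulr0 //.
  by split=> // t; apply: sub_R0.
have [|c [Rc E]] := IH.
  by move=> q qs; apply: sP; rewrite inE qs orbT.
have [Rp [t _ tE]] := sP p (mem_head _ _).
exists (fun t' => (t' == t)%:R * p.1 + c t'); split.
  move=> t'; apply: sub_RD => //; case: eqP => _; rewrite ?mul1r ?mul0r //.
  exact: sub_R0.
rewrite big_cons E -tE [RHS](eq_bigr (fun t' => a t' * ((t' == t)%:R * p.1) + a t' * c t')).
  rewrite big_split /= [in RHS](bigD1 t) //= eqxx mul1r [a t * _]mulrC.
  by rewrite [X in _ + X + _]big1 ?addr0 // => t' /negPf ->; rewrite mul0r mulr0.
by move=> t' _; rewrite mulrDr.
Qed.

Variables (I : set L) (idI : is_ideal R I).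

Let prod_sub k :
  [set x | exists y : 'I_k -> L, (forall i, I (y i)) /\ x = \prod_(i < k) y i] `<=` R.
Proof. by move=> x [y [Iy ->]]; apply: sub_R_prod => i _; apply: (idealR idI). Qed.

Lemma ideal_exp_ideal k : is_ideal R (ideal_exp R I k).
Proof. exact: ideal_gen_ideal. Qed.

Lemma ideal_exp0 x : R x -> ideal_exp R I 0 x.
Proof.
move=> Rx; rewrite -[x]mulr1; apply: idealMl => //; first exact: ideal_exp_ideal.
apply: sub_ideal_gen; exists (fun=> 0); rewrite big_ord0; split=> // -[].
by [].
Qed.

Lemma ideal_expS k a b : I a -> ideal_exp R I k b -> ideal_exp R I k.+1 (a * b).
Proof.
move=> Ia [s [sP ->]]; rewrite big_seq mulr_sumr.
apply: ideal_sum => [|p /sP[Rp [y [Iy yE]]]]; first exact: ideal_exp_ideal.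
rewrite mulrCA; apply: idealMl => //; first exact: ideal_exp_ideal.
apply: sub_ideal_gen; exists (fun i => if unlift ord0 i is Some j then y j else a).
split; first by move=> i; case: unliftP => [j _|_] //.
rewrite big_ord_recl unlift_none yE; congr (_ * _); apply: eq_bigr => i _.
by rewrite liftK.
Qed.

(** With [ideal_expS], this describes the power I^(k+1) as the ideal generated by
    the products of an element of I and an element of I^k. *)
Lemma ideal_expS_min k J : is_ideal R J ->
  (forall a b, I a -> ideal_exp R I k b -> J (a * b)) -> ideal_exp R I k.+1 `<=` J.
Proof.
move=> idJ H; apply: ideal_gen_min => // x [y [Iy ->]].
rewrite big_ord_recl; apply: H => //; apply: sub_ideal_gen.
by exists (fun i => y (lift ord0 i)).
Qed.

Lemma ideal_exp1 x : ideal_exp R I 1 x <-> I x.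
Proof.
split=> [|Ix].
  apply: ideal_expS_min => // a b Ia Rb; apply: idealMr => //.
  exact: idealR (ideal_exp_ideal 0) Rb.
rewrite -[x]mulr1; apply: ideal_expS => //; apply: ideal_exp0; exact: sub_R1.
Qed.

Lemma ideal_exp_le j k : (j <= k)%N -> ideal_exp R I k `<=` ideal_exp R I j.
Proof.
elim: j k => [|j IH] [|k] // jk x.
- by move=> Ix; apply: ideal_exp0; apply: idealR Ix; apply: ideal_exp_ideal.
- by move=> Ix; apply: ideal_exp0; apply: idealR Ix; apply: ideal_exp_ideal.
apply: ideal_expS_min; first exact: ideal_exp_ideal.
by move=> a b Ia /(IH _ jk); apply: ideal_expS.
Qed.

Lemma ideal_expM j k a b :
  ideal_exp R I j a -> ideal_exp R I k b -> ideal_exp R I (j + k) (a * b).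
Proof.
move=> + Ib; elim: j a => [|j IH] a Ia.
  apply: idealMl => //; first exact: ideal_exp_ideal.
  exact: idealR (ideal_exp_ideal 0) Ia.
have Rb : R b by exact: idealR (ideal_exp_ideal k) Ib.
have idJ : is_ideal R [set x | R x /\ ideal_exp R I (j.+1 + k) (x * b)].
  split; first by move=> x [].
  - by split; rewrite ?mul0r; [exact: sub_R0 | exact: ideal0 (ideal_exp_ideal _)].
  - move=> x y [Rx Ix] [Ry Iy]; rewrite /= mulrDl; split; first exact: sub_RD.
    by apply: idealD => //; apply: ideal_exp_ideal.
  - move=> c x Rc [Rx Ix]; rewrite /= -mulrA; split; first exact: sub_RM.
    by apply: idealMl => //; apply: ideal_exp_ideal.
suff [] : [set x | R x /\ ideal_exp R I (j.+1 + k) (x * b)] a by [].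
apply: ideal_expS_min Ia => // c d Ic Id; split.
  by apply: sub_RM; [exact: idealR Ic | exact: idealR (ideal_exp_ideal j) Id].
by rewrite -mulrA addSn; apply: ideal_expS => //; apply: IH.
Qed.

Lemma ideal_expS_fg (T : finType) (a : T -> L) k x :
  I = ideal_gen R (range a) -> ideal_exp R I k.+1 x ->
  exists c : T -> L, (forall t, ideal_exp R I k (c t)) /\ x = \sum_t a t * c t.
Proof.
move=> Igen; move: x.
set J := [set x | exists c : T -> L, (forall t, ideal_exp R I k (c t)) /\ x = \sum_t a t * c t].
have IRa t : R (a t).
  by apply: (idealR idI); rewrite Igen; apply: sub_ideal_gen; exists t.
have idk := ideal_exp_ideal k.
have idJ : is_ideal R J.
  split.
  - move=> x [c [Ic ->]]; apply: sub_R_sum => t _; apply: sub_RM => //.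
    exact: idealR (Ic t).
  - exists (fun=> 0); split=> [t|]; first exact: ideal0.
    by rewrite big1 // => t _; rewrite mulr0.
  - move=> x y [c [Ic ->]] [c' [Ic' ->]]; exists (fun t => c t + c' t); split.
      by move=> t; apply: idealD.
    by rewrite -big_split; apply: eq_bigr => t _; rewrite mulrDr.
  - move=> r x Rr [c [Ic ->]]; exists (fun t => r * c t); split.
      by move=> t; apply: idealMl.
    by rewrite mulr_sumr; apply: eq_bigr => t _; rewrite mulrCA.
apply: ideal_expS_min => // b c Ib Ic.
rewrite Igen in Ib; have [d [Rd ->]] := ideal_gen_range Ib.
exists (fun t => d t * c); split; first by move=> t; apply: idealMl.
by rewrite mulr_suml; apply: eq_bigr => t _; rewrite mulrA.
Qed.

End IdealPowers.
Arguments ideal_sum {L R I T r P F}.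
Arguments sub_R_sum {L R} subR {I r P F}.
Arguments sub_R_prod {L R} subR {I r P F}.

(** * The local ring at a point *)

Definition subalg_set (K : fieldType) n (A : set {mpoly K[n]}) : Prop :=
  subring_set A /\ forall c, A c%:MP.

(** If c is an inverse of b modulo an ideal, a * c approximates a / b modulo it. *)
Fact approx_identity (F : fieldType) (a b c : F) :
  b != 0 -> a / b - a * c = - (a / b) * (b * c - 1).
Proof. by move=> b0; field. Qed.

Section LocalRing.
Variables (K : fieldType) (n : nat) (A : set {mpoly K[n]}) (x : point A).
Hypothesis algA : subalg_set A.
Let subA : subring_set A. Proof. by case: algA. Qed.
Local Notation P := (proj1_sig x).
Local Notation O := (local_ring x).
Local Notation m := (local_max x).
Local Notation "f %:F" := (tofrac (f : {mpoly K[n]}) : ratfun K n) (at level 1, format "f %:F").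

Lemma point_ideal : is_ideal A P. Proof. by case: x => Q []. Qed.
Lemma point_not1 : ~ P 1. Proof. by case: x => Q []. Qed.
Let idP := point_ideal.

Lemma point_inv f : A f -> ~ P f -> exists2 g, A g & P (f * g - 1).
Proof.
move=> Af Pf.
pose J : set {mpoly K[n]} := [set h | exists p a, [/\ P p, A a & h = p + f * a]].
have idJ : is_ideal A J.
  split.
  - move=> h [p [a [Pp Aa ->]]]; apply: (sub_RD subA); first exact: idealR Pp.
    exact: (sub_RM subA).
  - exists 0, 0; rewrite mulr0 addr0; split=> //; first exact: ideal0 idP.
    exact: sub_R0.
  - move=> h h' [p [a [Pp Aa ->]]] [p' [a' [Pp' Aa' ->]]].
    exists (p + p'), (a + a'); rewrite mulrDr addrACA; split=> //.
      exact: (idealD idP).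
    exact: sub_RD.
  - move=> c h Ac [p [a [Pp Aa ->]]]; exists (c * p), (c * a).
    by rewrite mulrDr mulrCA; split=> //; [exact: (idealMl idP) | exact: sub_RM].
have PJ : P `<=` J.
  by move=> p Pp; exists p, 0; rewrite mulr0 addr0; split=> //; apply: sub_R0.
have Jf : J f.
  exists 0, 1; rewrite mulr1 add0r; split=> //; first exact: ideal0 idP.
  exact: sub_R1.
have [p [a [Pp Aa E]]] : J 1.
  apply/not_notP => J1; apply: Pf.
  by case: (proj2_sig x) => _ _ /(_ J idJ J1 PJ); apply.
exists a => //; have -> : f * a - 1 = - p by rewrite E opprD addrC subrK.
exact: (idealN subA).
Qed.

Lemma point_prime f g : A f -> A g -> P (f * g) -> P f \/ P g.
Proof.
move=> Af Ag Pfg; have [|Pf] := EM (P f); [by left|right].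
have [h Ah Ph] := point_inv Af Pf.
have -> : g = h * (f * g) - g * (f * h - 1) by ring.
by apply: (idealB subA); [exact: idP | exact: (idealMl idP) | exact: (idealMl idP)].
Qed.

Lemma point_n0 f : ~ P f -> f%:F != 0.
Proof.
by move=> Pf; rewrite tofrac_eq0; apply/eqP => f0; apply: Pf; rewrite f0; apply: ideal0 idP.
Qed.

Lemma point_mulN f g : A f -> A g -> ~ P f -> ~ P g -> ~ P (f * g).
Proof. by move=> Af Ag Pf Pg /(point_prime Af Ag)[]. Qed.

Lemma local_tofrac f : A f -> O f%:F.
Proof.
move=> Af; exists f, 1; rewrite tofrac1 divr1; split=> //; first exact: sub_R1.
exact: point_not1.
Qed.

Lemma local_subring : subring_set O.
Proof.
split; first by have := local_tofrac (sub_R1 subA); rewrite tofrac1.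
- move=> _ _ [f [g [Af Ag Pg ->]]] [f' [g' [Af' Ag' Pg' ->]]].
  exists (f * g' - f' * g), (g * g'); split.
  + by apply: (sub_RB subA); apply: (sub_RM subA).
  + exact: (sub_RM subA).
  + exact: point_mulN.
  + rewrite tofracB !tofracM -mulNr addf_div ?point_n0 //.
    by rewrite mulNr.
- move=> _ _ [f [g [Af Ag Pg ->]]] [f' [g' [Af' Ag' Pg' ->]]].
  exists (f * f'), (g * g'); split.
  + exact: (sub_RM subA).
  + exact: (sub_RM subA).
  + exact: point_mulN.
  + by rewrite !tofracM mulf_div.
Qed.
Let subO := local_subring.

Lemma local_max_ideal : is_ideal O m.
Proof.
split.
- by move=> _ [f [g [Pf Ag Pg ->]]]; exists f, g; split=> //; apply: idealR Pf.
- exists 0, 1; rewrite tofrac0 mul0r; split=> //; first exact: ideal0 idP.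
    exact: sub_R1.
  exact: point_not1.
- move=> _ _ [f [g [Pf Ag Pg ->]]] [f' [g' [Pf' Ag' Pg' ->]]].
  exists (f * g' + f' * g), (g * g'); split.
  + by apply: (idealD idP); apply: (idealMr idP).
  + exact: (sub_RM subA).
  + exact: point_mulN.
  + by rewrite tofracD !tofracM addf_div ?point_n0.
- move=> _ _ [f [g [Af Ag Pg ->]]] [f' [g' [Pf' Ag' Pg' ->]]].
  exists (f * f'), (g * g'); split.
  + exact: (idealMl idP).
  + exact: (sub_RM subA).
  + exact: point_mulN.
  + by rewrite !tofracM mulf_div.
Qed.
Let idm := local_max_ideal.

Lemma local_inv h : O h -> ~ m h -> h != 0 /\ O h^-1.
Proof.
move=> [f [g [Af Ag Pg ->]]] mh.
have Pf : ~ P f by move=> Pf; apply: mh; exists f, g.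
split; first by rewrite mulf_neq0 ?invr_eq0 ?point_n0.
by exists g, f; rewrite invf_div.
Qed.

(** The error of g + h - f * g * h as an inverse of f is, up to sign, the product
    of those of g and of h. *)
Lemma point_pow_inv k f : A f -> ~ P f -> exists2 g, A g & ideal_exp A P k (f * g - 1).
Proof.
move=> Af Pf; have [h Ah Ph] := point_inv Af Pf.
elim: k => [|k [g Ag IH]].
  exists h => //; apply: ideal_exp0 => //; exact: idealR Ph.
exists (g + h - f * g * h).
  by apply: (sub_RB subA); [exact: sub_RD | by apply: (sub_RM subA) => //; apply: (sub_RM subA)].
have -> : f * (g + h - f * g * h) - 1 = - ((f * h - 1) * (f * g - 1)).
  by ring.
apply: (idealN subA); first exact: (ideal_exp_ideal subA idP).
exact: (ideal_expS subA idP).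
Qed.

Lemma tofrac_max f : P f -> m f%:F.
Proof.
move=> Pf; exists f, 1; rewrite tofrac1 divr1; split=> //; first exact: sub_R1.
exact: point_not1.
Qed.

Lemma tofrac_ideal_exp k f : ideal_exp A P k f -> ideal_exp O m k f%:F.
Proof.
move=> [s [sP ->]]; rewrite rmorph_sum big_seq.
apply: (ideal_sum (ideal_exp_ideal subO idm k)) => p /sP[Ap [y [Py yE]]].
rewrite rmorphM; apply: (idealMl (ideal_exp_ideal subO idm k)).
  exact: local_tofrac.
apply: (sub_ideal_gen subO); exists (fun i => (y i)%:F); split.
  by move=> i; apply: tofrac_max.
by rewrite yE rmorph_prod.
Qed.

Lemma local_ideal_exp k h : ideal_exp O m k h ->
  exists f g, [/\ ideal_exp A P k f, A g, ~ P g & h = f%:F / g%:F].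
Proof.
move: h; elim: k => [|k IH].
  move=> h /(idealR (ideal_exp_ideal subO idm 0)) [f [g [Af Ag Pg ->]]].
  by exists f, g; split=> //; apply: ideal_exp0.
have idk := ideal_exp_ideal subA idP k.+1.
have RP i f : ideal_exp A P i f -> A f by apply: idealR; apply: (ideal_exp_ideal subA idP).
pose J : set (ratfun K n) := [set h | exists f g, [/\ ideal_exp A P k.+1 f, A g, ~ P g & h = f%:F / g%:F]].
have idJ : is_ideal O J.
  split.
  - by move=> _ [f [g [/RP Af Ag Pg ->]]]; exists f, g.
  - exists 0, 1; rewrite tofrac0 mul0r; split=> //; first exact: ideal0 idk.
      exact: sub_R1.
    exact: point_not1.
  - move=> _ _ [f [g [Pf Ag Pg ->]]] [f' [g' [Pf' Ag' Pg' ->]]].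
    exists (f * g' + f' * g), (g * g'); split.
    + by apply: (idealD idk); apply: (idealMr idk).
    + exact: (sub_RM subA).
    + exact: point_mulN.
    + by rewrite tofracD !tofracM addf_div ?point_n0.
  - move=> _ _ [f [g [Af Ag Pg ->]]] [f' [g' [Pf' Ag' Pg' ->]]].
    exists (f * f'), (g * g'); split.
    + exact: (idealMl idk).
    + exact: (sub_RM subA).
    + exact: point_mulN.
    + by rewrite !tofracM mulf_div.
apply: (ideal_expS_min subO idJ) => _ b [f [g [Pf Ag Pg ->]]] /IH[f' [g' [Pf' Ag' Pg' ->]]].
exists (f * f'), (g * g'); split.
+ exact: (ideal_expS subA idP).
+ exact: (sub_RM subA).
+ exact: point_mulN.
+ by rewrite !tofracM mulf_div.
Qed.

(** The powers of a maximal ideal are primary: a denominator outside P is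
    invertible modulo P^k. *)
Lemma tofrac_ideal_expP k f : A f -> ideal_exp O m k f%:F <-> ideal_exp A P k f.
Proof.
move=> Af; split; last exact: tofrac_ideal_exp.
have idk := ideal_exp_ideal subA idP k.
move=> /local_ideal_exp[h [g [Ph Ag Pg E]]].
have {}E : f * g = h.
  apply/eqP; rewrite -tofrac_eq tofracM E divfK //; exact: point_n0.
have [g' Ag' Pg'] := point_pow_inv k Ag Pg.
have -> : f = g' * h - f * (g * g' - 1) by rewrite -E; ring.
by apply: (idealB subA); [exact: idk | exact: (idealMl idk) | exact: (idealMl idk)].
Qed.

(** A / P^k is already the quotient of the local ring by m^k, as denominators
    are invertible modulo P^k. *)
Lemma local_approx k h : O h -> exists2 f, A f & ideal_exp O m k (h - f%:F).
Proof.
move=> [f [g [Af Ag Pg ->]]]; have [g' Ag' Pg'] := point_pow_inv k Ag Pg.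
exists (f * g'); first exact: sub_RM.
have -> : f%:F / g%:F - (f * g')%:F = - (f%:F / g%:F) * (g * g' - 1)%:F.
  by rewrite tofracB !tofracM tofrac1 approx_identity //; apply: point_n0.
apply: (idealMl (ideal_exp_ideal subO idm k)); last exact: tofrac_ideal_exp.
by apply: (sub_RN subO); exists f, g.
Qed.

Lemma tofrac_fg (T : finType) (a : T -> {mpoly K[n]}) :
  P = ideal_gen A (range a) -> m = ideal_gen O (range (fun t => (a t)%:F)).
Proof.
move=> Pgen.
have Pa t : P (a t) by rewrite Pgen; apply: sub_ideal_gen => //; exists t.
have rg : range (fun t => (a t)%:F) `<=` O.
  by move=> _ [t _ <-]; apply/local_tofrac/(idealR idP).
apply/seteqP; split=> [_ [f [g [Pf Ag Pg ->]]]|].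
  have idG := ideal_gen_ideal subO rg.
  rewrite Pgen in Pf; have [c [Ac ->]] := ideal_gen_range subA Pf.
  rewrite rmorph_sum mulr_suml; apply: (ideal_sum idG) => t _.
  rewrite rmorphM -mulrA mulrC; apply: (idealMl idG); last first.
    by apply: sub_ideal_gen => //; exists t.
  by exists (c t), g.
by apply: (ideal_gen_min idm) => _ [t _ <-]; apply: tofrac_max.
Qed.

End LocalRing.
Arguments tofrac_ideal_expP {K n A x} algA k [f] Af.
Arguments local_tofrac {K n A x} algA [f] Af.

(** * Completions and formal isomorphisms *)

Lemma ex2P (T : Type) (Q1 Q2 : T -> Prop) :
  (exists2 t, Q1 t & Q2 t) -> exists t, Q1 t /\ Q2 t.
Proof. by case=> t ? ?; exists t. Qed.

Section Completion.
Variables (K : fieldType) (n : nat) (A : set {mpoly K[n]}) (x : point A).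
Hypothesis algA : subalg_set A.
Let subA : subring_set A. Proof. by case: algA. Qed.
Local Notation P := (proj1_sig x).
Local Notation O := (local_ring x).
Local Notation m := (local_max x).
Local Notation C := (completion x).
Local Notation "u ~~ w" := (completion_eq x u w) (at level 70).
Local Notation mpow k := (ideal_exp O m k).
Let subO := local_subring x algA.
Let idm := local_max_ideal x algA.
Let idk k := ideal_exp_ideal subO idm k.

Lemma comp_in u k : C u -> O (u k). Proof. by move=> /(_ k)[]. Qed.

Lemma comp_step u j k : C u -> (k <= j)%N -> mpow k (u j - u k).
Proof.
move=> Cu /subnK <-; elim: (j - k)%N => [|i IH].
  by rewrite subrr; apply: ideal0 (idk k).
rewrite addSn -(subrK (u (i + k)%N) (u _)) -addrA; apply: (idealD (idk k)) => //.
have [_] := Cu (i + k)%N; apply: (ideal_exp_le subO idm); exact: leq_addl.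
Qed.

Lemma comp_refl u : u ~~ u.
Proof. by move=> k; rewrite subrr; apply: ideal0 (idk k). Qed.
Lemma comp_sym u w : u ~~ w -> w ~~ u.
Proof. by move=> uw k; rewrite -opprB; apply: (idealN subO (idk k)). Qed.
Lemma comp_trans u w z : u ~~ w -> w ~~ z -> u ~~ z.
Proof.
move=> uw wz k; rewrite -(subrK (w k) (u k)) -addrA; exact: (idealD (idk k)).
Qed.

Lemma comp_add u w : C u -> C w -> C (fun k => u k + w k).
Proof.
move=> Cu Cw k; have [Ou mu] := Cu k; have [Ow mw] := Cw k.
split; first exact: (sub_RD subO).
by rewrite opprD addrACA; apply: (idealD (idk k)).
Qed.

Lemma comp_mul u w : C u -> C w -> C (fun k => u k * w k).
Proof.
move=> Cu Cw k; have [Ou mu] := Cu k; have [Ow mw] := Cw k.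
have [Ou' _] := Cu k.+1.
split; first exact: (sub_RM subO).
have -> : u k.+1 * w k.+1 - u k * w k = u k.+1 * (w k.+1 - w k) + (u k.+1 - u k) * w k.
  by rewrite mulrBr mulrBl addrA subrK.
by apply: (idealD (idk k)); [apply: (idealMl (idk k)) | apply: (idealMr (idk k))].
Qed.

Lemma comp_const h : O h -> C (fun=> h).
Proof. by move=> Oh k; split=> //; rewrite subrr; apply: ideal0 (idk k). Qed.

Lemma comp_eq_add u w u' w' : u ~~ u' -> w ~~ w' ->
  (fun k => u k + w k) ~~ (fun k => u' k + w' k).
Proof. by move=> uu ww k; rewrite opprD addrACA; apply: (idealD (idk k)). Qed.

Lemma comp_eq_mul u w u' w' : C u -> C w' -> u ~~ u' -> w ~~ w' ->
  (fun k => u k * w k) ~~ (fun k => u' k * w' k).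
Proof.
move=> Cu Cw' uu ww k.
have -> : u k * w k - u' k * w' k = u k * (w k - w' k) + (u k - u' k) * w' k.
  by rewrite mulrBr mulrBl addrA subrK.
apply: (idealD (idk k)); [apply: (idealMl (idk k)) | apply: (idealMr (idk k))] => //.
  exact: comp_in.
exact: comp_in.
Qed.

(** The elements of the completion that vanish in O / m^k. *)
Definition comp_ord k u : Prop := C u /\ mpow k (u k).

Lemma comp_ordE k j u : C u -> (k <= j)%N -> mpow k (u j) <-> mpow k (u k).
Proof.
move=> Cu kj; have H := comp_step Cu kj; split=> mu.
  by rewrite -(subKr (u j) (u k)); apply: (idealB subO (idk k)).
by rewrite -(subrK (u k) (u j)); apply: (idealD (idk k)).
Qed.

Lemma comp_ord_eq k u w : C w -> u ~~ w -> comp_ord k u -> comp_ord k w.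
Proof.
move=> Cw uw [Cu mu]; split=> //; rewrite -(subKr (u k) (w k)).
by apply: (idealB subO (idk k)).
Qed.

Lemma comp_ordM j k u w :
  comp_ord j u -> comp_ord k w -> comp_ord (j + k) (fun i => u i * w i).
Proof.
move=> [Cu mu] [Cw mw]; split; first exact: comp_mul.
by apply: (ideal_expM subO idm); apply/comp_ordE; rewrite ?leq_addl ?leq_addr.
Qed.

Lemma comp_ord0 u : C u -> comp_ord 0 u.
Proof. by move=> Cu; split=> //; apply: (ideal_exp0 subO idm); apply: comp_in. Qed.

Lemma comp_ord_sum (T : finType) k (F : T -> nat -> ratfun K n) :
  (forall t, comp_ord k (F t)) -> comp_ord k (fun i => \sum_t F t i).
Proof.
move=> HF; split=> [i|]; last by apply: (ideal_sum (idk k)) => t _; case: (HF t).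
split; first by apply: (sub_R_sum subO) => t _; apply: comp_in; case: (HF t).
by rewrite -sumrB; apply: (ideal_sum (idk i)) => t _; case: (HF t) => /(_ i)[].
Qed.

Lemma comp_eq_sum (T : finType) (F G : T -> nat -> ratfun K n) :
  (forall t, F t ~~ G t) -> (fun i => \sum_t F t i) ~~ (fun i => \sum_t G t i).
Proof.
by move=> FG k; rewrite -sumrB; apply: (ideal_sum (idk k)) => t _; apply: FG.
Qed.

(** Invert term by term; the term of index 0 is only considered modulo m^0, so it
    may be 1. *)
Lemma comp_unit u : C u -> ~ comp_ord 1 u ->
  exists2 w, C w & (fun k => u k * w k) ~~ (fun=> 1).
Proof.
move=> Cu u1.
have um k : (0 < k)%N -> ~ m (u k).
  move=> k0 /(ideal_exp1 subO idm) mu; apply: u1; split=> //.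
  exact/(comp_ordE Cu k0).
exists (fun k => if k is 0 then 1 else (u k)^-1).
  case=> [|k]; first split; first exact: sub_R1.
    apply: (ideal_exp0 subO idm); apply: (sub_RB subO); last exact: (sub_R1 subO).
    by have [] := local_inv (comp_in 1 Cu) (um 1%N isT).
  have [n0 Oi] := local_inv (comp_in k.+1 Cu) (um k.+1 isT).
  have [n0' Oi'] := local_inv (comp_in k.+2 Cu) (um k.+2 isT).
  split=> //; have -> : (u k.+2)^-1 - (u k.+1)^-1 =
      - ((u k.+2)^-1 * (u k.+1)^-1) * (u k.+2 - u k.+1).
    by move: (u _) (u _) n0 n0' => a b a0 b0; rewrite mulNr mulrBr mulrAC mulVf // mul1r mulfVK // opprB.
  apply: (idealMl (idk _)); last by have [] := Cu k.+1.
  by apply: (sub_RN subO); apply: (sub_RM subO).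
case=> [|k].
  apply: (ideal_exp0 subO idm); rewrite mulr1; apply: (sub_RB subO).
    exact: comp_in.
  exact: sub_R1.
have [n0 Oi] := local_inv (comp_in k.+1 Cu) (um k.+1 isT).
by rewrite mulfV // subrr; apply: ideal0 (idk _).
Qed.

Lemma local_max_not1 : ~ m 1.
Proof.
move=> m1; apply: (point_not1 (x := x)).
have /(ideal_exp1 subA (point_ideal x)) // : ideal_exp A P 1 1.
apply/(tofrac_ideal_expP algA 1 (sub_R1 subA)).
by rewrite tofrac1; apply/(ideal_exp1 subO idm).
Qed.

Lemma comp_unit_ord u w : C u -> C w -> (fun k => u k * w k) ~~ (fun=> 1) ->
  ~ comp_ord 1 u.
Proof.
move=> Cu Cw uw u1; apply: local_max_not1; apply/(ideal_exp1 subO idm).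
have [_] := comp_ordM u1 (comp_ord0 Cw); rewrite addn0 => uw1.
rewrite -(subKr (u 1%N * w 1%N) 1); apply: (idealB subO (idk 1)) => //.
Qed.

Variables (T : finType) (a : T -> {mpoly K[n]}).
Hypothesis Pgen : P = ideal_gen A (range a).
Let mgen : m = ideal_gen O (range (fun t => tofrac (a t) : ratfun K n)).
Proof. exact: tofrac_fg. Qed.

(** Expand each difference of consecutive terms on the generators and sum up the
    coefficients. Thus elements of order k + 1 are combinations of elements of
    order 1 with coefficients of order k, which makes the filtration by the order
    an invariant of the ring structure. *)
Lemma comp_ord_fg k u : comp_ord k.+1 u -> exists c : T -> nat -> ratfun K n,
  (forall t, comp_ord k (c t)) /\
  u ~~ (fun i => \sum_t tofrac (a t) * c t i).
Proof.
move=> [Cu mu].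
have [c0 [c0m c0E]] := ideal_expS_fg subO idm mgen mu.
have H j : exists c : T -> ratfun K n, (forall t, mpow (k + j) (c t)) /\
    u (k + j).+2 - u (k + j).+1 = \sum_t tofrac (a t) * c t.
  by apply: (ideal_expS_fg subO idm mgen); have [] := Cu (k + j).+1.
have [b bP] := choice H.
pose c t i := c0 t + \sum_(j < i) b j t.
have cE i : u (k + i).+1 = \sum_t tofrac (a t) * c t i.
  elim: i => [|i IH].
    by rewrite addn0 c0E; apply: eq_bigr => t _; rewrite /c big_ord0 addr0.
  rewrite addnS -[LHS](subrK (u (k + i).+1)) (bP i).2 IH -big_split.
  apply: eq_bigr => t _; rewrite /= -mulrDr /c big_ord_recr /=; congr (_ * _).
  by rewrite [RHS]addrA [LHS]addrC.
have ck t i : mpow k (c t i).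
  apply: (idealD (idk k)) => //; apply: (ideal_sum (idk k)) => j _.
  by apply: (ideal_exp_le subO idm) ((bP j).1 t); apply: leq_addr.
exists c; split.
  move=> t; split=> // i; split; first exact: idealR (idk k) (ck t i).
  rewrite /c big_ord_recr /= opprD addrACA subrr add0r addrC addrA addNr add0r.
  by apply: (ideal_exp_le subO idm) ((bP i).1 t); apply: leq_addl.
move=> i; rewrite -cE -opprB; apply: (idealN subO (idk i)).
by apply: comp_step => //; apply: leqW; apply: leq_addl.
Qed.

End Completion.

Section FormalIsomorphism.
Variables (K : fieldType) (n1 n2 : nat).
Variables (A1 : set {mpoly K[n1]}) (A2 : set {mpoly K[n2]}).
Variables (x : point A1) (y : point A2).
Hypotheses (alg1 : subalg_set A1) (alg2 : subalg_set A2).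
Let sub1 : subring_set A1. Proof. by case: alg1. Qed.
Let sub2 : subring_set A2. Proof. by case: alg2. Qed.
Let subO1 := local_subring x alg1.
Let subO2 := local_subring y alg2.
Let idm1 := local_max_ideal x alg1.
Let idm2 := local_max_ideal y alg2.
Let idk2 k := ideal_exp_ideal subO2 idm2 k.

Section Map.
Variable phi : (nat -> ratfun K n1) -> (nat -> ratfun K n2).
Hypotheses
  (phiC : forall u, completion x u -> completion y (phi u))
  (phiE : forall u w, completion x u -> completion x w ->
           completion_eq x u w <-> completion_eq y (phi u) (phi w))
  (phiS : forall z, completion y z ->
           exists2 u, completion x u & completion_eq y (phi u) z)
  (phiD : forall u w, completion x u -> completion x w ->
           completion_eq y (phi (fun k => u k + w k)) (fun k => phi u k + phi w k))
  (phiM : forall u w, completion x u -> completion x w ->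
           completion_eq y (phi (fun k => u k * w k)) (fun k => phi u k * phi w k))
  (phiK : forall c, completion_eq y (phi (scalar n1 c)) (scalar n2 c)).

Let scalar1 n : scalar n (1 : K) = fun=> 1.
Proof. by rewrite /scalar mpolyC1 tofrac1. Qed.

Let C1 : completion x (fun=> 1). Proof. exact: comp_const (sub_R1 subO1). Qed.

Lemma phi_unit u w : completion x u -> completion x w ->
  completion_eq x (fun k => u k * w k) (fun=> 1) <->
  completion_eq y (fun k => phi u k * phi w k) (fun=> 1).
Proof.
move=> Cu Cw; have E1 : completion_eq y (phi (fun=> 1)) (fun=> 1).
  by have := phiK 1; rewrite !scalar1.
have Em := phiM Cu Cw.
rewrite (phiE (comp_mul alg1 Cu Cw) C1); split=> E.
  by apply: (comp_trans alg2 (comp_sym alg2 Em)); apply: (comp_trans alg2 E).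
by apply: (comp_trans alg2 Em); apply: (comp_trans alg2 E); apply: comp_sym.
Qed.

(** Both sides are local rings, and isomorphisms preserve units. *)
Lemma phi_ord1 u : completion x u -> comp_ord x 1 u <-> comp_ord y 1 (phi u).
Proof.
move=> Cu; split=> H; apply/not_notP => N.
- have [w Cw uw] := comp_unit alg2 (phiC Cu) N.
  have [w' Cw' w'E] := phiS Cw.
  suff /(comp_unit_ord alg1 Cu Cw') : completion_eq x (fun k => u k * w' k) (fun=> 1) by [].
  apply/(phi_unit Cu Cw'); apply: comp_trans uw => //.
  by apply: (comp_eq_mul alg2) => //; [exact: phiC | exact: comp_refl].
- have [w Cw uw] := comp_unit alg1 Cu N.
  by move/(phi_unit Cu Cw)/(comp_unit_ord alg2 (phiC Cu) (phiC Cw)): uw.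
Qed.

Lemma phi_sum (T : finType) (u : T -> nat -> ratfun K n1) :
  (forall t, completion x (u t)) ->
  completion x (fun k => \sum_t u t k) /\
  completion_eq y (phi (fun k => \sum_t u t k)) (fun k => \sum_t phi (u t) k).
Proof.
move=> Cu; pose Q (s : seq T) := completion x (fun k => \sum_(t <- s) u t k) /\
  completion_eq y (phi (fun k => \sum_(t <- s) u t k)) (fun k => \sum_(t <- s) phi (u t) k).
suff : Q (index_enum T) by [].
elim: (index_enum T) => [|t s [IH1 IH2]].
  have E0 n (v : T -> nat -> ratfun K n) : (fun k => \sum_(t <- [::]) v t k) = fun=> 0.
    by apply/funext => k; rewrite big_nil.
  rewrite /Q !E0; split; first exact: comp_const (sub_R0 subO1).
  by have := phiK 0; rewrite /scalar mpolyC0 !tofrac0.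
have E : (fun k => \sum_(t <- t :: s) u t k) = (fun k => u t k + \sum_(t <- s) u t k).
  by apply/funext => k; rewrite big_cons.
rewrite /Q E; split; first exact: comp_add.
apply: (comp_trans alg2 (phiD (Cu t) IH1)).
rewrite (_ : (fun k => \sum_(_ <- _) phi _ _) = (fun k => phi (u t) k + \sum_(t <- s) phi (u t) k)).
  by apply: (comp_eq_add alg2) => //; apply: comp_refl.
by apply/funext => k; rewrite big_cons.
Qed.

Lemma comp_ord_max n (A : set {mpoly K[n]}) (z : point A) f : subalg_set A ->
  proj1_sig z f -> comp_ord z 1 (fun=> tofrac f).
Proof.
move=> algA Pf; have [sA _] := algA; split.
  by apply/(comp_const algA)/(local_tofrac algA)/(idealR (point_ideal z)).
by apply/(ideal_exp1 (local_subring z algA) (local_max_ideal z algA))/tofrac_max.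
Qed.

(** Induction on k by [comp_ord_fg]. *)
Lemma phi_ord (T : finType) (a : T -> {mpoly K[n1]}) k u :
  proj1_sig x = ideal_gen A1 (range a) -> comp_ord x k u -> comp_ord y k (phi u).
Proof.
move=> Pgen; elim: k u => [|k IH] u ku; first by apply: comp_ord0 => //; apply: phiC; case: ku.
have [c [kc uE]] := comp_ord_fg alg1 Pgen ku; have [Cu _] := ku.
have a1 t : comp_ord x 1 (fun=> tofrac (a t)).
  by apply: comp_ord_max => //; rewrite Pgen; apply: (sub_ideal_gen sub1); exists t.
have Cac t : completion x (fun i => tofrac (a t) * c t i).
  by apply: (comp_mul alg1); [case: (a1 t) | case: (kc t)].
have [Cs sE] := phi_sum Cac.
have phiu : completion_eq y (phi u) (fun i => \sum_t phi (fun j => tofrac (a t) * c t j) i).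
  by apply: (comp_trans alg2) sE; apply/(phiE Cu Cs).
apply: (comp_ord_eq alg2 (phiC Cu) (comp_sym alg2 phiu)).
apply: (comp_ord_sum alg2) => t; have [Ca _] := a1 t; have [Cc _] := kc t.
apply: (comp_ord_eq alg2 (phiC (Cac t)) (comp_sym alg2 (phiM Ca Cc))).
by rewrite -addn1 addnC; apply: comp_ordM => //; [apply/phi_ord1 | apply: IH].
Qed.

Lemma phi_ord_inv (T : finType) (b : T -> {mpoly K[n2]}) k u :
  proj1_sig y = ideal_gen A2 (range b) -> completion x u ->
  comp_ord y k (phi u) -> comp_ord x k u.
Proof.
move=> Pgen; elim: k u => [|k IH] u Cu ku; first exact: comp_ord0.
have [c [kc uE]] := comp_ord_fg alg2 Pgen ku.
have [c' c'C c'E] : exists2 c' : T -> nat -> ratfun K n1,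
    (forall t, completion x (c' t)) & (forall t, completion_eq y (phi (c' t)) (c t)).
  have [c' c'P] := choice (fun t => ex2P (phiS (kc t).1)).
  by exists c' => t; have [] := c'P t.
have b1 t : comp_ord y 1 (fun=> tofrac (b t)).
  by apply: comp_ord_max => //; rewrite Pgen; apply: (sub_ideal_gen sub2); exists t.
have [b' b'C b'E] : exists2 b' : T -> nat -> ratfun K n1,
    (forall t, completion x (b' t)) &
    (forall t, completion_eq y (phi (b' t)) (fun=> tofrac (b t))).
  have [b' b'P] := choice (fun t => ex2P (phiS (b1 t).1)).
  by exists b' => t; have [] := b'P t.
have Cbc t : completion x (fun i => b' t i * c' t i) by apply: comp_mul.
have [Cs sE] := phi_sum Cbc.
have E : completion_eq x (fun i => \sum_t b' t i * c' t i) u.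
  apply/(phiE Cs Cu); apply: (comp_trans alg2 sE).
  apply: (comp_trans alg2 _ (comp_sym alg2 uE)).
  apply: (comp_eq_sum alg2) => t; apply: (comp_trans alg2 (phiM (b'C t) (c'C t))).
  by apply: (comp_eq_mul alg2) => //; [exact: phiC | case: (kc t)].
apply: (comp_ord_eq alg1 Cu E); apply: (comp_ord_sum alg1) => t.
rewrite -addn1 addnC; apply: (comp_ordM alg1).
  apply/phi_ord1 => //; apply: (comp_ord_eq alg2 _ (comp_sym alg2 (b'E t)) (b1 t)).
  exact: phiC.
apply: IH => //; apply: (comp_ord_eq alg2 _ (comp_sym alg2 (c'E t)) (kc t)).
exact: phiC.
Qed.

End Map.

(** What a formal isomorphism says about the rings A / P^k for k <= N, in terms of
    representatives theta f of the images. *)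
Record jet_iso (N : nat) (theta : {mpoly K[n1]} -> {mpoly K[n2]}) : Prop := JetIso {
  jet_in : forall f, A1 f -> A2 (theta f);
  jetD : forall f g, A1 f -> A1 g ->
    ideal_exp A2 (proj1_sig y) N (theta (f + g) - (theta f + theta g));
  jetM : forall f g, A1 f -> A1 g ->
    ideal_exp A2 (proj1_sig y) N (theta (f * g) - theta f * theta g);
  jetC : forall c, ideal_exp A2 (proj1_sig y) N (theta c%:MP - c%:MP);
  jet_ord : forall k f, (k <= N)%N -> A1 f ->
    ideal_exp A1 (proj1_sig x) k f <-> ideal_exp A2 (proj1_sig y) k (theta f);
  jet_surj : forall s, A2 s ->
    exists2 f, A1 f & ideal_exp A2 (proj1_sig y) N (s - theta f) }.

(** Take for theta f an element of A2 close to the N-th term of the image of the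
    constant sequence f. *)
Lemma formal_jet_iso (T1 T2 : finType) (a : T1 -> {mpoly K[n1]}) (b : T2 -> {mpoly K[n2]}) N :
  proj1_sig x = ideal_gen A1 (range a) -> proj1_sig y = ideal_gen A2 (range b) ->
  formally_isomorphic x y -> exists theta, jet_iso N theta.
Proof.
move=> agen bgen [phi [[phiC phiE phiS] [phiD phiM phiK]]].
have idN := ideal_exp_ideal sub2 (point_ideal y) N.
pose cst f : nat -> ratfun K n1 := fun=> tofrac f.
have Ccst f : A1 f -> completion x (cst f).
  by move=> Af; apply/(comp_const alg1)/local_tofrac.
have H f : exists g, A1 f ->
    A2 g /\ ideal_exp (local_ring y) (local_max y) N (phi (cst f) N - tofrac g).
  have [Af|nAf] := EM (A1 f); last by exists 0.
  have [g Ag gP] := local_approx alg2 N (comp_in N (phiC _ (Ccst f Af))).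
  by exists g.
have [theta thP] := choice H.
have thA f : A1 f -> A2 (theta f) by move=> /thP[].
have thE f : A1 f -> ideal_exp (local_ring y) (local_max y) N (phi (cst f) N - tofrac (theta f)).
  by move=> /thP[].
have ideal_tr (u w z : ratfun K n2) : ideal_exp (local_ring y) (local_max y) N (u - w) ->
    ideal_exp (local_ring y) (local_max y) N (w - z) ->
    ideal_exp (local_ring y) (local_max y) N (u - z).
  by move=> uw wz; rewrite -(subrK w u) -addrA; apply: (idealD (idk2 N)).
have ideal_sy (u w : ratfun K n2) : ideal_exp (local_ring y) (local_max y) N (u - w) ->
    ideal_exp (local_ring y) (local_max y) N (w - u).
  by move=> uw; rewrite -opprB; apply: (idealN subO2 (idk2 N)).
have A2e k f : A2 f -> ideal_exp (local_ring y) (local_max y) k (tofrac f) ->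
    ideal_exp A2 (proj1_sig y) k f.
  by move=> Af /(tofrac_ideal_expP alg2 _ Af).
exists theta; split=> //.
- move=> f g Af Ag; have Afg := sub_RD sub1 Af Ag.
  apply: A2e; first by apply: (sub_RB sub2); [|apply: (sub_RD sub2)]; apply: thA.
  rewrite tofracB tofracD; apply: (ideal_tr _ _ _ (ideal_sy _ _ (thE _ Afg))).
  have -> : cst (f + g) = fun k => cst f k + cst g k by apply/funext => k; rewrite /cst tofracD.
  apply: (ideal_tr _ _ _ (phiD _ _ (Ccst f Af) (Ccst g Ag) N)).
  by rewrite opprD addrACA; apply: (idealD (idk2 N)); apply: thE.
- move=> f g Af Ag; have Afg := sub_RM sub1 Af Ag.
  apply: A2e; first by apply: (sub_RB sub2); [|apply: (sub_RM sub2)]; apply: thA.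
  rewrite tofracB tofracM; apply: (ideal_tr _ _ _ (ideal_sy _ _ (thE _ Afg))).
  have -> : cst (f * g) = fun k => cst f k * cst g k by apply/funext => k; rewrite /cst tofracM.
  apply: (ideal_tr _ _ _ (phiM _ _ (Ccst f Af) (Ccst g Ag) N)).
  apply: (ideal_tr _ (phi (cst f) N * tofrac (theta g))).
    rewrite -mulrBr; apply: (idealMl (idk2 N)); last exact: thE.
    by apply: comp_in; apply/phiC/Ccst.
  rewrite -mulrBl; apply: (idealMr (idk2 N)); last exact: thE.
  by apply: local_tofrac => //; apply: thA.
- move=> c; have [_ Kc1] := alg1; have [_ Kc2] := alg2.
  apply: A2e; first by apply: (sub_RB sub2) => //; apply: thA.
  rewrite tofracB; apply: (ideal_tr _ _ _ (ideal_sy _ _ (thE _ (Kc1 c)))).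
  exact: phiK.
- move=> k f kN Af.
  have ke : ideal_exp A2 (proj1_sig y) k (theta f) <-> comp_ord y k (phi (cst f)).
    have Cf := phiC _ (Ccst f Af).
    rewrite -(tofrac_ideal_expP alg2 k (thA f Af)).
    have E := ideal_exp_le subO2 idm2 kN (thE f Af).
    have idk := ideal_exp_ideal subO2 idm2 k.
    split=> [H1|[_ /(comp_ordE alg2 Cf kN) H1]].
      split=> //; apply/(comp_ordE alg2 Cf kN).
      by rewrite -(subrK (tofrac (theta f)) (phi _ _)); apply: (idealD idk).
    by rewrite -(subKr (phi (cst f) N) (tofrac _)); apply: (idealB subO2 idk).
  rewrite ke -(tofrac_ideal_expP alg1 k Af).
  have kx : ideal_exp (local_ring x) (local_max x) k (tofrac f) <-> comp_ord x k (cst f).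
    by split=> [H1|[]//]; split=> //; apply: Ccst.
  rewrite kx; split=> H1; first exact: (phi_ord phiC phiE phiS phiD phiM phiK agen).
  apply: (phi_ord_inv phiC phiE phiS phiD phiM phiK bgen) => //; exact: Ccst.
- move=> s As; have Cs : completion y (fun=> tofrac s) by apply/(comp_const alg2)/local_tofrac.
  have [u Cu uE] := phiS _ Cs.
  have [f Af fE] := local_approx alg1 N (comp_in N Cu).
  exists f => //; apply: A2e; first by apply: (sub_RB sub2) => //; apply: thA.
  rewrite tofracB; apply: (ideal_tr _ _ _ (ideal_sy _ _ (uE N))).
  apply: (fun H => ideal_tr _ _ _ H (thE f Af)).
  have CN : completion x (cst (- f)) by apply/Ccst/(sub_RN sub1).
  have Cd := comp_add alg1 Cu CN.
  have dN : comp_ord x N (fun k => u k + cst (- f) k).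
    by split=> //; rewrite /cst tofracN.
  have [_ dN'] := phi_ord phiC phiE phiS phiD phiM phiK agen dN.
  have E : (fun k => (u k + cst (- f) k) + cst f k) = u.
    by apply/funext => k; rewrite /cst tofracN subrK.
  have := phiD _ _ Cd (Ccst f Af) N; rewrite E => DN.
  rewrite -(subrK (phi (fun k => u k + cst (- f) k) N) (phi u N - _)).
  apply: (idealD (idk2 N)) => //.
  by rewrite -addrA -opprD [phi (cst f) N + _]addrC.
Qed.

(** The residue field is the quotient of the completion by its non-units. *)
Lemma formal_residue : formally_isomorphic x y ->
  (forall g, A2 g -> exists c, proj1_sig y (g - c%:MP)) ->
  forall f, A1 f -> exists c, proj1_sig x (f - c%:MP).
Proof.
move=> [phi [[phiC phiE phiS] [phiD phiM phiK]]] resy f Af.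
pose cst f : nat -> ratfun K n1 := fun=> tofrac f.
have Ccst g : A1 g -> completion x (cst g).
  by move=> Ag; apply/(comp_const alg1)/local_tofrac.
have Cf := phiC _ (Ccst f Af).
have [g Ag gE] := local_approx alg2 1 (comp_in 1 Cf).
have [c cE] := resy g Ag; exists c.
have [_ Kc1] := alg1; have [_ Kc2] := alg2.
have Afc := sub_RB sub1 Af (Kc1 c).
have CN : completion x (cst (- c%:MP)) by apply/Ccst/(sub_RN sub1)/Kc1.
apply/(ideal_exp1 sub1 (point_ideal x))/(tofrac_ideal_expP alg1 _ Afc).
suff : comp_ord x 1 (cst (f - c%:MP)) by case.
apply/(phi_ord1 phiC phiE phiS phiM phiK) => //; first exact: Ccst.
split; first exact/phiC/Ccst.
have id1 := idk2 1.
have E : cst (f - c%:MP) = fun k => cst f k + cst (- c%:MP) k.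
  by apply/funext => k; rewrite /cst tofracD.
rewrite E; have D := phiD _ _ (Ccst f Af) CN 1%N.
rewrite -(subrK (phi (cst f) 1%N + phi (cst (- c%:MP)) 1%N) (phi _ _)).
apply: (idealD id1) => //.
have -> : cst (- c%:MP) = scalar n1 (- c) by rewrite /scalar mpolyCN.
have Kc := phiK (- c) 1%N.
rewrite -(subrK (scalar n2 (- c) 1%N) (phi (scalar _ _) _)) addrCA.
apply: (idealD id1) => //; rewrite -(subrK (tofrac g) (phi _ _)) -addrA.
apply: (idealD id1) => //; rewrite /scalar mpolyCN tofracN -tofracB.
by apply: tofrac_ideal_exp => //; apply/(ideal_exp1 sub2 (point_ideal y)).
Qed.

End FormalIsomorphism.

(** * Invariants of a finite linear group *)

Lemma pevalB (K : fieldType) n (p q : {mpoly K[n]}) v : peval (p - q) v = peval p v - peval q v.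
Proof. by rewrite /peval mevalB. Qed.
Lemma pevalM (K : fieldType) n (p q : {mpoly K[n]}) v : peval (p * q) v = peval p v * peval q v.
Proof. by rewrite /peval mevalM. Qed.
Lemma pevalC (K : fieldType) n c v : peval (c%:MP : {mpoly K[n]}) v = c.
Proof. by rewrite /peval mevalC. Qed.
Lemma peval0 (K : fieldType) n (p : {mpoly K[n]}) : peval p 0 = p@_0%MM.
Proof.
have [->|p0] := eqVneq p 0; first by rewrite mcoeff0 /peval meval0.
rewrite /peval mevalE (mpolyE p) raddf_sum /= -(mpolyE p).
apply: eq_bigr => m _; rewrite mcoeffZ mcoeffX; congr (_ * _).
have [->|m0] := eqVneq m 0%MM.
  by rewrite big1 // => i _; rewrite mnm0E expr0.
have [i mi] : exists i, m i != 0%N.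
  apply/existsP; rewrite -negb_forall; apply/negP => /forallP mi.
  by move/eqP: m0; apply; apply/mnmP => i; rewrite mnm0E; apply/eqP/mi.
by rewrite (bigD1 i) //= mxE expr0n (negPf mi) mul0r.
Qed.

Lemma invariants_subalg (K : fieldType) n (H : set 'M[K]_n) : subalg_set (invariants H).
Proof.
split; first split.
- by move=> g v _; rewrite -mpolyC1 !pevalC.
- by move=> p q Hp Hq g v Hg; rewrite !pevalB Hp ?Hq.
- by move=> p q Hp Hq g v Hg; rewrite !pevalM Hp ?Hq.
- by move=> c g v _; rewrite !pevalC.
Qed.

Section LinearSubstitution.
Variables (K : fieldType) (n : nat).

Definition mx_subst (M : 'M[K]_n) : {mpoly K[n]} -> {mpoly K[n]} :=
  mmap (@mpolyC n K) (fun i => \sum_j M i j *: 'X_j).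

HB.instance Definition _ M := GRing.RMorphism.on (mx_subst M).

Lemma mx_substC M c : mx_subst M c%:MP = c%:MP.
Proof. by rewrite /mx_subst mmapC. Qed.

Lemma mx_substZ M c p : mx_subst M (c *: p) = c *: mx_subst M p.
Proof. by rewrite -!mul_mpolyC rmorphM /= mx_substC. Qed.

Lemma mx_substX M i : mx_subst M 'X_i = \sum_j M i j *: 'X_j.
Proof. by rewrite /mx_subst mmapX mmap1U. Qed.

Lemma peval_subst M p v : peval (mx_subst M p) v = peval p (M *m v).
Proof.
apply: (@rmorph_mpoly_eq _ _ _ (meval (fun i => v i 0) \o mx_subst M)
  (meval (fun i => (M *m v) i 0))) => [c|i] /=.
  by rewrite mx_substC !mevalC.
rewrite mx_substX mevalXU mxE rmorph_sum; apply: eq_bigr => j _ /=.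
by rewrite mevalZ mevalXU.
Qed.

Hypothesis charK0 : [pchar K] =i pred0.

Lemma peval_inj p q : (forall v, peval p v = peval q v) -> p = q :> {mpoly K[n]}.
Proof.
move=> pq; apply/eqP; rewrite -subr_eq0; apply/eqP.
apply: (mpoly_vanish charK0) => c.
have := pq (\col_i c i); rewrite /peval => E.
have cE : (fun i => (\col_i c i : 'cV[K]_n) i 0) =1 c by move=> i; rewrite mxE.
by rewrite mevalB -!(meval_eq _ cE) E subrr.
Qed.

Lemma mx_subst1 p : mx_subst 1%:M p = p.
Proof. by apply: peval_inj => v; rewrite peval_subst mul1mx. Qed.

Lemma mx_substM M N p : mx_subst N (mx_subst M p) = mx_subst (M *m N) p.
Proof. by apply: peval_inj => v; rewrite !peval_subst mulmxA. Qed.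

Lemma invariantsP (H : set 'M[K]_n) p :
  invariants H p <-> forall g, H g -> mx_subst g p = p.
Proof.
split=> [Hp g Hg|Hp g v Hg]; last by rewrite -peval_subst Hp.
by apply: peval_inj => v; rewrite peval_subst Hp.
Qed.

End LinearSubstitution.

Section FiniteGroup.
Variables (K : fieldType) (charK0 : [pchar K] =i pred0).
Variables (d : nat) (gT : finGroupType) (G : {group gT}) (rG : mx_representation K G d).
Notation D := {mpoly K[d]}.
Definition group_image : set 'M[K]_d := [set M | exists2 g, g \in G & M = rG g].
Local Notation H := group_image.
Local Notation S := (invariants H).
Local Notation mS := (eval_ideal H 0).
Let act g : D -> D := mx_subst (rG g).
Let act_mul g p q : act g (p * q) = act g p * act g q. Proof. exact: rmorphM. Qed.
Let algS := invariants_subalg H.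
Let subS : subring_set S. Proof. by case: algS. Qed.

Lemma mS_ideal : is_ideal S mS.
Proof. by case: (eval_ideal_maximal H 0). Qed.
Let idm := mS_ideal.

Lemma group_invariantsP p : S p <-> forall g, g \in G -> act g p = p.
Proof.
split=> [/(invariantsP charK0) Hp g Gg|Hp]; first by apply: Hp; exists g.
by apply/(invariantsP charK0) => _ [g Gg ->]; apply: Hp.
Qed.

Lemma actM g h p : g \in G -> h \in G -> act h (act g p) = act (g * h)%g p.
Proof. by move=> Gg Gh; rewrite /act mx_substM // repr_mxM. Qed.

Lemma card_group_neq0 : #|G|%:R != 0 :> K.
Proof. by move/pcharf0P: charK0 => ->; rewrite -lt0n cardG_gt0. Qed.

Definition reynolds (p : D) : D := #|G|%:R^-1 *: \sum_(g in G) act g p.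

Lemma reynolds_inv p : S (reynolds p).
Proof.
apply/group_invariantsP => h Gh; rewrite /act /reynolds mx_substZ rmorph_sum; congr (_ *: _).
rewrite [RHS](reindex_inj (mulIg h)) /=; apply: eq_big => g.
  by rewrite groupMr.
by move=> Gg; rewrite -/(act _ _) actM.
Qed.

Lemma reynoldsM s p : S s -> reynolds (s * p) = s * reynolds p.
Proof.
move=> /group_invariantsP Hs; rewrite /reynolds -scalerAr mulr_sumr; congr (_ *: _).
by apply: eq_bigr => g Gg; rewrite act_mul Hs.
Qed.

Lemma reynolds1 : reynolds 1 = 1.
Proof.
rewrite /reynolds (eq_bigr (fun=> 1)) => [|g _]; last by rewrite /act rmorph1.
by rewrite sumr_const -scaler_nat scalerA mulVf ?scale1r ?card_group_neq0.
Qed.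

Lemma reynolds_id s : S s -> reynolds s = s.
Proof. by move=> Ss; rewrite -[s in LHS]mulr1 reynoldsM // reynolds1 mulr1. Qed.

Lemma reynolds_sum (T : Type) (r : seq T) (F : T -> D) :
  reynolds (\sum_(t <- r) F t) = \sum_(t <- r) reynolds (F t).
Proof.
rewrite /reynolds -scaler_sumr [in RHS]exchange_big /=; congr (_ *: _).
by apply: eq_bigr => g _; rewrite /act rmorph_sum.
Qed.

Lemma reynoldsZ c p : reynolds (c *: p) = c *: reynolds p.
Proof. by rewrite -!mul_mpolyC reynoldsM //; case: algS => _; apply. Qed.

(** The Reynolds operator is linear over the invariants: ideals of the invariant
    ring are contracted from the polynomial ring. *)
Lemma reynolds_contract (J : set D) s : is_ideal S J -> S s ->
  ideal_gen setT J s -> J s.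
Proof.
move=> idJ Ss [r [rJ sE]]; rewrite -(reynolds_id Ss) sE reynolds_sum big_seq.
apply: (ideal_sum idJ) => p /rJ[_ Jp]; have Sp := idealR idJ Jp.
by rewrite mulrC reynoldsM // mulrC; apply: (idealMl idJ) => //; apply: reynolds_inv.
Qed.

Local Notation g0 := #|G|.

Definition orbit_poly (i : 'I_d) : {poly D} := \prod_(g in G) ('X - (act g 'X_i)%:P).

Lemma size_orbit_poly i : size (orbit_poly i) = g0.+1.
Proof. by rewrite /orbit_poly -big_enum size_prod_XsubC -cardE. Qed.

Lemma orbit_coef_inv i l : S (orbit_poly i)`_l.
Proof.
apply/group_invariantsP => h Gh; rewrite /act -coef_map /=; congr (polyseq _)`_l.
rewrite /orbit_poly rmorph_prod [RHS](reindex_inj (mulIg h)) /=.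
apply: eq_big => g; first by rewrite groupMr.
by move=> Gg; rewrite map_polyXsubC /= -/(act h (act g _)) actM.
Qed.

(** The action fixes the origin, where the orbit polynomial becomes a power of the
    variable. *)
Lemma orbit_coef_mS i l : (l < g0)%N -> mS (orbit_poly i)`_l.
Proof.
move=> lt_l; split; first exact: orbit_coef_inv.
rewrite /peval -coef_map /orbit_poly rmorph_prod /=.
rewrite (eq_bigr (fun=> 'X)) => [|g Gg].
  by rewrite prodr_const coefXn ltn_eqF.
have E : peval (act g 'X_i) 0 = 0.
  by rewrite /act peval_subst mulmx0 /peval mevalXU mxE.
by rewrite map_polyXsubC /= -[meval _ _]/(peval _ 0) E subr0.
Qed.

Lemma orbit_relation i : 'X_i ^+ g0 = - \sum_(l < g0) (orbit_poly i)`_l * 'X_i ^+ l.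
Proof.
have : (orbit_poly i).['X_i] = 0.
  apply/eqP; rewrite /orbit_poly horner_prod; apply/prodf_eq0.
  exists 1%g; first exact: group1.
  by rewrite hornerXsubC /act repr_mx1 mx_subst1 // subrr.
rewrite horner_coef size_orbit_poly big_ord_recr /= => /eqP.
have -> : (orbit_poly i)`_g0 = 1.
  have : orbit_poly i \is monic by apply: monic_prod => g _; apply: monicXsubC.
  by rewrite monicE lead_coefE size_orbit_poly => /eqP.
by rewrite mul1r addrC addr_eq0 => /eqP.
Qed.

(** X_i is a root of its orbit polynomial, a monic polynomial over the invariants. *)
Lemma monomial_relation (m : 'X_{1..d}) i : (g0 <= m i)%N ->
  'X_[m] = - \sum_(l < g0) (orbit_poly i)`_l * 'X_[m - U_(i) *+ g0 + U_(i) *+ l]%MM.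
Proof.
move=> le_m; have {1}-> : m = (U_(i) *+ g0 + (m - U_(i) *+ g0))%MM.
  apply/mnmP => j; rewrite mnmDE mnmBE mulmnE mnm1E.
  by case: eqP => [<-|_]; rewrite ?mul1n ?subnKC // mul0n subn0.
rewrite mpolyXD -mpolyXn orbit_relation mulNr mulr_suml; congr (- _).
by apply: eq_bigr => l _; rewrite mpolyXD -mpolyXn -mulrA [_ * 'X_[_]]mulrC.
Qed.

Lemma mdeg_relation (m : 'X_{1..d}) i l : (g0 <= m i)%N -> (l < g0)%N ->
  (mdeg (m - U_(i) *+ g0 + U_(i) *+ l)%MM < mdeg m)%N /\
  (mdeg m - g0 <= mdeg (m - U_(i) *+ g0)%MM)%N.
Proof.
move=> le_m lt_l.
have E : mdeg m = (mdeg (m - U_(i) *+ g0)%MM + g0)%N.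
  have {1}<- : (m - U_(i) *+ g0 + U_(i) *+ g0)%MM = m.
    apply/mnmP => j; rewrite mnmDE mnmBE mulmnE mnm1E.
    by case: eqP => [<-|_]; rewrite ?mul1n ?subnK // mul0n subn0 addn0.
  by rewrite mdegD mdegMn mdeg1 mul1n.
by rewrite mdegD mdegMn mdeg1 mul1n; lia.
Qed.

Definition exps := {ffun 'I_d -> 'I_g0}.
Definition exp_mnm (e : exps) : 'X_{1..d} := [multinom (e i : nat) | i < d].

Lemma module_finite p : exists s : exps -> D,
  (forall e, S (s e)) /\ p = \sum_e s e * 'X_[exp_mnm e].
Proof.
pose Mod p := exists s : exps -> D, (forall e, S (s e)) /\ p = \sum_e s e * 'X_[exp_mnm e].
have Mod0 : Mod 0.
  exists (fun=> 0); split=> [e|]; first exact: sub_R0.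
  by rewrite big1 // => e _; rewrite mul0r.
have ModD x y : Mod x -> Mod y -> Mod (x + y).
  move=> [s [Ss ->]] [t [St ->]]; exists (fun e => s e + t e); split.
    by move=> e; apply: (sub_RD subS).
  by rewrite -big_split; apply: eq_bigr => e _; rewrite mulrDl.
have ModM a x : S a -> Mod x -> Mod (a * x).
  move=> Sa [s [Ss ->]]; exists (fun e => a * s e); split.
    by move=> e; apply: (sub_RM subS).
  by rewrite mulr_sumr; apply: eq_bigr => e _; rewrite mulrA.
have ModX m : Mod 'X_[m].
  have [N] := ubnP (mdeg m); elim: N m => // N IH m lt_m.
  have [i le_m|small] := pickP (fun i => g0 <= m i)%N.
    rewrite (monomial_relation le_m) -mulN1r; apply: (ModM).
      by apply: (sub_RN subS); apply: sub_R1.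
    elim/big_ind: _ => // l _; apply: (ModM); first exact: orbit_coef_inv.
    apply: IH; have [lt _] := mdeg_relation le_m (ltn_ord l); exact: leq_trans lt _.
  have lt_g i : (m i < g0)%N by rewrite ltnNge small.
  exists (fun e => (e == [ffun i => Ordinal (lt_g i)])%:R); split.
    move=> e; case: eqP => _; [exact: sub_R1 | exact: sub_R0].
  rewrite (bigD1 [ffun i => Ordinal (lt_g i)]) //= eqxx mul1r big1 ?addr0.
    by congr 'X_[_]; apply/mnmP => i; rewrite mnmE ffunE.
  by move=> e /negPf->; rewrite mul0r.
rewrite -/(Mod p) (mpolyE p); elim/big_ind: _ => // m _.
by rewrite -mul_mpolyC; apply: (ModM) => //; case: algS => _; apply.
Qed.

(** A bound for the degrees of the monomials in which every exponent is below the
    order of G. *)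
Definition conductor := (d * g0).+1.

Lemma large_exponent (m : 'X_{1..d}) : (conductor <= mdeg m)%N -> exists i, (g0 <= m i)%N.
Proof.
move=> le_m; have [i le_i|small] := pickP (fun i => g0 <= m i)%N; first by exists i.
suff : (mdeg m <= d * g0)%N by move: le_m; rewrite /conductor ltnNge => /negP.
rewrite mdegE -[d in X in (_ <= X)%N]card_ord -sum_nat_const; apply: leq_sum => i _.
by apply: ltnW; rewrite ltnNge small.
Qed.

(** The ideal of K[z] generated by the k-th power of the ideal of the origin in
    the invariant ring. *)
Definition ext_pow k : set D := ideal_gen setT (ideal_exp S mS k).

Let subT : subring_set (setT : set D). Proof. by split. Qed.

Lemma ext_pow_ideal k : is_ideal setT (ext_pow k).
Proof. exact: (ideal_gen_ideal subT). Qed.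

Lemma ext_powS k a b : mS a -> ext_pow k b -> ext_pow k.+1 (a * b).
Proof.
move=> ma [r [rP ->]]; rewrite big_seq mulr_sumr.
apply: (ideal_sum (ext_pow_ideal _)) => p /rP[_ kp].
rewrite mulrCA; apply: (idealMl (ext_pow_ideal _)) => //.
by apply: (sub_ideal_gen subT); apply: (ideal_expS subS idm).
Qed.

(** A monomial of large degree contains a variable to the power #|G|, which
    [monomial_relation] trades for invariants that vanish at the origin. *)
Lemma monomial_ext_pow k m : (conductor * k <= mdeg m)%N -> ext_pow k 'X_[m].
Proof.
elim: k m => [|k IH] m le_m.
  rewrite -['X_[m]]mulr1; apply: (idealMl (ext_pow_ideal _)) => //.
  by apply: (sub_ideal_gen subT); apply: (ideal_exp0 subS idm); apply: sub_R1.
have [|i le_i] := @large_exponent m; first by apply: leq_trans le_m; rewrite leq_pmulr.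
rewrite (monomial_relation le_i); apply: (idealN subT (ext_pow_ideal _)).
apply: (ideal_sum (ext_pow_ideal _)) => l _; apply: ext_powS; first exact: orbit_coef_mS.
apply: IH; rewrite mdegD.
have [_ le] := mdeg_relation le_i (ltn_ord l).
have gc : (g0 <= conductor)%N.
  rewrite /conductor; case: (d) i {le le_m le_i} => [[]//|d' _].
  by rewrite mulSn; lia.
by rewrite mulnS in le_m; lia.
Qed.

Lemma ord_ge_ext_pow k : ord_ge (conductor * k) `<=` ext_pow k.
Proof.
move=> p pk; rewrite (mpolyE p) big_seq; apply: (ideal_sum (ext_pow_ideal _)) => m.
rewrite mcoeff_msupp => pm; rewrite -mul_mpolyC; apply: (idealMl (ext_pow_ideal _)) => //.
apply: monomial_ext_pow; rewrite leqNgt; apply/negP => lt.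
by move/eqP: pm; apply; apply: pk.
Qed.

Lemma mS_ord p : mS p -> ord_ge 1 p.
Proof.
by move=> [_]; rewrite peval0 => p0 m; rewrite ltnS leqn0 mdeg_eq0 => /eqP ->.
Qed.

Lemma mS_pow_ord k : ideal_exp S mS k `<=` ord_ge k.
Proof.
have idk := @ord_ge_ideal d K k.
move=> p [r [rP ->]]; rewrite big_seq; apply: (ideal_sum idk) => q /rP[_ [y [my ->]]].
apply: (idealMl idk) => //.
elim: k y my {idk rP} => [|k IH] y my; first by move=> m.
by rewrite big_ord_recl; apply: (@ord_geM _ _ 1); [apply: mS_ord | apply: IH].
Qed.

(** Apply the Reynolds operator to the monomials: those of large degree reduce to
    the coefficients of the orbit polynomials by [monomial_relation]. *)
Lemma mS_fg : exists (T : finType) (b : T -> D), mS = ideal_gen S (range b).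
Proof.
pose T : finType := (('I_d * 'I_g0) + 'X_{1..d < conductor})%type.
pose b (t : T) : D := match t with
  | inl il => (orbit_poly il.1)`_(il.2)
  | inr m => if (m : 'X_{1..d}) == 0%MM then 0 else reynolds 'X_[m] end.
have bm t : mS (b t).
  case: t => [[i l]|m] /=; first exact: orbit_coef_mS.
  case: eqP => [_|m0]; first exact: ideal0 idm.
  split; first exact: reynolds_inv.
  have: ord_ge 1 ('X_[m] : D) by apply: ord_geX; rewrite lt0n mdeg_eq0; apply/eqP.
  move=> Xm; rewrite /reynolds -mul_mpolyC pevalM /peval rmorph_sum big1 ?mulr0 // => g _.
  by rewrite -[LHS]/(peval (act g 'X_[m]) 0) /act peval_subst mulmx0 peval0 Xm // mdeg0.
have bS : range b `<=` S by move=> _ [t _ <-]; apply: idealR idm (bm t).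
have idB := ideal_gen_ideal subS bS.
have Bb t : ideal_gen S (range b) (b t) by apply: (sub_ideal_gen subS); exists t.
exists T, b; apply/seteqP; split; last first.
  by apply: (ideal_gen_min idm) => _ [t _ <-].
move=> s ms; have Ss := idealR idm ms; rewrite -(reynolds_id Ss) (mpolyE s) reynolds_sum big_seq.
apply: (ideal_sum idB) => m; rewrite mcoeff_msupp => sm.
rewrite reynoldsZ -mul_mpolyC; apply: (idealMl idB); first by case: algS => _; apply.
have m0 : m != 0%MM.
  apply/eqP => m0; move/eqP: sm; apply; apply: (mS_ord ms).
  by rewrite m0 mdeg0.
have [lt_m|/large_exponent[i le_i]] := ltnP (mdeg m) conductor.
  by have := Bb (inr (BMultinom lt_m)); rewrite /b /= (negPf m0).
rewrite (monomial_relation le_i) -scaleN1r reynoldsZ -mul_mpolyC.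
apply: (idealMl idB); first by case: algS => _; apply.
rewrite reynolds_sum; apply: (ideal_sum idB) => l _.
rewrite reynoldsM; last exact: orbit_coef_inv.
apply: (idealMr idB); first exact: reynolds_inv.
exact: (Bb (inl (i, l))).
Qed.

Lemma residue_origin g : S g -> exists c, mS (g - c%:MP).
Proof.
move=> Sg; exists (peval g 0); split; last by rewrite pevalB pevalC subrr.
by apply: (sub_RB subS) => //; case: algS => _; apply.
Qed.

End FiniteGroup.

(** * Dickson's lemma and denominators *)

Section Dickson.
Variable n : nat.
Implicit Types (P : 'X_{1..n} -> Prop) (u v : 'X_{1..n}).

(** Dickson's lemma for the first k coordinates. Given a finite set s that
    dominates for the first k coordinates, an element that s fails to dominate at
    the next one has there one of finitely many values, and each of these is dealt
    with by induction. *)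
Lemma dickson_prefix k P : (k <= n)%N -> exists s : seq 'X_{1..n},
  (forall v, v \in s -> P v) /\
  (forall u, P u -> exists2 v, v \in s & forall i : 'I_n, (i < k)%N -> (v i <= u i)%N).
Proof.
elim: k P => [|k IH] P lt_kn.
  have [[u Pu]|nP] := EM (exists u, P u); last first.
    by exists [::]; split=> // u Pu; case: nP; exists u.
  exists [:: u]; split=> [v|v _]; first by rewrite inE => /eqP ->.
  by exists u; rewrite ?inE.
pose j := Ordinal lt_kn.
have [s [sP sdom]] := IH P (ltnW lt_kn).
have [f fP] := choice (fun t => IH (fun u => P u /\ u j = t) (ltnW lt_kn)).
pose T := (\sum_(v <- s) v j)%N.
exists (s ++ flatten [seq f t | t <- iota 0 T]); split.
  move=> v; rewrite mem_cat => /orP[/sP //|/flattenP[_ /mapP[t _ ->] vt]].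
  by have [/(_ v vt)[]] := fP t.
move=> u Pu; have [v vs vu] := sdom u Pu.
have [le_Tu|lt_uT] := leqP T (u j).
  exists v; first by rewrite mem_cat vs.
  move=> i; rewrite ltnS leq_eqVlt => /orP[/eqP ik|]; last exact: vu.
  have -> : i = j by apply/val_inj.
  by apply: leq_trans le_Tu; rewrite /T (big_rem v vs) leq_addr.
have [_ /(_ u)[//|v' vs' vu']] := fP (u j).
exists v'.
  rewrite mem_cat; apply/orP; right; apply/flattenP; exists (f (u j)) => //.
  by apply/map_f; rewrite mem_iota.
move=> i; rewrite ltnS leq_eqVlt => /orP[/eqP ik|]; last exact: vu'.
have -> : i = j by apply/val_inj.
by have [/(_ v' vs')[_ ->]] := fP (u j).
Qed.

Lemma dickson P : exists s : seq 'X_{1..n},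
  (forall v, v \in s -> P v) /\
  (forall u, P u -> exists2 v, v \in s & (v <= u)%MM).
Proof.
have [s [sP sdom]] := dickson_prefix P (leqnn n).
exists s; split=> // u /sdom[v vs vu]; exists v => //.
by apply/mnm_lepP => i; apply: vu.
Qed.

End Dickson.

Section RationalScaling.
Import Order.TTheory Num.Theory.

Lemma rat_row_scale n (x : 'rV[rat]_n) : exists2 N : nat, (0 < N)%N &
  exists z : 'I_n -> int, forall i : 'I_n, N%:R * x 0 i = (z i)%:~R.
Proof.
pose N := (\prod_(i < n) `|denq (x ord0 i)|)%N.
have N0 : (0 < N)%N by apply: prodn_gt0 => i; rewrite absz_gt0 denq_eq0.
exists N => //.
exists (fun i => (\prod_(j < n | j != i) `|denq (x ord0 j)|)%N%:Z * numq (x ord0 i)) => i.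
rewrite /N (bigD1 i) //= natrM intrM mulrAC mulrC; congr (_ * _).
have -> : (`|denq (x ord0 i)|%N%:R : rat) = (denq (x ord0 i))%:~R.
  by rewrite -[in RHS](gez0_abs (ltW (denq_gt0 (x ord0 i)))).
by rewrite numqE mulrC.
Qed.

End RationalScaling.

(** * The monoid of relations and its faces *)

Section RelationMonoid.
Import Order.TTheory Num.Theory.
Import mathcomp.boot.fintype mathcomp.boot.finset.
Local Open Scope set_scope. Local Open Scope ring_scope.
Local Close Scope classical_set_scope.
Variables (n r : nat) (W : 'I_n -> 'I_r -> int).
Implicit Types (u w : 'X_{1..n}) (S T I : {set 'I_n}).

(** The exponents of the monomials of weight 0, for variables of weights W. *)
Definition relation u : bool := [forall l, \sum_i (u i)%:Z * W i l == 0].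

Lemma relationP u : reflect (forall l, \sum_i (u i)%:Z * W i l = 0) (relation u).
Proof. by apply: (iffP forallP) => H l; apply/eqP/H. Qed.

Lemma relation0 : relation 0%MM.
Proof. by apply/relationP => l; rewrite big1 // => i _; rewrite mnm0E mul0r. Qed.

Lemma relationD u w : relation u -> relation w -> relation (u + w)%MM.
Proof.
move=> /relationP Hu /relationP Hw; apply/relationP => l.
rewrite (eq_bigr (fun i => (u i)%:Z * W i l + (w i)%:Z * W i l)) => [|i _].
  by rewrite big_split /= Hu Hw.
by rewrite mnmDE PoszD mulrDl.
Qed.

Lemma relationMn u k : relation u -> relation (u *+ k)%MM.
Proof.
by move=> Hu; elim: k => [|k IH]; rewrite ?mulm0n ?relation0 // mulmS relationD.
Qed.

Lemma relationB u w : relation u -> relation w -> (w <= u)%MM -> relation (u - w)%MM.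
Proof.
move=> /relationP Hu /relationP Hw /mnm_lepP wu; apply/relationP => l.
rewrite (eq_bigr (fun i => (u i)%:Z * W i l - (w i)%:Z * W i l)) => [|i _].
  by rewrite sumrB Hu Hw.
by rewrite mnmBE -subzn // mulrBl.
Qed.

Definition Wq : 'M[rat]_(n, r) := \matrix_(i, l) (W i l)%:~R.
Definition vec u : 'rV[rat]_n := \row_i (u i)%:R.

Lemma relation_vec u : relation u <-> vec u *m Wq = 0.
Proof.
have E l : (vec u *m Wq) 0 l = (\sum_i (u i)%:Z * W i l)%:~R.
  rewrite mxE rmorph_sum; apply: eq_bigr => i _.
  by rewrite !mxE rmorphM.
split=> [/relationP H|H].
  by apply/rowP => l; rewrite E H mxE.
apply/relationP => l; apply/eqP; rewrite -(intr_eq0 rat) -E H mxE.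
by [].
Qed.

Lemma relation_pull (x : 'rV[rat]_n) : x *m Wq = 0 -> (forall i, 0 <= x 0 i) ->
  exists2 N : nat, (0 < N)%N & exists2 u, relation u & vec u = N%:R *: x.
Proof.
move=> xW x0; have [N N0 [z zE]] := rat_row_scale x.
pose u := [multinom `|z i|%N | i < n].
have uE : vec u = N%:R *: x.
  apply/rowP => i; rewrite !mxE mnmE zE -[in RHS](@gez0_abs (z i)) //.
  by rewrite -(ler0z rat) -zE mulr_ge0.
exists N => //; exists u => //; apply/relation_vec.
by rewrite uE -scalemxAl xW scaler0.
Qed.

(** The rational relations that vanish on I, as a row space. *)
Definition Lmx I : 'M[rat]_n :=
  kermx (row_mx Wq (diag_mx (\row_i (i \in I)%:R))).

Lemma LmxP I (x : 'rV[rat]_n) :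
  reflect (x *m Wq = 0 /\ forall i, i \in I -> x 0 i = 0) (x <= Lmx I)%MS.
Proof.
apply: (iffP sub_kermxP); rewrite mul_mx_row.
  rewrite -row_mx0 => /eq_row_mx[xW xI]; split=> // i iI.
  have := congr1 (fun M : 'rV_n => M 0 i) xI.
  by rewrite mul_mx_diag !mxE iI mulr1.
move=> [-> xI]; rewrite -row_mx0; congr row_mx; apply/rowP => i.
rewrite mul_mx_diag !mxE; case: (boolP (i \in I)) => [/xI ->|_]; first by rewrite mul0r.
by rewrite mulr0.
Qed.

Lemma Lmx_sub I T : I \subset T -> (Lmx T <= Lmx I)%MS.
Proof.
move=> /subsetP IT; apply/row_subP => i; have /LmxP[xW xT] := row_sub i (Lmx T).
by apply/LmxP; split=> // j /IT; apply: xT.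
Qed.

(** One more coordinate is one more linear equation. *)
Lemma rank_Lmx_setU1 i I : (\rank (Lmx I) <= (\rank (Lmx (i |: I))).+1)%N.
Proof.
pose B := row_base (Lmx I); pose f := col i B.
have rB : row_free B := row_base_free _.
have le1 : (\rank (Lmx I) - \rank f <= \rank (kermx f *m B))%N.
  by rewrite mxrankMfree // mxrank_ker.
have rf : (\rank f <= 1)%N by apply: rank_leq_col.
have sub : (kermx f *m B <= Lmx (i |: I))%MS.
  apply/row_subP => k; rewrite row_mul; set y := row k (kermx f).
  have /LmxP[xW xI] : (y *m B <= Lmx I)%MS.
    by apply: submx_trans (submxMl _ _) _; rewrite eq_row_base.
  apply/LmxP; split=> // j; rewrite !inE => /orP[/eqP ->|/xI //].
  have : y *m f = 0 by apply/sub_kermxP/row_sub.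
  move/(congr1 (fun M : 'M_1 => M 0 0)); rewrite /f !mxE => E; rewrite -[RHS]E.
  by apply: eq_bigr => l _; rewrite !mxE.
have := mxrankS sub; lia.
Qed.

Definition vanishes u S := [forall i in S, u i == 0%N].

Lemma vanishesP u S : reflect (forall i, i \in S -> u i = 0%N) (vanishes u S).
Proof. by apply: (iffP forall_inP) => H i /H/eqP. Qed.

(** The coordinates that vanish on the whole face cut out by S. *)
Definition clos S : {set 'I_n} :=
  [set j | `[< forall u, relation u -> vanishes u S -> u j = 0%N >]].

Lemma closP S j :
  reflect (forall u, relation u -> vanishes u S -> u j = 0%N) (j \in clos S).
Proof. by rewrite inE; apply: asboolP. Qed.

Lemma sub_clos S : S \subset clos S.
Proof. by apply/subsetP => i iS; apply/closP => u _ /vanishesP/(_ i iS). Qed.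

Lemma vanishes_clos u S : relation u -> vanishes u S -> vanishes u (clos S).
Proof. by move=> Ru uS; apply/vanishesP => j /closP; apply. Qed.

Lemma clos_min S T : S \subset clos T -> clos S \subset clos T.
Proof.
move=> /subsetP ST; apply/subsetP => j /closP jS; apply/closP => u Ru uT.
apply: jS => //; apply/vanishesP => i /ST iT.
by move/vanishesP: (vanishes_clos Ru uT); apply.
Qed.

(** Every face has a point in its relative interior: add up relations, one for each
    coordinate that does not vanish on the face. *)
Lemma interior_point S : exists2 w, relation w & forall j, (w j == 0%N) = (j \in clos S).
Proof.
have H j : exists u, relation u /\ vanishes u S /\ (j \notin clos S -> u j != 0%N).
  have [jS|jS] := boolP (j \in clos S).
    exists 0%MM; split; first exact: relation0.
    by split=> //; apply/vanishesP => i _; rewrite mnm0E.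
  have [u [Ru [uS uj]]] : exists u, relation u /\ vanishes u S /\ u j != 0%N.
    apply/not_notP => N; move/negP: jS; apply; apply/closP => u Ru uS.
    apply/eqP/negPn/negP => uj; by apply: N; exists u.
  by exists u.
have [f fP] := choice H.
have Rsum (r' : seq 'I_n) : relation (\sum_(j <- r') f j)%MM.
  elim: r' => [|j r' IH]; first by rewrite big_nil relation0.
  by rewrite big_cons relationD //; case: (fP j).
exists (\sum_j f j)%MM => // j; rewrite mnm_sumE sum_nat_eq0.
apply/forallP/idP => [/(_ j)/= fj|jS i].
  by apply/negPn/negP => jS; have [_ [_ /(_ jS)]] := fP j; rewrite fj.
by have [Rf [fS _]] := fP i; apply/eqP; move/closP: jS; apply.
Qed.

(** The dimension of the face cut out by S: adding a large multiple of an interior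
    point moves any rational relation that vanishes on clos S into the cone. *)
Definition delta S : nat := \rank (Lmx (clos S)).
Definition rk : nat := \rank (Lmx finset.set0).

(** Some \rank (Lmx I) coordinates determine a relation that vanishes on I. *)
Lemma card_face_le C I :
  (#|[set u : 'X_{1..n < C} | relation u & vanishes u I]| <= C ^ \rank (Lmx I))%N.
Proof.
pose e := \rank (Lmx I); pose B := row_base (Lmx I).
have fB : row_full B^T by rewrite /row_full mxrank_tr eq_row_base.
pose f := fullrankfun fB.
have unit_fB : colsub f B \in unitmx.
  by rewrite -unitmx_tr trmx_mxsub; apply: fullrowsub_unit.
case: C => [|C].
  by rewrite eq_card0 // => -[u lt_u]; have := lt_u; rewrite ltn0.
pose g (u : 'X_{1..n < C.+1}) : {ffun 'I_e -> 'I_C.+1} := [ffun k => inord (u (f k))].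
rewrite -(card_in_imset (f := g)).
  by apply: leq_trans (max_card _) _; rewrite card_ffun !card_ord.
have gE (u : 'X_{1..n < C.+1}) k : g u k = u (f k) :> nat.
  rewrite ffunE inordK //; apply: leq_ltn_trans (bmdeg u).
  by rewrite mdegE (bigD1 (f k)) //= leq_addr.
move=> u v; rewrite !inE => /andP[Ru uI] /andP[Rv vI] guv.
have inL (w : 'X_{1..n}) : relation w -> vanishes w I -> exists c, vec w = c *m B.
  move=> /relation_vec Rw /vanishesP wI; apply/submxP; rewrite eq_row_base.
  by apply/LmxP; split=> // i /wI wi; rewrite mxE wi.
have [c cE] := inL u Ru uI; have [c' c'E] := inL v Rv vI.
suff E : c = c'.
  apply/val_inj/mnmP => i; have := cE; rewrite E -c'E.
  by move/(congr1 (fun M : 'rV_n => M 0 i)); rewrite !mxE => /eqP; rewrite eqr_nat => /eqP.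
apply: (can_inj (mulmxK unit_fB)); rewrite !mulmx_colsub -cE -c'E.
apply/rowP => k; rewrite !mxE; congr (_%:R); by rewrite -!gE guv.
Qed.

(** With integral vectors z_a that span Lmx (clos S) and an interior point w of the
    face, the points \sum_a h_a z_a + A k w with 0 <= h_a < k lie in the face, are
    distinct, and have degree O(k). *)
Lemma card_face_ge S : exists2 C : nat, (0 < C)%N & forall k, (0 < k)%N ->
  (k ^ delta S <= #|[set u : 'X_{1..n < (C * k)} | relation u & vanishes u (clos S)]|)%N.
Proof.
pose I := clos S; pose e := delta S; pose B := row_base (Lmx I).
have [w Rw wE] := interior_point S.
have H a : exists z : 'I_n -> int, exists N : nat, (0 < N)%N /\
    forall i, N%:R * B a i = (z i)%:~R.
  have [N N0 [z zE]] := rat_row_scale (row a B); exists z, N; split=> // i.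
  by rewrite -zE [in RHS]mxE.
have [z zP] := choice H; have [N NP] := choice zP.
pose A : nat := (\sum_a \sum_i `|z a i|)%N.
pose val (k : nat) (h : {ffun 'I_e -> 'I_k}) (i : 'I_n) : int :=
  \sum_a (h a)%:Z * z a i + (A * k * w i)%N%:Z.
pose C : nat := (A * n + A * mdeg w).+1.
pose nv k (h : {ffun 'I_e -> 'I_k}) := [multinom `|val k h i|%N | i < n].
have zA a i : (`|z a i| <= A)%N.
  by rewrite /A (bigD1 a) //= (bigD1 i) //= -addnA leq_addr.
have zI a i : i \in I -> z a i = 0.
  move=> iI; have [N0 /(_ i)] := NP a.
  have /LmxP[_ /(_ i iI)] : (row a B <= Lmx I)%MS.
    by apply: submx_trans (row_sub _ _) _; rewrite eq_row_base.
  by rewrite mxE => ->; rewrite mulr0 => /esym/eqP; rewrite intr_eq0 => /eqP.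
have sum_le k (h : {ffun 'I_e -> 'I_k}) i : `|\sum_a (h a)%:Z * z a i| <= (A * k)%N%:Z.
  apply: le_trans (ler_norm_sum _ _ _) _.
  apply: (@le_trans _ _ (\sum_a (`|z a i| * k)%N%:Z)).
    apply: ler_sum => a _.
    by rewrite -abszE abszM absz_nat mulnC lez_nat leq_mul2l (ltnW (ltn_ord _)) orbT.
  rewrite -(big_morph Posz PoszD (erefl _)) lez_nat -big_distrl /= leq_mul2r.
  by apply/orP; right; apply: leq_sum => a _; rewrite (bigD1 i) //= leq_addr.
have val0 k h i : i \in I -> val k h i = 0.
  move=> iI; rewrite /val big1 => [|a _]; last by rewrite zI ?mulr0.
  by have := wE i; rewrite iI => /eqP ->; rewrite muln0.
have val_ge0 k h i : 0 <= val k h i.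
  have [/(val0 k h) ->//|iI] := boolP (i \in I).
  have w1 : (0 < w i)%N by rewrite lt0n wE.
  rewrite /val -lerBlDr sub0r; have := sum_le k h i.
  rewrite ler_norml => /andP[+ _]; apply: le_trans.
  by rewrite lerN2 lez_nat leq_pmulr.
have nvE k h i : (nv k h i)%:R = (val k h i)%:~R :> rat.
  by rewrite mnmE -[in RHS](gez0_abs (val_ge0 k h i)).
pose y k (h : {ffun 'I_e -> 'I_k}) : 'rV[rat]_e := \row_a ((h a)%:R * (N a)%:R).
have vecE k h : vec (nv k h) = y k h *m B + (A * k)%:R *: vec w.
  apply/rowP => i; rewrite !mxE nvE /val rmorphD rmorph_sum natrM; congr (_ + _); last first.
    by rewrite -!natrM.
  apply: eq_bigr => a _; rewrite rmorphM mxE -mulrA; congr (_ * _).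
  by have [_ ->] := NP a.
exists C => // k k0.
have bound h : (mdeg (nv k h) < C * k)%N.
  have : (mdeg (nv k h) <= \sum_(i < n) (A * k + A * k * w i))%N.
    rewrite mdegE; apply: leq_sum => i _; rewrite mnmE -lez_nat abszE /val PoszD.
    apply: le_trans (ler_normD _ _) _; apply: lerD; first exact: sum_le.
    by rewrite -abszE absz_nat.
  rewrite big_split /= sum_nat_const card_ord -big_distrr /= -mdegE => le.
  apply: leq_ltn_trans le _.
  have -> : (n * (A * k) + A * k * mdeg w = (A * n + A * mdeg w) * k)%N by ring.
  by rewrite /C mulSn -[X in (X < _)%N]add0n ltn_add2r.
pose G (h : {ffun 'I_e -> 'I_k}) : 'X_{1..n < (C * k)} := BMultinom (bound h).
have Ginj : injective G.
  move=> h h' /(congr1 (fun u : 'X_{1..n < (C * k)} => vec u)) /=; rewrite !vecE => /addIr.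
  move/(row_free_inj (row_base_free _)) => yh; apply/ffunP => a.
  have := congr1 (fun M : 'rV_e => M 0 a) yh; rewrite !mxE.
  have [Na _] := NP a; move/(mulIf _); rewrite pnatr_eq0 -lt0n => /(_ Na)/eqP.
  by rewrite eqr_nat => /eqP/val_inj.
have <- : #|{ffun 'I_e -> 'I_k}| = (k ^ e)%N by rewrite card_ffun !card_ord.
rewrite -cardsT -(card_imset _ Ginj); apply: subset_leq_card.
apply/subsetP => _ /imsetP[h _ ->]; rewrite inE /=; apply/andP; split; last first.
  by apply/vanishesP => i iI; rewrite mnmE val0.
apply/relation_vec; rewrite vecE mulmxDl -scalemxAl.
have /relation_vec -> := Rw; rewrite scaler0 addr0.
have /LmxP[-> //] : (y k h *m B <= Lmx I)%MS.
by apply: submx_trans (submxMl _ _) _; rewrite eq_row_base.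
Qed.

End RelationMonoid.

(** * Freeness of the monoid of relations *)

Lemma finset_ind (T : finType) (P : {set T} -> Prop) : P finset.set0 ->
  (forall (S : {set T}) i, i \notin S -> P S -> P (finset.setU (finset.set1 i) S)) ->
  forall S, P S.
Proof.
move=> P0 PS S; have [N] := ubnP #|S|; elim: N S => // N IH S cS.
have [->//|/finset.set0Pn[i iS]] := eqVneq S finset.set0.
rewrite -(finset.setD1K iS); apply: PS; first by rewrite !inE eqxx.
by apply: IH; move: cS; rewrite (cardsD1 i) iS ltnS.
Qed.

Section FreeMonoid.
Import Order.TTheory Num.Theory.
Import mathcomp.boot.fintype mathcomp.boot.finset.
Local Open Scope set_scope. Local Open Scope ring_scope.
Local Close Scope classical_set_scope.
Variables (n r : nat) (W : 'I_n -> 'I_r -> int).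
Notation clos := (clos W). Notation relation := (relation W).
Notation delta := (delta W). Notation rk := (rk W). Notation Lmx := (Lmx W).
Variable p : 'X_{1..n}.
Hypotheses (Rp : relation p) (p_gt0 : forall i, (0 < p i)%N).
Hypothesis pureQ : forall i j, j \in clos [set i] -> i \in clos [set j].

Lemma mem_clos1 i : i \in clos [set i].
Proof. by apply: (subsetP (sub_clos W _)); rewrite inE. Qed.

Lemma clos_trans i j S : j \in clos [set i] -> i \in clos S -> j \in clos S.
Proof. by move=> ji iS; move: j ji; apply/subsetP/clos_min; rewrite sub1set. Qed.

(** By hypothesis the sets clos [set i] are the classes of an equivalence relation. *)
Lemma clos1_eq i j : j \in clos [set i] -> clos [set j] = clos [set i].
Proof.
move=> ji; apply/eqP; rewrite eqEsubset; apply/andP; split.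
  by apply: clos_min; rewrite sub1set.
by apply: clos_min; rewrite sub1set pureQ.
Qed.

(** Among the coordinates in clos [set i], let k be one where x / p takes its
    largest value th. Then th p - x is nonnegative on clos [set i] and vanishes at
    k; adding a multiple of an interior point of the face makes it nonnegative
    everywhere. It is now in the cone, so as it vanishes at k it vanishes on
    clos [set k] = clos [set i], where x / p is thus constant. *)
Lemma facet_proportional i j (x : 'rV[rat]_n) :
  j \in clos [set i] -> x *m Wq W = 0 -> x 0 j * (p i)%:R = x 0 i * (p j)%:R.
Proof.
move=> ji xW; pose I := clos [set i].
pose th k : rat := x 0 k / (p k)%:R.
have pn k : (p k)%:R != 0 :> rat by rewrite pnatr_eq0 -lt0n.
pose k := [arg max_(k > i in I) th k]%O.
have [kI kmax] : k \in I /\ forall l, l \in I -> th l <= th k.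
  by rewrite /k; case: arg_maxP => //; apply: mem_clos1.
have [w Rw wE] := interior_point W [set i].
pose y : 'rV[rat]_n := th k *: vec p - x.
have yE l : y 0 l = (p l)%:R * (th k - th l).
  by rewrite !mxE mulrBr /th [_ * (x 0 l / _)]mulrC divfK // mulrC.
pose C : rat := \sum_l `|y 0 l|.
pose z : 'rV[rat]_n := y + C *: vec w.
have zE' l : z 0 l = y 0 l + C * (w l)%:R.
  by rewrite [LHS]mxE; congr (_ + _); rewrite !mxE.
have zE l : l \in I -> z 0 l = y 0 l.
  by move=> lI; rewrite zE'; have := wE l; rewrite lI => /eqP ->; rewrite mulr0 addr0.
have z0 l : 0 <= z 0 l.
  have [lI|lI] := boolP (l \in I).
    by rewrite zE // yE mulr_ge0 ?ler0n // subr_ge0 kmax.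
  rewrite zE' addrC -lerBlDr sub0r.
  have w1 : 1 <= (w l)%:R :> rat by rewrite ler1n lt0n wE.
  have C0 : 0 <= C by apply: sumr_ge0 => m _; apply: normr_ge0.
  apply: (@le_trans _ _ C); last by rewrite ler_peMr.
  apply: le_trans (_ : `|y 0 l| <= _); first by rewrite -normrN ler_norm.
  by rewrite /C (bigD1 l) //= lerDl sumr_ge0 // => m _; apply: normr_ge0.
have zW : z *m Wq W = 0.
  have /relation_vec pW := Rp; have /relation_vec wW := Rw.
  by rewrite /z /y mulmxDl mulmxBl -!scalemxAl pW wW xW !scaler0 subrr addr0.
have [N N0 [u Ru uE]] := relation_pull zW z0.
have uz l : (u l == 0%N) = (z 0 l == 0).
  have Ez : (N%:R *: z) 0 l = N%:R * z 0 l by rewrite mxE.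
  have Eu : vec u 0 l = (u l)%:R by rewrite mxE.
  rewrite -uE Eu in Ez.
  by rewrite -(eqr_nat rat) Ez mulf_eq0 pnatr_eq0 (gtn_eqF N0).
have uk : vanishes u [set k].
  by apply/vanishesP => l; rewrite inE => /eqP ->; apply/eqP; rewrite uz zE // yE subrr mulr0.
have th_eq l : l \in I -> th l = th k.
  move=> lI; have lk : l \in clos [set k] by apply: clos_trans lI (pureQ kI).
  have := (closP _ _ _ lk) u Ru uk => /eqP; rewrite uz zE // yE mulf_eq0 (negPf (pn l)) /=.
  by rewrite subr_eq0 => /eqP ->.
have := th_eq j ji; rewrite -(th_eq i (mem_clos1 i)) /th => E.
apply: (mulIf (invr_neq0 (pn j))); rewrite -[RHS]mulrA divff // mulr1.
by rewrite mulrAC E mulfVK.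
Qed.

(** By proportionality, the single equation x_i = 0 cuts out the face. *)
Lemma delta_facet i : (rk <= (delta [set i]).+1)%N.
Proof.
rewrite /delta /rk; apply: leq_trans (rank_Lmx_setU1 W i _) _; rewrite ltnS.
apply: mxrankS; apply/row_subP => k; set x := row k _.
have /LmxP[xW xi] : (x <= Lmx (i |: finset.set0))%MS by apply: row_sub.
apply/LmxP; split=> // j ji.
have := facet_proportional ji xW; rewrite (xi i) ?inE ?eqxx // mul0r => /eqP.
by rewrite mulf_eq0 pnatr_eq0 -[p i == _]negbK -lt0n p_gt0 orbF => /eqP.
Qed.

Lemma clos0 : clos finset.set0 = finset.set0.
Proof.
apply/setP => j; rewrite [RHS]inE; apply/negP => /closP/(_ p Rp).
move=> /(_ _) pj; have := p_gt0 j; rewrite pj //.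
by apply/vanishesP => i; rewrite inE.
Qed.

Hypothesis submodular : forall S T, (delta S + delta T <= delta (S :|: T) + rk)%N.

Lemma delta_ge T : (rk <= delta T + #|T|)%N.
Proof.
elim/finset_ind: T => [|T i iT IH].
  by rewrite /delta clos0 leq_addr.
rewrite cardsU1 iT.
have := submodular [set i] T; have := delta_facet i; lia.
Qed.

(** Let T be a minimal counterexample. For each s in T an interior point w s of the
    face cut out by T :\ s vanishes on T except at s, so the coordinates in T are
    independent, and by submodularity the face cut out by T spans all of Lmx T.
    Given u in the monoid with u_t = 0, subtract from u the combination of the w s
    that agrees with it on T: the result is in Lmx T, so vanishes at t. As all terms
    are nonnegative, u vanishes on T. Hence T is contained in clos [set t], and by
    hypothesis t is in clos [set s] for s in T. *)
Lemma clos_facets T t : t \in clos T -> exists2 s, s \in T & t \in clos [set s].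
Proof.
have [N] := ubnP #|T|; elim: N T t => // N IH T t cT tT.
apply/not_notP => none.
have tTs s : s \in T -> t \notin clos (T :\ s).
  move=> sT; apply/negP => /IH[|s' s'T ts'].
    by move: cT; rewrite (cardsD1 s) sT ltnS.
  by apply: none; exists s' => //; move: s'T; rewrite inE => /andP[].
have sTs s : s \in T -> s \notin clos (T :\ s).
  move=> sT; apply/negP => sTs; move/negP: (tTs s sT); apply.
  apply: (subsetP (clos_min _)) tT; apply/subsetP => s' s'T.
  have [->//|ss'] := eqVneq s' s.
  by apply: (subsetP (sub_clos W _)); rewrite !inE ss'.
have [w wP] := choice (fun s => ex2P (interior_point W (T :\ s))).
have Rw s : relation (w s) by case: (wP s).
have wE s j : (w s j == 0%N) = (j \in clos (T :\ s)) by case: (wP s).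
have w0 s s' : s' \in T -> s' != s -> w s s' = 0%N.
  move=> s'T ss'; apply/eqP; rewrite wE; apply: (subsetP (sub_clos W _)).
  by rewrite !inE ss'.
have ws s : s \in T -> w s s != 0%N by move=> sT; rewrite wE sTs.
have wt s : s \in T -> w s t != 0%N by move=> sT; rewrite wE tTs.
(* Each coordinate of T lowers the rank by one. *)
have drop (T' : {set 'I_n}) : T' \subset T -> (\rank (Lmx T') + #|T'| <= rk)%N.
  elim/finset_ind: T' => [|T' s sT' IH' sub]; first by rewrite cards0 addn0.
  have [sT T'T] : s \in T /\ T' \subset T.
    by move: sub; rewrite subUset sub1set => /andP[].
  rewrite cardsU1 sT'; have := IH' T'T.
  suff : (\rank (Lmx (s |: T')) < \rank (Lmx T'))%N by lia.
  have : (Lmx (s |: T') < Lmx T')%MS.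
    rewrite ltmxE Lmx_sub ?subsetUr //=; apply/negP => le.
    have wL : (vec (w s) <= Lmx T')%MS.
      apply/LmxP; split; first exact/relation_vec.
      move=> i iT'; rewrite mxE w0 //; first exact: (subsetP T'T).
      by apply: contraNneq sT' => <-.
    have /LmxP[_ /(_ s)] := submx_trans wL le; rewrite !inE eqxx => /(_ isT).
    by rewrite mxE => /eqP; rewrite pnatr_eq0 (negPf (ws s sT)).
  by rewrite ltmxErank => /andP[].
have LT : (Lmx T <= Lmx (clos T))%MS.
  have le : (Lmx (clos T) <= Lmx T)%MS by apply: Lmx_sub; apply: sub_clos.
  have := mxrank_leqif_sup le => -[_ <-].
  rewrite eqn_leq mxrankS //=; have := drop T (subxx _); have := delta_ge T.
  by rewrite /delta; lia.
have [s0 s0T] : exists s, s \in T.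
  apply/set0Pn; apply/eqP => T0; move: tT; rewrite T0 clos0 inE //.
apply: none; exists s0 => //; apply: pureQ; apply/closP => u Ru /vanishesP ut.
have {}ut : u t = 0%N by apply: ut; rewrite inE.
pose c s : rat := (u s)%:R / (w s s)%:R.
pose x := vec u - \sum_(s in T) c s *: vec (w s).
have xT : (x <= Lmx T)%MS.
  apply/LmxP; split.
    rewrite mulmxBl (iffLR (relation_vec W u)) // sub0r mulmx_suml big1 ?oppr0 // => s sT.
    by rewrite -scalemxAl (iffLR (relation_vec W _)) // scaler0.
  move=> s sT; rewrite !mxE summxE (bigD1 s) //= big1 ?addr0 => [|s' /andP[s'T ss']].
    by rewrite !mxE /c divfK ?subrr // pnatr_eq0 ws.
  by rewrite !mxE w0 ?mulr0 // eq_sym.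
have /LmxP[_ /(_ t tT)] := submx_trans xT LT.
rewrite !mxE ut sub0r summxE => /eqP; rewrite oppr_eq0 psumr_eq0; last first.
  by move=> s _; rewrite !mxE mulr_ge0 ?ler0n // divr_ge0 ?ler0n.
move/allP => /(_ s0); rewrite mem_index_enum s0T => /(_ isT) /=.
rewrite !mxE !mulf_eq0 invr_eq0 !pnatr_eq0 (negPf (ws s0 s0T)) (negPf (wt s0 s0T)).
by rewrite !orbF => /eqP.
Qed.

(** By [clos_facets] an interior point of the face cut out by the complement of
    clos [set i] is positive at i. Take such a relation with the least value at i;
    any u restricts to a relation on clos [set i], proportional to it, and the
    remainder of the division by it contradicts minimality unless it is 0. *)
Lemma facet_generator i : exists b : 'X_{1..n},
  [/\ relation b, (0 < b i)%N, (forall j, j \notin clos [set i] -> b j = 0%N) &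
      forall u, relation u -> (b i %| u i)%N].
Proof.
pose good (b : 'X_{1..n}) := relation b /\ (0 < b i)%N /\ (forall j, j \notin clos [set i] -> b j = 0%N).
(* Choose the relation with the least value at i. *)
have ex : exists k, `[< exists2 b, good b & b i = k >].
  have [w Rw wE] := interior_point W (~: clos [set i]).
  exists (w i); apply/asboolP; exists w => //; split=> //; split.
    rewrite lt0n wE; apply/negP => /clos_facets[s]; rewrite inE => sI iS.
    by move/negP: sI; apply; apply: pureQ.
  move=> j jI; apply/eqP; rewrite wE; apply: (subsetP (sub_clos W _)).
  by rewrite inE.
case: (ex_minnP ex) => _ /asboolP[b [Rb [b0 bI]] <-] bmin.
exists b; split=> // u Ru.
pose v := [multinom (if j \in clos [set i] then u j else 0) | j < n]%N.
have prop j (y : 'X_{1..n}) : j \in clos [set i] -> relation y -> (y j * p i = y i * p j)%N.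
  move=> ji /relation_vec Ry; have := facet_proportional ji Ry.
  by rewrite !mxE -!natrM => /eqP; rewrite eqr_nat => /eqP.
have ub j : j \in clos [set i] -> (u j * b i = u i * b j)%N.
  move=> ji; apply/eqP; rewrite -(eqn_pmul2r (p_gt0 i)) mulnAC (prop j u) //.
  by rewrite -!mulnA (prop j b) // [(p j * b i)%N]mulnC.
have Rv : relation v.
  apply/relation_vec; have /relation_vec Rb' := Rb.
  have bi : (b i)%:R != 0 :> rat by rewrite pnatr_eq0 -lt0n.
  have E : vec v = ((u i)%:R / (b i)%:R) *: vec b.
    apply/rowP => j; rewrite !mxE mnmE; case: ifPn => [ji|/bI ->]; last by rewrite mulr0.
    apply: (mulIf bi); rewrite -natrM ub // natrM mulrAC divfK //.
  by rewrite E -scalemxAl Rb' scaler0.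
have vi : v i = u i by rewrite mnmE mem_clos1.
pose q := (u i %/ b i)%N.
have le : (b *+ q <= v)%MM.
  apply/mnm_lepP => j; rewrite mulmnE mnmE; case: ifPn => [ji|/bI ->]; last by rewrite mul0n.
  by rewrite -(leq_pmul2r b0) ub // -mulnA mulnC leq_mul2r leq_trunc_div orbT.
have Rd := relationB Rv (relationMn q Rb) le.
apply/negPn/negP => ndvd.
have di : (v - b *+ q)%MM i = (u i %% b i)%N.
  by rewrite mnmBE mulmnE vi {1}(divn_eq (u i) (b i)) -/q mulnC addKn.
have : (b i <= u i %% b i)%N.
  apply: bmin; apply/asboolP; exists (v - b *+ q)%MM => //; split=> //; split.
    by rewrite di lt0n.
  by move=> j jI; rewrite mnmBE mnmE (negPf jI) sub0n.
by rewrite leqNgt ltn_mod b0.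
Qed.

(** There is one generator for each class clos [set i], and by proportionality the
    restriction of u to a class is determined by one coordinate mk c. *)
Lemma free_monoid : exists (k : nat) (b : 'I_k -> 'X_{1..n}) (mk : 'I_k -> 'I_n),
  [/\ (forall c, relation (b c)), (forall c, (0 < b c (mk c))%N),
      (forall c c', c' != c -> b c' (mk c) = 0%N) &
      forall u, relation u -> exists nu : 'X_{1..k}, u = (\sum_c b c *+ nu c)%MM].
Proof.
have [b bP] := choice facet_generator.
have Rb i : relation (b i) by case: (bP i).
have b0 i : (0 < b i i)%N by case: (bP i).
have bI i j : j \notin clos [set i] -> b i j = 0%N by case: (bP i) => _ _ + _; apply.
have bd i u : relation u -> (b i i %| u i)%N by case: (bP i) => _ _ _; apply.
pose Cl := [set clos [set i] | i in [set: 'I_n]].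
have mkP (c : 'I_#|Cl|) : exists i, clos [set i] = enum_val c.
  by have /imsetP[i _ E] := enum_valP c; exists i.
have [mk mkE] := choice mkP.
exists #|Cl|, (fun c => b (mk c)), mk; split=> [c|c|c c' cc'|u Ru] //.
  apply: bI; apply: contra cc' => mc; apply/eqP/enum_val_inj.
  by rewrite -!mkE; apply/esym/clos1_eq.
exists [multinom (u (mk c) %/ b (mk c) (mk c))%N | c < #|Cl|].
apply/mnmP => j; rewrite mnm_sumE.
have jCl : clos [set j] \in Cl by apply: imset_f; rewrite inE.
pose c := enum_rank_in jCl (clos [set j]).
have cE : clos [set mk c] = clos [set j] by rewrite mkE enum_rankK_in.
rewrite (bigD1 c) //= big1 ?addn0 => [|c' cc']; last first.
  rewrite mulmnE bI ?mul0n //; apply: contra cc' => jc'; apply/eqP/enum_val_inj.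
  by rewrite -!mkE cE; apply/esym/clos1_eq.
have jc : j \in clos [set mk c] by rewrite cE mem_clos1.
rewrite mulmnE mnmE.
have prop (y : 'X_{1..n}) : relation y -> (y j * p (mk c) = y (mk c) * p j)%N.
  move=> /relation_vec Ry; have := facet_proportional jc Ry.
  by rewrite !mxE -!natrM => /eqP; rewrite eqr_nat => /eqP.
have ub : (u j * b (mk c) (mk c) = u (mk c) * b (mk c) j)%N.
  apply/eqP; rewrite -(eqn_pmul2r (p_gt0 (mk c))) mulnAC (prop u) //.
  by rewrite -!mulnA (prop (b (mk c))) // [(p j * b (mk c) (mk c))%N]mulnC.
apply/eqP; rewrite -(eqn_pmul2r (b0 (mk c))) ub -mulnA divnK ?bd //.
by rewrite mulnC.
Qed.

End FreeMonoid.

(** * Toric varieties with a quotient singularity *)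

(* A is the coordinate ring of a toric variety, in variables changed by tau. *)
Section ToricRing.
Variables (K : fieldType) (n r : nat) (W : 'I_n -> 'I_r -> int).
Local Notation D := {mpoly K[n]}.
Variables (tau sig : {rmorphism D -> D}).
Hypotheses (tauK : cancel tau sig) (sigK : cancel sig tau).
Hypotheses (tauC : forall c, tau c%:MP = c%:MP).
Variable A : set D.
Hypothesis AE : forall f, A f <-> (forall u, u \in msupp (tau f) -> relation W u).

Let sigC c : sig c%:MP = c%:MP. Proof. by rewrite -{1}tauC tauK. Qed.

Definition mono (u : 'X_{1..n}) : D := sig 'X_[u].

Lemma tau_mono u : tau (mono u) = 'X_[u]. Proof. exact: sigK. Qed.

Lemma toric_coef0 f u : A f -> ~~ relation W u -> (tau f)@_u = 0.
Proof. by move=> /AE Af Ru; apply: memN_msupp_eq0; apply: contra Ru => /Af. Qed.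

Lemma mono_in u : relation W u -> A (mono u).
Proof. by move=> Ru; apply/AE => v; rewrite tau_mono msuppX inE => /eqP ->. Qed.

Lemma toric_subalg : subalg_set A.
Proof.
have A_coef f : A f <-> (forall u, ~~ relation W u -> (tau f)@_u = 0).
  split=> [Af u|H]; first exact: toric_coef0.
  apply/AE => u; rewrite mcoeff_msupp; apply: contraNT => /H/eqP.
  by [].
split; last first.
  move=> c; apply/AE => u; rewrite tauC msuppC; case: eqP => //= _.
  by rewrite inE => /eqP ->; apply: relation0.
split.
- apply/AE => u; rewrite rmorph1 msupp1 inE => /eqP ->; exact: relation0.
- move=> f g /A_coef Af /A_coef Ag; apply/A_coef => u Ru.
  by rewrite rmorphB mcoeffB Af // Ag // subrr.
- move=> f g /AE Af /AE Ag; apply/AE => u; rewrite rmorphM => /msuppM_le.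
  by case/allpairsP => -[v w] /= [/Af Rv /Ag Rw ->]; apply: relationD.
Qed.
Let subA : subring_set A. Proof. by case: toric_subalg. Qed.
Let cstA c : A c%:MP. Proof. by case: toric_subalg. Qed.

Lemma mono_expansion f : f = \sum_(u <- msupp (tau f)) (tau f)@_u *: mono u.
Proof.
rewrite -[LHS]tauK {1}(mpolyE (tau f)) rmorph_sum; apply: eq_bigr => u _.
by rewrite -mul_mpolyC rmorphM /= sigC mul_mpolyC.
Qed.

(** The ideal of the image of the origin. *)
Definition mA : set D := [set f | A f /\ (tau f)@_0%MM = 0].

Variables (x : point A) (xE : proj1_sig x = mA).
Let idm : is_ideal A mA. Proof. by rewrite -xE; apply: point_ideal. Qed.
Let idmk k := ideal_exp_ideal subA idm k.

Lemma mono_max u : relation W u -> u != 0%MM -> mA (mono u).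
Proof.
move=> Ru u0; split; first exact: mono_in.
by rewrite tau_mono mcoeffX (negPf u0).
Qed.

Lemma mA_pow_ord k f : ideal_exp A mA k f -> ord_ge k (tau f).
Proof.
have idk := @ord_ge_ideal n K k.
move=> [s [sP ->]]; rewrite rmorph_sum big_seq; apply: (ideal_sum idk) => q /sP[_ [y [my ->]]].
rewrite rmorphM; apply: (idealMl idk) => //; rewrite rmorph_prod.
elim: k y my {idk sP} => [|k IH] y my; first by move=> m.
rewrite big_ord_recl; apply: (@ord_geM _ _ 1); last by apply: IH.
move=> m; rewrite ltnS leqn0 mdeg_eq0 => /eqP ->.
by case: (my ord0).
Qed.

(** Gordan's lemma: the minimal nonzero relations are finite in number. *)
Lemma exists_generators : exists gs : seq 'X_{1..n},
  (forall v, v \in gs -> relation W v /\ v != 0%MM) /\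
  (forall u, relation W u -> u != 0%MM -> exists2 v, v \in gs & (v <= u)%MM).
Proof.
have [s [sP sdom]] := dickson (fun u => relation W u /\ u != 0%MM).
by exists s; split=> // u Ru u0; apply: sdom.
Qed.

Lemma mono_split u v : (v <= u)%MM -> mono u = mono v * mono (u - v)%MM.
Proof. by move=> le; rewrite /mono -rmorphM -mpolyXD addmC submK. Qed.

(** A generator divides x^u, and the quotient is again in A. *)
Lemma mono_pow : exists2 c : nat, (0 < c)%N & forall k u, relation W u ->
  (c * k <= mdeg u)%N -> ideal_exp A mA k (mono u).
Proof.
have [gs [gsR gsdom]] := exists_generators.
pose c := (\sum_(v <- gs) mdeg v).+1.
exists c => //; elim=> [|k IH] u Ru le.
  by apply: (ideal_exp0 subA idm); apply: mono_in.
have u0 : u != 0%MM by apply: contraTneq le => ->; rewrite mdeg0 mulnS; lia.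
have [v vs vu] := gsdom u Ru u0; have [Rv v0] := gsR v vs.
rewrite (mono_split vu); apply: (ideal_expS subA idm); first exact: mono_max.
apply: IH; first exact: relationB.
have := congr1 (@mdeg n) (submK vu); rewrite mdegD => E.
have : (mdeg v <= \sum_(v <- gs) mdeg v)%N by rewrite (big_rem v vs) leq_addr.
by move: le; rewrite -E /c mulnS; lia.
Qed.

Lemma mA_fg : exists (T : finType) (a : T -> D), mA = ideal_gen A (range a).
Proof.
have [gs [gsR gsdom]] := exists_generators.
pose a (i : 'I_(size gs)) : D := mono (nth 0%MM gs i).
have aR i : mA (a i) by have [Rv v0] := gsR _ (mem_nth 0%MM (ltn_ord i)); apply: mono_max.
have aS : range a `<=` A by move=> _ [i _ <-]; apply: idealR idm (aR i).
have idB := ideal_gen_ideal subA aS.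
exists 'I_(size gs), a; apply/seteqP; split; last first.
  by apply: (ideal_gen_min idm) => _ [t _ <-].
move=> f [Af f0]; rewrite (mono_expansion f) big_seq; apply: (ideal_sum idB) => u us.
rewrite -mul_mpolyC; apply: (idealMl idB) => //.
have u0 : u != 0%MM by apply: contraTneq us => ->; rewrite mcoeff_msupp f0 eqxx.
have Ru : relation W u by move/AE: Af; apply.
have [v vs vu] := gsdom u Ru u0; have [Rv v0] := gsR v vs.
rewrite (mono_split vu); apply: (idealMr idB).
  by apply: mono_in; apply: relationB.
have lt : (index v gs < size gs)%N by rewrite index_mem.
by apply: (sub_ideal_gen subA); exists (Ordinal lt); rewrite // /a /= nth_index.
Qed.

(** The ideal of the closure of the torus orbit attached to the face cut out by S. *)
Definition face_ideal (S : {set 'I_n}) : set D :=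
  [set f | A f /\ forall u, vanishes u S -> (tau f)@_u = 0].

Lemma face_ideal_ideal S : is_ideal A (face_ideal S).
Proof.
split.
- by move=> f [].
- by split; [exact: sub_R0 | move=> u _; rewrite rmorph0 mcoeff0].
- move=> f g [Af f0] [Ag g0]; split; first exact: sub_RD.
  by move=> u uS; rewrite rmorphD mcoeffD f0 ?g0 ?addr0.
- move=> a f Aa [Af f0]; split; first exact: sub_RM.
  move=> u /vanishesP uS; rewrite rmorphM mcoeffM big1 // => -[u1 u2] /= /eqP uE.
  rewrite f0 ?mulr0 //; apply/vanishesP => i iS.
  by have := congr1 (fun m : 'X_{1..n} => m i) uE; rewrite uS // mnmDE; lia.
Qed.

Lemma mono_face u S : relation W u -> ~~ vanishes u S -> face_ideal S (mono u).
Proof.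
move=> Ru uS; split; first exact: mono_in.
by move=> v vS; rewrite tau_mono mcoeffX; case: eqP => // uv; rewrite uv vS in uS.
Qed.

Hypothesis charK0 : [pchar K] =i pred0.
Variables (d : nat) (gT : finGroupType) (G : {group gT}) (rG : mx_representation K G d).
Local Notation H := (group_image rG).
Local Notation S2 := (invariants H).
Local Notation mS := (eval_ideal H 0).
Let y : point S2 := quot_map H 0.
Let sub2 : subring_set S2. Proof. by case: (invariants_subalg H). Qed.
Let idS := mS_ideal rG.
Let idSk k := ideal_exp_ideal sub2 idS k.
Let cstS c : S2 c%:MP. Proof. by case: (invariants_subalg H). Qed.

Section Jets.
Variables (N : nat) (theta : D -> {mpoly K[d]}).
Hypothesis jet : jet_iso x y N theta.

Lemma jet_sum (T : Type) (s : seq T) (c : T -> K) (f : T -> D) :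
  (forall t, A (f t)) ->
  ideal_exp S2 mS N (theta (\sum_(t <- s) c t *: f t) - \sum_(t <- s) c t *: theta (f t)).
Proof.
move=> Af; have [jin jD jM jC _ _] := jet.
have id := idSk N.
have AZ t : A (c t *: f t) by rewrite -mul_mpolyC; apply: sub_RM.
elim: s => [|t s IH].
  by rewrite !big_nil subr0; have := jC 0; rewrite mpolyC0 subr0.
have As : A (\sum_(t <- s) c t *: f t) by apply: (sub_R_sum subA).
rewrite !big_cons.
set a := c t *: f t; set b := \sum_(_ <- _) _ *: f _; set b' := \sum_(_ <- _) _ *: theta _.
have -> : theta (a + b) - (c t *: theta (f t) + b') =
  (theta (a + b) - (theta a + theta b)) + (theta b - b') + (theta a - c t *: theta (f t)).
  by ring.
apply: (idealD id); first by apply: (idealD id) => //; apply: jD; [apply: AZ | ].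
have -> : theta a - c t *: theta (f t) =
  (theta a - theta (c t)%:MP * theta (f t)) + (theta (c t)%:MP - (c t)%:MP) * theta (f t).
  by rewrite -mul_mpolyC; ring.
apply: (idealD id); last by apply: (idealMr id); [exact: jin (Af t) | exact: jC].
by rewrite /a -mul_mpolyC; apply: jM.
Qed.

Lemma jet_sub f g : A f -> A g -> ideal_exp S2 mS N (theta (f - g) - (theta f - theta g)).
Proof.
move=> Af Ag; have [_ jD _ _ _ _] := jet.
have Afg := sub_RB subA Af Ag.
have := jD _ _ Afg Ag; rewrite subrK => H1.
have -> : theta (f - g) - (theta f - theta g) = - (theta f - (theta (f - g) + theta g)) by ring.
exact: (idealN sub2 (idSk N)).
Qed.

(** The extension to K[z] of the image of a face ideal, plus a power of the ideal
    of the origin. *)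
Definition face_ext (k : nat) (S : {set 'I_n}) : set {mpoly K[d]} :=
  [set p | exists q o, [/\ ideal_gen setT (theta @` face_ideal S) q, ord_ge k o & p = q + o]].

Let subT : subring_set (setT : set {mpoly K[d]}). Proof. by split. Qed.
Let idT (X : set {mpoly K[d]}) : is_ideal setT (ideal_gen setT X).
Proof. exact: (ideal_gen_ideal subT). Qed.

Lemma face_ext_ideal k S : is_ideal setT (face_ext k S).
Proof.
split=> //.
- exists 0, 0; rewrite addr0; split=> //; first exact: ideal0 (idT _).
  exact: ideal0 (@ord_ge_ideal d K k).
- move=> _ _ [q [o [qS ok ->]]] [q' [o' [qS' ok' ->]]]; exists (q + q'), (o + o').
  by rewrite addrACA; split=> //; [exact: idealD (idT _) _ _ | exact: idealD (@ord_ge_ideal d K k) _ _].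
- move=> a _ _ [q [o [qS ok ->]]]; exists (a * q), (a * o); rewrite mulrDr.
  by split=> //; [exact: idealMl (idT _) _ _ | exact: idealMl (@ord_ge_ideal d K k) _ _].
Qed.

Lemma face_ext_ord k S : ord_ge k `<=` face_ext k S.
Proof.
by move=> o ok; exists 0, o; rewrite add0r; split=> //; apply: ideal0 (idT _).
Qed.

Lemma face_ext_mono k S u : relation W u -> ~~ vanishes u S -> face_ext k S (theta (mono u)).
Proof.
move=> Ru uS; exists (theta (mono u)), 0; rewrite addr0; split=> //.
  by apply: (sub_ideal_gen subT); exists (mono u) => //; apply: mono_face.
exact: ideal0 (@ord_ge_ideal d K k).
Qed.

Local Notation cG := (conductor d G).

(** Modulo mS^k, the image of the face ideal is an ideal J of the invariant ring;
    it is recovered from its extension to K[z] by [reynolds_contract], while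
    the power of the ideal of the origin is absorbed by [ord_ge_ext_pow]. *)
Lemma face_ext_thick k S f z : (k <= N)%N -> A f -> ideal_exp S2 mS k (theta f - z) ->
  face_ext (cG * k) S z -> exists2 h, face_ideal S h & ideal_exp A mA k (f - h).
Proof.
move=> kN Af fs; have [jin jD jM _ jord jsurj] := jet.
have idk := idSk k.
have leN := ideal_exp_le sub2 idS kN.
(* The face ideal of A, transported to the invariant ring modulo mS^k. *)
pose J : set {mpoly K[d]} := [set s | S2 s /\ exists2 h, face_ideal S h & ideal_exp S2 mS k (s - theta h)].
have idF := face_ideal_ideal S.
have idJ : is_ideal S2 J.
  split; first by move=> s [].
  - split; first exact: sub_R0.
    exists 0; first exact: ideal0 idF.
    rewrite sub0r; apply: (idealN sub2 idk); apply/(jord _ _ kN); first exact: sub_R0.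
    by rewrite xE; apply: ideal0 (idmk k).
  - move=> s s' [Ss [h Fh sh]] [Ss' [h' Fh' sh']]; split; first exact: (sub_RD sub2).
    have Ah := idealR idF Fh; have Ah' := idealR idF Fh'.
    exists (h + h'); first exact: (idealD idF).
    have -> : s + s' - theta (h + h') =
      (s - theta h) + (s' - theta h') - (theta (h + h') - (theta h + theta h')) by ring.
    apply: (idealB sub2 idk); last by apply: leN; apply: jD.
    exact: (idealD idk).
  - move=> a s Sa [Ss [h Fh sh]]; split; first exact: (sub_RM sub2).
    have Ah := idealR idF Fh.
    have [a' Aa' aE] := jsurj a Sa.
    exists (a' * h); first exact: (idealMl idF).
    have -> : a * s - theta (a' * h) = a * (s - theta h) + (a - theta a') * theta h
       - (theta (a' * h) - theta a' * theta h) by ring.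
    apply: (idealB sub2 idk); last by apply: leN; apply: jM.
    apply: (idealD idk); first exact: (idealMl idk).
    by apply: (idealMr idk); [apply: jin | apply: leN].
move=> [q [o [qS ok zE]]].
have : J (theta f).
  apply: (reynolds_contract charK0 idJ); first exact: jin.
  have sub1 : ideal_gen setT (theta @` face_ideal S) `<=` ideal_gen setT J.
    apply: (ideal_gen_min (idT _)) => _ [h Fh <-]; apply: (sub_ideal_gen subT).
    have Ah := idealR idF Fh.
    split; first exact: jin.
    by exists h => //; rewrite subrr; apply: ideal0 idk.
  have sub2' : ext_pow rG k `<=` ideal_gen setT J.
    apply: (ideal_gen_min (idT _)) => s sk.
    apply: (sub_ideal_gen subT); split; first exact: idealR idk sk.
    exists 0; first exact: ideal0 idF.
    apply: (idealB sub2 idk) => //; apply/(jord _ _ kN); first exact: sub_R0.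
    by rewrite xE; apply: ideal0 (idmk k).
  rewrite -(subrK z (theta f)) zE; apply: (idealD (idT _)); last apply: (idealD (idT _)).
  - by apply: sub2'; rewrite -zE; apply: (sub_ideal_gen subT).
  - exact: sub1.
  - by apply: sub2'; apply: (ord_ge_ext_pow charK0).
move=> [_ [h Fh fh]]; exists h => //; have Ah := idealR idF Fh.
rewrite -xE; apply/(jord _ _ kN); first exact: (sub_RB subA).
rewrite -(subrK (theta f - theta h) (theta _)); apply: (idealD idk) => //.
by apply: leN; apply: jet_sub.
Qed.

Definition face_pts (C : nat) (I : {set 'I_n}) : {set 'X_{1..n < C}} :=
  finset.finset (fun u : 'X_{1..n < C} => relation W u && vanishes u I).

(** The monomials of degree below k on the face are independent modulo the face
    ideal and m^k, so their images are by [face_ext_thick]. *)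
Lemma codim_face_ge k S e : (k <= N)%N ->
  has_dual (face_ext (cG * k) S) e -> (#|face_pts k S| <= e)%N.
Proof.
move=> kN he.
pose T := {u : 'X_{1..n < k} | u \in face_pts k S}.
have TP (t : T) : relation W (val t) /\ vanishes (val t) S.
  by have := valP t; rewrite finset.inE => /andP[].
rewrite -[#|face_pts _ _|]card_sig.
apply: (has_dual_ge_indep (w := fun t : T => theta (mono (val t))) he) => c cU t.
have AT (t' : T) : A (mono (val t')) by apply: mono_in; case: (TP t').
pose f := \sum_(t' : T) c t' *: mono (val t').
have Af : A f by apply: (sub_R_sum subA) => t' _; rewrite -mul_mpolyC; apply: (sub_RM subA).
have fU : ideal_exp S2 mS k (theta f - \sum_t' c t' *: theta (mono (val t'))).
  by apply: (ideal_exp_le sub2 idS kN); apply: jet_sum.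
have idU := face_ext_ideal (cG * k) S.
have [h [Ah h0] fh] := face_ext_thick kN Af fU cU.
have := mA_pow_ord fh (m := val t) (bmdeg (val t)).
have [_ vt] := TP t.
rewrite rmorphB mcoeffB h0 // subr0 /f rmorph_sum raddf_sum /=.
rewrite (bigD1 t) //= -mul_mpolyC rmorphM /= tauC tau_mono mul_mpolyC mcoeffZ mcoeffX eqxx mulr1.
rewrite big1 ?addr0 // => t' tt'; rewrite -mul_mpolyC rmorphM /= tauC tau_mono mul_mpolyC.
rewrite mcoeffZ mcoeffX; case: eqP => [E|_]; last by rewrite mulr0.
by case/eqP: tt'; do 2!apply: val_inj.
Qed.

Definition face_type (C : nat) (I : {set 'I_n}) : finType :=
  {u : 'X_{1..n < C} | u \in face_pts C I}.

Definition face_gen C I (t : exps d G * face_type C I) : {mpoly K[d]} :=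
  theta (mono (val t.2)) * 'X_[exp_mnm t.1].

(** K[z] is generated over the invariants by finitely many monomials, and the
    invariants are spanned modulo mS^N by the images of monomials of A. Those of
    degree at least c * N are in mS^N, and those off one of the two faces lie in U1
    or in U2. *)
Lemma span_quotient c (U1 U2 : set {mpoly K[d]}) (T1 T2 : {set 'I_n}) :
  (forall k u, relation W u -> (c * k <= mdeg u)%N -> ideal_exp A mA k (mono u)) ->
  is_ideal setT U1 -> is_ideal setT U2 -> ord_ge N `<=` U1 ->
  (forall u, relation W u -> ~~ vanishes u T1 -> U1 (theta (mono u))) ->
  (forall u, relation W u -> ~~ vanishes u T2 -> U2 (theta (mono u))) ->
  forall p, exists a : exps d G * face_type (c * N) (finset.setU T1 T2) -> K,
    exists u1 u2, [/\ U1 u1, U2 u2 & p = \sum_t a t *: face_gen t + u1 + u2].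
Proof.
move=> cP id1 id2 sub1 H1 H2.
have [jin _ _ _ jord jsurj] := jet.
pose Sp : set {mpoly K[d]} := [set p | exists a : exps d G * face_type (c * N) (finset.setU T1 T2) -> K,
    exists u1 u2, [/\ U1 u1, U2 u2 & p = \sum_t a t *: face_gen t + u1 + u2]].
have SpD p q : Sp p -> Sp q -> Sp (p + q).
  move=> [a [u1 [u2 [Uu1 Uu2 ->]]]] [b [v1 [v2 [Uv1 Uv2 ->]]]].
  exists (fun t => a t + b t), (u1 + v1), (u2 + v2).
  split; [exact: (idealD id1) | exact: (idealD id2) |].
  rewrite [in RHS](eq_bigr (fun t => a t *: face_gen t + b t *: face_gen t)) => [|t _].
    by rewrite big_split addrACA; congr (_ + _); rewrite addrACA.
  by rewrite scalerDl.
have SpZ b p : Sp p -> Sp (b *: p).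
  move=> [a [u1 [u2 [Uu1 Uu2 ->]]]]; exists (fun t => b * a t), (b *: u1), (b *: u2).
  split; [by rewrite -mul_mpolyC; exact: (idealMl id1) | by rewrite -mul_mpolyC; exact: (idealMl id2) |].
  rewrite !scalerDr scaler_sumr; congr (_ + _ + _); apply: eq_bigr => t _.
  by rewrite scalerA.
have Sp1 u : U1 u -> Sp u.
  move=> Uu; exists (fun=> 0), u, 0; rewrite addr0 big1 ?add0r => [|t _]; last by rewrite scale0r.
  by split=> //; apply: ideal0 id2.
have Sp2 u : U2 u -> Sp u.
  move=> Uu; exists (fun=> 0), 0, u; rewrite addr0 big1 ?add0r => [|t _]; last by rewrite scale0r.
  by split=> //; apply: ideal0 id1.
have Sp_sum (T : Type) (s : seq T) (P : pred T) (F : T -> {mpoly K[d]}) :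
    (forall t, P t -> Sp (F t)) -> Sp (\sum_(t <- s | P t) F t).
  by move=> SF; elim/big_ind: _ => //; apply: (Sp1); apply: ideal0 id1.
have mSU q : ideal_exp S2 mS N q -> U1 q by move=> /mS_pow_ord /sub1.
move=> p; rewrite -/(Sp p).
have [s [Ss ->]] := module_finite charK0 rG p.
apply: (Sp_sum) => e _; have [f Af fE] := jsurj _ (Ss e).
rewrite -(subrK (theta f) (s e)) mulrDl; apply: (SpD).
  by apply: (Sp1); apply: (idealMr id1) => //; apply: (mSU).
pose Ft := \sum_(u <- msupp (tau f)) (if relation W u then (tau f)@_u else 0) *: theta (if relation W u then mono u else 0).
have FE : ideal_exp S2 mS N (theta f - Ft).
  rewrite {1}(mono_expansion f).
  have -> : \sum_(u <- msupp (tau f)) (tau f)@_u *: mono u =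
      \sum_(u <- msupp (tau f)) (if relation W u then (tau f)@_u else 0) *: (if relation W u then mono u else 0).
    rewrite !big_seq; apply: eq_bigr => u us; have -> // : relation W u.
    by move/AE: Af; apply.
  by apply: jet_sum => u; case: ifP => [/mono_in//|_]; apply: sub_R0.
rewrite -(subrK Ft (theta f)) mulrDl; apply: (SpD).
  by apply: (Sp1); apply: (idealMr id1) => //; apply: (mSU).
rewrite /Ft mulr_suml; apply: (Sp_sum) => u _; rewrite -scalerAl; apply: (SpZ).
case: ifP => Ru; last first.
  apply: (Sp1); apply: (idealMr id1) => //; apply: (mSU).
  apply/(jord _ _ (leqnn _)); first exact: sub_R0.
  by rewrite xE; apply: ideal0 (idmk N).
have [big|small] := leqP (c * N) (mdeg u).
  apply: (Sp1); apply: (idealMr id1) => //; apply: (mSU).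
  by apply/(jord _ _ (leqnn _)); [exact: mono_in | rewrite xE; apply: (cP)].
have [v1|v1] := boolP (vanishes u T1); last by apply: (Sp1); apply: (idealMr id1) => //; apply: (H1).
have [v2|v2] := boolP (vanishes u T2); last by apply: (Sp2); apply: (idealMr id2) => //; apply: (H2).
have uP : BMultinom small \in face_pts (c * N) (finset.setU T1 T2).
  rewrite finset.inE /= Ru; apply/vanishesP => i; rewrite finset.inE => /orP[] iT.
    by move/vanishesP: v1; apply.
  by move/vanishesP: v2; apply.
pose t0 : exps d G * face_type (c * N) (finset.setU T1 T2) := (e, Sub (BMultinom small) uP).
exists (fun t => (t == t0)%:R), 0, 0; rewrite !addr0 (bigD1 t0) //= eqxx scale1r big1 ?addr0.
  by split; [exact: ideal0 id1 | exact: ideal0 id2 |].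
by move=> t /negPf ->; rewrite scale0r.
Qed.

End Jets.

Hypothesis jets : forall N, exists theta, jet_iso x y N theta.

Local Notation cG := (conductor d G).

Lemma card_exps : #|exps d G| = (#|G| ^ d)%N.
Proof. by rewrite card_ffun !card_ord. Qed.

Lemma card_face_type C I : #|face_type C I| = #|face_pts C I|.
Proof. by rewrite card_sig. Qed.

Lemma card_face_pts_le C I : (#|face_pts C I| <= C ^ \rank (Lmx W I))%N.
Proof.
apply: leq_trans (card_face_le W C I); apply: subset_leq_card.
by apply/fintype.subsetP => u; rewrite !finset.inE.
Qed.

Lemma card_face_pts_clos C I : #|face_pts C I| = #|face_pts C (clos W I)|.
Proof.
apply: eq_card => u; rewrite !finset.inE; case: (boolP (relation W u)) => //= Ru.
apply/idP/idP => [|/vanishesP uI]; first exact: vanishes_clos.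
by apply/vanishesP => i iI; apply: uI; apply: (fintype.subsetP (sub_clos W I)).
Qed.

(** The N-th jets of K[z] have a dimension of order N^d, and are spanned by
    O(N^(rk W)) elements. *)
Lemma dim_le : (d <= rk W)%N.
Proof.
have [c c0 cP] := mono_pow.
apply: (@leq_growth _ _ (#|G| ^ d * (c * d.+1) ^ rk W)) => k k0.
(* All monomials with exponents below k have degree below N. *)
pose N := (d.+1 * k)%N.
have [theta jet] := jets N.
have idN := @ord_ge_ideal d K N.
have none u : relation W u -> ~~ vanishes u finset.set0 -> ord_ge N (theta (mono u)).
  by move=> _ /negP[]; apply/vanishesP => i; rewrite finset.inE.
have sp := span_quotient jet cP idN idN (fun _ h => h) none none.
have spN : spanned (ord_ge N) (face_gen theta (C := c * N) (I := finset.setU finset.set0 finset.set0)).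
  move=> p; have [a [u1 [u2 [U1 U2 ->]]]] := sp p; exists a.
  have E (X u v : {mpoly K[d]}) : X + u + v - X = u + v by ring.
  by rewrite E; apply: (idealD idN).
have [e he] := exists_dual (ideal_subspace idN) spN.
have le1 := has_dual_le_span he spN.
have le2 : (k ^ d <= e)%N.
  have <- : #|{ffun 'I_d -> 'I_k}| = (k ^ d)%N by rewrite card_ffun !card_ord.
  pose mn (h : {ffun 'I_d -> 'I_k}) : 'X_{1..d} := [multinom (h i : nat) | i < d].
  apply: (has_dual_ge_indep (w := fun h => 'X_[mn h] : {mpoly K[d]}) he) => b bN h.
  have lt_h : (mdeg (mn h) < N)%N.
    have : (mdeg (mn h) <= d * k)%N.
      rewrite mdegE -[d in X in (_ <= X)%N]card_ord -sum_nat_const; apply: leq_sum => i _.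
      by rewrite mnmE ltnW.
    by rewrite /N mulSn; lia.
  have := bN _ lt_h; rewrite raddf_sum /= (bigD1 h) //= mcoeffZ mcoeffX eqxx mulr1.
  rewrite big1 ?addr0 // => h' hh'; rewrite mcoeffZ mcoeffX; case: eqP => [E|_]; last by rewrite mulr0.
  case/eqP: hh'; apply/ffunP => i; apply: val_inj.
  by have := congr1 (fun m : 'X_{1..d} => m i) E; rewrite !mnmE.
apply: leq_trans le2 _; apply: leq_trans le1 _.
rewrite card_prod card_exps card_face_type -mulnA leq_mul2l; apply/orP; right.
rewrite -expnMn; have -> : (c * d.+1 * k = c * N)%N by rewrite /N mulnA.
by apply: leq_trans (card_face_pts_le _ _) _; rewrite finset.setU0.
Qed.

(** Compare in [intersection_codim] the growth of the codimensions of the two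
    extended face ideals, at least k^(delta W S) and k^(delta W T), with that of
    their sum, O(k^(delta W (S :|: T))); the factor N^d is absorbed by [dim_le]. *)
Lemma delta_submodular (S T : {set 'I_n}) :
  (delta W S + delta W T <= delta W (finset.setU S T) + rk W)%N.
Proof.
suff : (delta W S + delta W T <= d + delta W (finset.setU S T))%N.
  by have := dim_le; lia.
have [c c0 cP] := mono_pow.
have [C1 C10 ge1] := card_face_ge W S.
have [C2 C20 ge2] := card_face_ge W T.
pose M := (c * (cG * (C1 * C2)))%N.
apply: (@leq_growth _ _ ((cG * (C1 * C2) + cG * (C1 * C2)) ^ d * #|G| ^ d * M ^ delta W (finset.setU S T))) => k k0.
(* The order at which the codimensions of both face ideals are bounded below by
     full powers of k. *)
pose N := (cG * (C1 * C2 * k))%N.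
have kN : (C1 * C2 * k <= N)%N by rewrite /N leq_pmull.
have [theta jet] := jets N.
pose U1 := face_ext theta N S; pose U2 := face_ext theta N T.
have id1 : is_ideal setT U1 := face_ext_ideal theta N S.
have id2 : is_ideal setT U2 := face_ext_ideal theta N T.
have o1 : ord_ge N `<=` U1 := @face_ext_ord theta N S.
have o2 : ord_ge N `<=` U2 := @face_ext_ord theta N T.
have m1 u : relation W u -> ~~ vanishes u S -> U1 (theta (mono u)) by apply: face_ext_mono.
have m2 u : relation W u -> ~~ vanishes u T -> U2 (theta (mono u)) by apply: face_ext_mono.
have fin (U : set {mpoly K[d]}) : is_ideal setT U -> ord_ge N `<=` U -> exists e, has_dual U e.
  move=> idU oU.
  have sp : spanned U (fun m : 'X_{1..d < N} => 'X_[m] : {mpoly K[d]}).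
    by move=> p; have [a Ha] := @spanned_ord_ge K d N p; exists a; apply: oU.
  exact: exists_dual (ideal_subspace idU) sp.
have [e1 he1] := fin _ id1 o1; have [e2 he2] := fin _ id2 o2.
have sp := span_quotient jet cP id1 id2 o1 m1 m2.
have le := intersection_codim id1 id2 o1 o2 he1 he2 sp.
have le1 : (k ^ delta W S <= e1)%N.
  apply: leq_trans (codim_face_ge jet kN he1).
  rewrite card_face_pts_clos; apply: (@leq_trans ((C2 * k) ^ delta W S)).
    by case: (delta W S) => [|e]; rewrite ?expn0 // leq_exp2r ?leq_pmull.
  rewrite -mulnA; apply: leq_trans (ge1 _ _) _; first by rewrite muln_gt0 C20.
  by apply: subset_leq_card; apply/fintype.subsetP => u; rewrite !finset.inE.
have le2 : (k ^ delta W T <= e2)%N.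
  apply: leq_trans (codim_face_ge jet kN he2).
  rewrite card_face_pts_clos; apply: (@leq_trans ((C1 * k) ^ delta W T)).
    by case: (delta W T) => [|e]; rewrite ?expn0 // leq_exp2r ?leq_pmull.
  rewrite (mulnC C1 C2) -mulnA; apply: leq_trans (ge2 _ _) _; first by rewrite muln_gt0 C10.
  by apply: subset_leq_card; apply/fintype.subsetP => u; rewrite !finset.inE.
rewrite expnD; apply: leq_trans (leq_mul le1 le2) _; apply: leq_trans le _.
rewrite card_prod card_exps card_face_type.
have -> : (N + N = (cG * (C1 * C2) + cG * (C1 * C2)) * k)%N by rewrite /N; ring.
rewrite [in X in (X <= _)%N]expnMn expnD.
have : (#|face_pts (c * N) (finset.setU S T)| <= (M * k) ^ delta W (finset.setU S T))%N.
  rewrite card_face_pts_clos; apply: leq_trans (card_face_pts_le _ _) _.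
  by rewrite /delta (_ : c * N = M * k)%N // /N /M; ring.
rewrite expnMn; set X := #|face_pts _ _|; set Y := (M ^ _)%N; set Z := (k ^ delta _ _)%N => XYZ.
set P := (_ ^ d)%N; set Q := (k ^ d)%N; set R := (#|G| ^ d)%N.
have -> : (P * R * Y * (Q * Z) = P * Q * (R * (Y * Z)))%N by ring.
by rewrite !leq_mul2l XYZ !orbT.
Qed.

End ToricRing.

(** * Algebraic dependence and chains of primes *)

Section SeparateVariable.
Variables (n : nat) (R : comNzRingType).

(** The last variable is singled out for inductions on the number of variables. *)
Definition separate : {mpoly R[n.+1]} -> {poly {mpoly R[n]}} :=
  mmap (polyC \o @mpolyC n R) (fun i => if unlift ord_max i is Some j then ('X_j)%:P else 'X).
HB.instance Definition _ := GRing.RMorphism.on separate.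

Lemma separate_eval (S : comNzRingType) (iota : {rmorphism R -> S}) (g : 'I_n.+1 -> S) p :
  mmap iota g p = (map_poly (mmap iota (fun j => g (lift ord_max j))) (separate p)).[g ord_max].
Proof.
pose F := horner_eval (g ord_max) \o map_poly (mmap iota (fun j => g (lift ord_max j))) \o separate.
apply: (@rmorph_mpoly_eq _ _ _ (mmap iota g) F) => [c|i] /=.
  by rewrite /horner_eval /separate !mmapC /= map_polyC hornerC /= mmapC.
rewrite /horner_eval /separate !mmapX !mmap1U.
case: unliftP => [j ->|->]; first by rewrite map_polyC hornerC /= mmapX mmap1U.
by rewrite map_polyX hornerX.
Qed.

Lemma separate_inj : injective separate.
Proof.
move=> p q pq.
have E p' : mmap (@mpolyC n.+1 R) (fun i => 'X_i) p' = p'.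
  apply: (@rmorph_mpoly_eq _ _ _ (mmap (@mpolyC n.+1 R) (fun i => 'X_i)) idfun) => [c|i] /=.
    by rewrite mmapC.
  by rewrite mmapX mmap1U.
by rewrite -(E p) -(E q) !separate_eval pq.
Qed.

End SeparateVariable.

(** Expand p in powers of the last variable. Its value g ord_max is in c 1 and not
    in the prime c 0, so if the value of p is in c 0, powers of g ord_max can be
    divided out until the constant coefficient is not 0; its value then lies in c 1,
    against the induction hypothesis for the chain that starts at c 1. *)
Lemma chain_independent (K : fieldType) (L : comNzRingType) (O : set L)
    (iota : {rmorphism K -> L}) (l : nat) (c : nat -> set L) (g : 'I_l -> L) :
  subring_set O -> (forall a, O (iota a)) ->
  (forall i, (i <= l)%N -> prime_ideal O (c i)) ->
  (forall i, (i < l)%N -> c i `<=` c i.+1) ->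
  (forall i : 'I_l, c (l - i)%N (g i) /\ ~ c (l - i.+1)%N (g i)) ->
  forall p, p != 0 -> ~ c 0%N (mmap iota g p).
Proof.
move=> subO Oi; elim: l c g => [|l IH] c g prc inc gc p p0.
  have [idc nc1 _] := prc 0%N isT.
  have E : p = (p@_0%MM)%:MP.
    apply/mpolyP => m; rewrite mcoeffC; have -> : m = 0%MM by apply/mnmP => -[].
    by rewrite eqxx mulr1.
  move: p0; rewrite E mpolyC_eq0 mmapC => a0 ca; apply: nc1.
  rewrite -(rmorph1 iota) -(mulVf a0) rmorphM; exact: (idealMl idc).
have [id0 n01 pr0] := prc 0%N isT.
have [id1 n11 _] := prc 1%N isT.
pose c' i := c i.+1; pose g' j := g (lift ord_max j).
have lE (j : 'I_l) : (lift ord_max j : nat) = j by rewrite lift_max.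
have IH' : forall q, q != 0 -> ~ c 1%N (mmap iota g' q).
  apply: (IH c' g') => [i il|i il|i].
  - exact: prc.
  - exact: inc.
  - have il := ltn_ord i.
    have E1 : (l.+1 - i = (l - i).+1)%N by lia.
    have E2 : (l.+1 - i.+1 = (l - i.+1).+1)%N by lia.
    by have := gc (lift ord_max i); rewrite lE E1 E2.
have [gl1 gl0] : c 1%N (g ord_max) /\ ~ c 0%N (g ord_max).
  by have := gc ord_max; rewrite /= subSnn subnn.
have Og j : O (g j) by have [id' _ _] := prc _ (leq_subr j l.+1); apply: (idealR id'); case: (gc j).
have Om (q : {mpoly K[l]}) : O (mmap iota g' q).
  apply: (sub_R_sum subO) => m _; apply: (sub_RM subO) => //.
  by apply: (sub_R_prod subO) => j _; apply: (sub_RX subO); apply: Og.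
rewrite separate_eval.
have : separate p != 0 by rewrite -(inj_eq (@separate_inj l K)) rmorph0 in p0.
elim/poly_ind: (separate p) => [|q a IHq]; first by rewrite eqxx.
rewrite rmorphD rmorphM /= map_polyX map_polyC hornerD hornerM hornerX hornerC /=.
set v := (map_poly _ q).[_].
have Ov : O v.
  rewrite /v; elim/poly_ind: q {IHq v} => [|q b IHq]; first by rewrite rmorph0 horner0; apply: sub_R0.
  rewrite rmorphD rmorphM /= map_polyX map_polyC hornerD hornerM hornerX hornerC /=.
  by apply: (sub_RD subO) => //; apply: (sub_RM subO).
have [->|a0] := eqVneq a 0.
  rewrite !rmorph0 !addr0 => qX0.
  have q0 : q != 0 by apply: contraNneq qX0 => ->; rewrite mul0r.
  move=> vg; have [cv|//] := pr0 _ _ Ov (Og ord_max) vg; exact: IHq q0 cv.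
move=> _ cs; apply: (IH' a a0).
rewrite -(addKr (v * g ord_max) (mmap _ _ _)) addrC.
apply: (idealB subO id1); first exact: (inc 0%N).
exact: (idealMl id1).
Qed.

Lemma card_bmnm_le m M : (#|{: 'X_{1..m < M}}| <= M ^ m)%N.
Proof.
case: M => [|M].
  by rewrite eq_card0 // => -[u lt_u]; have := lt_u; rewrite ltn0.
pose g (u : 'X_{1..m < M.+1}) : {ffun 'I_m -> 'I_M.+1} := [ffun k => inord (u k)].
have gE (u : 'X_{1..m < M.+1}) k : g u k = u k :> nat.
  rewrite ffunE inordK //; apply: leq_ltn_trans (bmdeg u).
  by rewrite mdegE (bigD1 k) //= leq_addr.
have g_inj : injective g.
  by move=> u v guv; apply/val_inj/mnmP => k; rewrite -!gE guv.
by have := leq_card g g_inj; rewrite card_ffun !card_ord.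
Qed.

Lemma msizeM_pred m (K : fieldType) (p q : {mpoly K[m]}) :
  (msize (p * q) <= (msize p + msize q).-1)%N.
Proof.
have [->|p0] := eqVneq p 0; first by rewrite mul0r msize0.
have [->|q0] := eqVneq q 0; first by rewrite mulr0 msize0.
by rewrite msizeM.
Qed.

(** Otherwise the products of the q i with exponents below N are N^(m+1)
    independent polynomials of degree O(N), but these have dimension O(N^m). *)
Lemma algebraic_dependence (K : fieldType) m (q : 'I_m.+1 -> {mpoly K[m]}) :
  exists2 p : {mpoly K[m.+1]}, p != 0 & mmap (@mpolyC m K) q p = 0.
Proof.
apply/not_notP => none.
have inj p : mmap (@mpolyC m K) q p = 0 -> p = 0.
  by move=> p0; apply/eqP/negPn/negP => pn; apply: none; exists p.
pose B := (\sum_i msize (q i))%N.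
suff : (m.+1 <= m)%N by rewrite ltnn.
apply: (@leq_growth _ _ ((m.+1 * B).+1 ^ m)) => N N0.
pose M := ((m.+1 * B).+1 * N)%N.
rewrite -expnMn -/M.
have sp := @spanned_ord_ge K m M.
have [e he] := exists_dual (ideal_subspace (@ord_ge_ideal m K M)) sp.
apply: leq_trans (card_bmnm_le m M); apply: leq_trans (has_dual_le_span he sp).
have <- : #|{ffun 'I_m.+1 -> 'I_N}| = (N ^ m.+1)%N by rewrite card_ffun !card_ord.
pose mn (h : {ffun 'I_m.+1 -> 'I_N}) : 'X_{1..m.+1} := [multinom (h i : nat) | i < m.+1].
have mn_inj : injective mn.
  move=> h h' E; apply/ffunP => i; apply: val_inj.
  by have := congr1 (fun u : 'X_{1..m.+1} => u i) E; rewrite !mnmE.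
pose Q u := mmap (@mpolyC m K) q 'X_[u].
apply: (has_dual_ge_indep (w := fun h => Q (mn h)) he) => b bM h.
pose p : {mpoly K[m.+1]} := \sum_h b h *: 'X_[mn h].
have pE : mmap (@mpolyC m K) q p = \sum_h b h *: Q (mn h).
  by rewrite rmorph_sum; apply: eq_bigr => h' _; rewrite -mul_mpolyC rmorphM /= mmapC mul_mpolyC.
have size_pow (t : {mpoly K[m]}) k : (msize (t ^+ k) <= (k * msize t).+1)%N.
  elim: k => [|k IH]; first by rewrite expr0 msize1.
  rewrite exprS; apply: leq_trans (msizeM_pred _ _) _; rewrite mulSn.
  by move: IH; case: (msize t); lia.
have size_prod (s : seq 'I_m.+1) (h' : {ffun 'I_m.+1 -> 'I_N}) :
    (msize (\prod_(i <- s) q i ^+ h' i) <= (size s * (B * N)).+1)%N.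
  elim: s => [|i s IH]; first by rewrite big_nil msize1.
  rewrite big_cons /= mulSn; apply: leq_trans (msizeM_pred _ _) _.
  have le1 : (h' i * msize (q i) <= B * N)%N.
    rewrite mulnC; apply: leq_mul; last exact: ltnW.
    by rewrite /B (bigD1 i) //= leq_addr.
  have := leq_trans (size_pow (q i) (h' i)) (_ : _ <= (B * N).+1)%N.
  move=> /(_ le1); move: IH; move: (size s * (B * N))%N (B * N)%N => X Y.
  by move: (msize _) (msize _) => X' Y'; lia.
have small : forall u, (M <= mdeg u)%N -> (\sum_h b h *: Q (mn h))@_u = 0.
  move=> u le_u; rewrite raddf_sum big1 //= => h' _; rewrite mcoeffZ.
  suff -> : (Q (mn h'))@_u = 0 by rewrite mulr0.
  apply: memN_msupp_eq0; apply: msize_mdeg_ge; apply: leq_trans le_u.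
  rewrite /Q mmapX /mmap1 (eq_bigr (fun i => q i ^+ h' i)) => [|i _]; last by rewrite mnmE.
  apply: leq_trans (size_prod _ _) _; rewrite -[index_enum _]enumT size_enum_ord.
  by rewrite /M mulSn mulnA; lia.
have : p = 0.
  apply: inj; rewrite pE; apply/mpolyP => u; rewrite mcoeff0.
  by have [/bM//|/small] := ltnP (mdeg u) M.
move/(congr1 (mcoeff (mn h))); rewrite mcoeff0 raddf_sum /= (bigD1 h) //=.
rewrite mcoeffZ mcoeffX eqxx mulr1 big1 ?addr0 // => h' hh'.
rewrite mcoeffZ mcoeffX; case: eqP => [/mn_inj E|_]; last by rewrite mulr0.
by rewrite E eqxx in hh'.
Qed.

(** * Regularity of polynomial subalgebras *)

Lemma subsetPn_ex (T : Type) (X Y : set T) :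
  ~ (X `<=` Y) -> exists2 t, X t & ~ Y t.
Proof.
by move=> XY; apply/not_notP => N; apply: XY => t Xt; apply/not_notP => Yt; apply: N; exists t.
Qed.

Section PolynomialSubalgebra.
Variables (K : fieldType) (n m : nat).
Local Notation D := {mpoly K[n]}.
Local Notation E := {mpoly K[m]}.
Variable Psi : {rmorphism E -> D}.
Hypotheses (PsiC : forall c, Psi c%:MP = c%:MP) (Psi_inj : injective Psi).
Variable A : set D.
Hypothesis AE : forall f, A f <-> exists q, f = Psi q.
Hypothesis algA : subalg_set A.
Let subA : subring_set A. Proof. by case: algA. Qed.
Variable x : point A.
Hypothesis residue : forall f, A f -> exists c, proj1_sig x (f - c%:MP).
Local Notation P := (proj1_sig x).
Local Notation O := (local_ring x).
Let subO := local_subring x algA.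
Let idP := point_ideal x.

Let APsi q : A (Psi q). Proof. by apply/AE; exists q. Qed.

Lemma exists_coordinates : exists c : 'I_m -> K, forall i, P (Psi ('X_i - (c i)%:MP)).
Proof.
have [c cP] := choice (fun i : 'I_m => residue (APsi 'X_i)).
by exists c => i; rewrite rmorphB PsiC.
Qed.

Section AtPoint.
Variables (c : 'I_m -> K) (cP : forall i, P (Psi ('X_i - (c i)%:MP))).

Lemma point_const a : P a%:MP -> a = 0.
Proof.
move=> Pa; apply/eqP/negPn/negP => a0; apply: (point_not1 (x := x)).
have [_ cst] := algA.
have := idealMl idP (cst a^-1) Pa.
by rewrite -mpolyCM mulVf // mpolyC1.
Qed.

Lemma point_eval q : P (Psi q) <-> q.@[c] = 0.
Proof.
have [h hE] := taylor c q.
have Ps : P (Psi (\sum_i ('X_i - (c i)%:MP) * h i)).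
  rewrite rmorph_sum; apply: (ideal_sum idP) => i _; rewrite rmorphM.
  by apply: (idealMr idP).
split=> [Pq|q0].
  apply: point_const; rewrite -PsiC.
  have -> : q.@[c]%:MP = q - \sum_i ('X_i - (c i)%:MP) * h i by rewrite {2}hE addrK.
  by rewrite rmorphB; apply: (idealB subA idP).
by rewrite hE q0 mpolyC0 add0r.
Qed.

Lemma point_gen : P = ideal_gen A (range (fun i => Psi ('X_i - (c i)%:MP))).
Proof.
have rA : range (fun i => Psi ('X_i - (c i)%:MP)) `<=` A by move=> _ [i _ <-].
have idG := ideal_gen_ideal subA rA.
apply/seteqP; split=> [f Pf|]; last by apply: (ideal_gen_min idP) => _ [i _ <-].
have /AE [q E'] := idealR idP Pf; move: Pf; rewrite E' => /point_eval q0.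
have [h ->] := taylor c q; rewrite q0 mpolyC0 add0r rmorph_sum.
apply: (ideal_sum idG) => i _; rewrite rmorphM; apply: (idealMr idG) => //.
by apply: (sub_ideal_gen subA); exists i.
Qed.

Notation F := (ratfun K n).
Definition psi (q : E) : F := tofrac (Psi q).

Lemma psiM q q' : psi (q * q') = psi q * psi q'. Proof. by rewrite /psi rmorphM tofracM. Qed.
Lemma psiD q q' : psi (q + q') = psi q + psi q'. Proof. by rewrite /psi rmorphD tofracD. Qed.
Lemma psi_inj : injective psi.
Proof. by move=> q q' /eqP; rewrite tofrac_eq => /eqP/Psi_inj. Qed.

Lemma psi_n0 s : s.@[c] != 0 -> psi s != 0.
Proof.
move=> s0; rewrite /psi tofrac_eq0; apply: contraNneq s0 => Ps.
by apply/eqP/point_eval; rewrite Ps; apply: ideal0 idP.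
Qed.

Lemma localE h : O h <-> exists q s, s.@[c] != 0 /\ h = psi q / psi s.
Proof.
split=> [[f [g [/AE[q ->] /AE[s ->] Ps ->]]]|[q [s [s0 ->]]]].
  by exists q, s; split=> //; apply/eqP => /point_eval.
exists (Psi q), (Psi s); split=> //.
by move/point_eval => E'; rewrite E' eqxx in s0.
Qed.

(** Restriction to the k-th term of a flag of coordinate subspaces through c; its
    kernel is a prime ideal. *)
Definition flag_subst (k : nat) : E -> E :=
  mmap (@mpolyC m K) (fun i : 'I_m => if (i < k)%N then (c i)%:MP else 'X_i).
HB.instance Definition _ k := GRing.RMorphism.on (flag_subst k).

Definition flag (k : nat) : set F :=
  [set h | exists q s, [/\ s.@[c] != 0, flag_subst k q = 0 & h = psi q / psi s]].

Lemma flag_eval k q : (flag_subst k q).@[c] = q.@[c].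
Proof.
apply: (@rmorph_mpoly_eq _ _ _ (meval c \o flag_subst k) (meval c)) => [a|i] /=.
  by rewrite /flag_subst mmapC.
by rewrite /flag_subst mmapX mmap1U; case: ifP => _; rewrite ?mevalC ?mevalXU.
Qed.

Lemma flag_n0 k s : s.@[c] != 0 -> flag_subst k s != 0.
Proof. by apply: contraNneq => E'; rewrite -(flag_eval k) E' meval0. Qed.

Lemma flagP k q s : s.@[c] != 0 -> flag k (psi q / psi s) <-> flag_subst k q = 0.
Proof.
move=> s0; split=> [[q' [s' [s'0 q'0 E']]]|q0]; last by exists q, s.
have /psi_inj H : psi (q * s') = psi (q' * s).
  rewrite !psiM; apply/eqP; rewrite -eqr_div ?psi_n0 //; exact/eqP.
have := congr1 (flag_subst k) H; rewrite !rmorphM /= q'0 mul0r => /eqP.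
by rewrite mulf_eq0 (negPf (flag_n0 k s'0)) orbF => /eqP.
Qed.

Lemma flag_prime k : prime_ideal O (flag k).
Proof.
split; first split.
- by move=> _ [q [s [s0 _ ->]]]; apply/localE; exists q, s.
- exists 0, 1; rewrite meval1 oner_neq0 /psi !rmorph0 mul0r; split=> //.
- move=> _ _ [q [s [s0 q0 ->]]] [q' [s' [s'0 q'0 ->]]].
  exists (q * s' + q' * s), (s * s'); split.
  + by rewrite mevalM mulf_neq0.
  + by rewrite rmorphD !rmorphM /= q0 q'0 !mul0r addr0.
  + by rewrite psiD !psiM addf_div ?psi_n0.
- move=> _ _ /localE [q [s [s0 ->]]] [q' [s' [s'0 q'0 ->]]].
  exists (q * q'), (s * s'); split.
  + by rewrite mevalM mulf_neq0.
  + by rewrite rmorphM /= q'0 mulr0.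
  + by rewrite !psiM mulf_div.
- have -> : (1 : F) = psi 1 / psi 1 by rewrite /psi !rmorph1 divr1.
  rewrite flagP ?meval1 ?oner_neq0 // rmorph1 => /eqP.
  by rewrite oner_eq0.
- move=> _ _ /localE [q [s [s0 ->]]] /localE [q' [s' [s'0 ->]]].
  rewrite mulf_div -!psiM flagP ?mevalM ?mulf_neq0 // rmorphM => /eqP.
  rewrite mulf_eq0 => /orP[] /eqP E'; [left|right]; exact/flagP.
Qed.

Lemma flag_strict k : (k < m)%N -> proper (flag k) (flag k.+1).
Proof.
move=> km; split.
  move=> _ [q [s [s0 q0 ->]]]; exists q, s; split=> //.
  have <- : flag_subst k.+1 (flag_subst k q) = flag_subst k.+1 q.
    apply: (@rmorph_mpoly_eq _ _ _ (flag_subst k.+1 \o flag_subst k) (flag_subst k.+1)) => [a|i] /=.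
      by rewrite /flag_subst !mmapC.
    rewrite {2}/flag_subst mmapX mmap1U; case: ifP => [ik|//].
    by rewrite /flag_subst mmapC mmapX mmap1U ltnS ltnW.
  by rewrite q0 rmorph0.
move=> sub; pose i := Ordinal km.
have X1 : psi ('X_i - (c i)%:MP) = psi ('X_i - (c i)%:MP) / psi 1.
  by rewrite /psi rmorph1 tofrac1 divr1.
have m1 : (1 : E).@[c] != 0 by rewrite meval1 oner_neq0.
have : flag k.+1 (psi ('X_i - (c i)%:MP)).
  rewrite X1 flagP // rmorphB /= /flag_subst mmapX mmap1U mmapC /= ltnSn.
  by rewrite subrr.
move/sub; rewrite X1 flagP // rmorphB /= /flag_subst mmapX mmap1U mmapC /= ltnn.
move/(congr1 (mcoeff U_(i)%MM)); rewrite mcoeffB mcoeffXU mcoeffC mcoeff0 eqxx.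
by rewrite mnm1_eq0 mulr0 subr0 => /eqP; rewrite oner_eq0.
Qed.

(** Pick an element at each of the first m + 1 steps of a longer chain; it may be
    taken in the image of Psi as denominators are units. These are algebraically
    dependent. *)
Lemma chain_bound e (ch : nat -> set F) : strict_chain (prime_ideal O) e ch -> (e <= m)%N.
Proof.
move=> [prc stc]; rewrite leqNgt; apply/negP => me.
have H (i : 'I_m.+1) : exists q : E, ch (m.+1 - i)%N (psi q) /\ ~ ch (m.+1 - i.+1)%N (psi q).
  have im := ltn_ord i.
  have [lt Ei] : (m.+1 - i.+1 < e)%N /\ (m.+1 - i.+1).+1 = (m.+1 - i)%N by lia.
  have [_ /subsetPn_ex] := stc _ lt; rewrite Ei => -[h ch1 ch0].
  have [id0 _ _] := prc _ (ltnW lt).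
  have [id1 _ _] : prime_ideal O (ch (m.+1 - i)%N) by apply: prc; lia.
  have /localE[q [s [s0 hE]]] := idealR id1 ch1.
  have Os : O (psi s) by apply/localE; exists s, 1; rewrite meval1 oner_neq0 /psi rmorph1 tofrac1 divr1.
  have Osi : O (psi s)^-1.
    by apply/localE; exists 1, s; rewrite /psi rmorph1 tofrac1 mul1r.
  exists q; split.
    by rewrite -(divfK (psi_n0 s0) (psi q)) -hE mulrC; apply: (idealMl id1).
  by move=> chq; apply: ch0; rewrite hE mulrC; apply: (idealMl id0).
have [q qP] := choice H.
have [p p0 pq] := algebraic_dependence q.
pose iota : {rmorphism K -> F} := (@tofrac _ \o @mpolyC n K : {rmorphism K -> F}).
have Oi a : O (iota a).
  by rewrite /iota /= -PsiC; apply: (local_tofrac algA).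
have prc' i : (i <= m.+1)%N -> prime_ideal O (ch i) by move=> im; apply: prc; apply: leq_trans im me.
have inc i : (i < m.+1)%N -> ch i `<=` ch i.+1.
  by move=> im; have [] := stc i (leq_trans im me).
apply: (chain_independent subO Oi prc' inc qP p0).
have -> : mmap iota (fun i => psi (q i)) p = psi (mmap (@mpolyC m K) q p).
  apply: (@rmorph_mpoly_eq _ _ _ (mmap iota (fun i => psi (q i)))
    (@tofrac _ \o Psi \o mmap (@mpolyC m K) q)) => [a|i] /=.
    by rewrite !mmapC /= PsiC.
  by rewrite !mmapX !mmap1U.
rewrite pq /psi rmorph0 tofrac0; have [id0 _ _] := prc 0%N isT; exact: ideal0 id0.
Qed.

Lemma regular_at : regular_local O (local_max x).
Proof.
exists m; split.
  split; last by move=> e ch; apply: chain_bound.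
  exists flag; split=> [i _|i im]; first exact: flag_prime.
  exact: flag_strict.
exists (fun i => tofrac (Psi ('X_i - (c i)%:MP))).
exact: (tofrac_fg algA point_gen).
Qed.

End AtPoint.

Lemma polynomial_subalgebra_regular : regular_local O (local_max x).
Proof. by have [c cP] := exists_coordinates; apply: regular_at cP. Qed.

End PolynomialSubalgebra.

(** * Weights of a torus representation *)

(** In a common eigenbasis of the C j each vector is fixed by exactly one of them. *)
Lemma commuting_idempotents_diagonal (K : fieldType) n (J : finType) (C : J -> 'M[K]_n) :
  (forall i j, C i *m C j = if i == j then C i else 0) -> \sum_i C i = 1%:M ->
  exists2 g : 'M[K]_n, g \in unitmx & exists k : 'I_n -> J,
    forall j, g *m C j = diag_mx (\row_i (k i == j)%:R) *m g.
Proof.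
move=> orth sum1.
have [g gu gd] : codiagonalizable [seq C j | j <- enum J].
  apply/codiagonalizableP; split.
    move=> _ _ /mapP[i _ ->] /mapP[j _ ->]; rewrite /comm_mx !orth eq_sym.
    by case: eqP => // ->.
  move=> _ /mapP[i _ ->]; apply/diagonalizablePeigen; exists [:: 0; 1].
    by rewrite /= inE eq_sym oner_eq0.
  rewrite big_cons big_seq1; apply/eqmxP; rewrite submx1 /=.
  have -> : (1%:M : 'M[K]_n) = (1%:M - C i) + C i by rewrite subrK.
  apply: addmx_sub.
    apply: submx_trans (addsmxSl _ _); apply/eigenspaceP.
    by rewrite scale0r mulmxBl mul1mx orth eqxx subrr.
  apply: submx_trans (addsmxSr _ _); apply/eigenspaceP.
  by rewrite scale1r orth eqxx.
have H j : exists D : 'rV[K]_n, g *m C j = diag_mx D *m g.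
  have /diagonalizable_forPex[D DE] : diagonalizable_for g (C j).
    by move/allP: gd; apply; apply: map_f; rewrite mem_enum.
  by exists D; apply/(simmxP gu).
have [D DE] := choice H.
have DD i j : diag_mx (D i) *m diag_mx (D j) = if i == j then diag_mx (D i) else 0.
  apply: (can_inj (mulmxK gu)); rewrite -mulmxA -DE mulmxA -DE -mulmxA orth.
  by case: eqP => [->|_]; rewrite ?DE ?mulmx0 ?mul0mx.
have Dent i j l : D i 0 l * D j 0 l = if i == j then D i 0 l else 0.
  have := congr1 (fun M : 'M_n => M l l) (DD i j).
  by rewrite mul_diag_mx !mxE eqxx mulr1n; case: ifP => _; rewrite !mxE ?eqxx ?mulr1n.
have Dsum l : \sum_i D i 0 l = 1.
  have : \sum_i diag_mx (D i) *m g = g.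
    by rewrite -[RHS]mulmx1 -sum1 mulmx_sumr; apply: eq_bigr => i _; rewrite DE.
  rewrite -mulmx_suml -[RHS]mul1mx => /(can_inj (mulmxK gu)).
  move/(congr1 (fun M : 'M_n => M l l)); rewrite summxE mxE eqxx mulr1n => <-.
  by apply: eq_bigr => i _; rewrite mxE eqxx mulr1n.
have K_ex l : exists j, D j 0 l != 0.
  apply/not_notP => N; have := Dsum l; rewrite big1 => [/eqP|i _].
    by rewrite eq_sym oner_eq0.
  by apply/eqP/negPn/negP => Di; apply: N; exists i.
have [k kP] := choice K_ex.
have k1 l : D (k l) 0 l = 1.
  by have := Dent (k l) (k l) l; rewrite eqxx => /(canRL (mulfK (kP l))) ->; rewrite divff.
exists g => //; exists k => j; rewrite DE; congr (diag_mx _ *m g).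
apply/rowP => l; rewrite [RHS]mxE; case: eqP => [<-|kj]; first exact: k1.
have := Dent (k l) j l; rewrite k1 mul1r => ->.
by case: eqP.
Qed.

Section Diagonalisation.
Variables (K : fieldType) (charK0 : [pchar K] =i pred0) (r n : nat).
Variable rho : ('I_r -> K) -> 'M[K]_n.
Hypothesis rat : rational_representation rho.

Definition char_val (a : 'I_r -> int) (t : 'I_r -> K) : K := \prod_l t l ^ a l.

(** After multiplication by a power e of \prod_l t_l the entries of rho are
    polynomials. By independence of the monomials in t, the relations
    rho (t u) = rho t *m rho u and rho 1 = 1 say that the matrices C m of
    coefficients are orthogonal idempotents with sum 1: they are the isotypic
    projections. *)
Lemma weight_basis : exists2 g : 'M[K]_n, g \in unitmx &
  exists a : 'I_n -> 'I_r -> int, forall t, torus t ->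
    g *m rho t = diag_mx (\row_i char_val (a i) t) *m g.
Proof.
have [rho1 rhoM rhoE] := rat.
have [p pP] := choice (fun ij : 'I_n * 'I_n => rhoE ij.1 ij.2).
have [Ne NP] := choice pP.
pose N := (\sum_ij Ne ij)%N.
pose pN ij : {mpoly K[r]} := p ij * (\prod_l 'X_l) ^+ (N - Ne ij).
have torusP (t : 'I_r -> K) : torus t -> \prod_l t l != 0.
  by move=> tt; apply/prodf_neq0 => l _; apply: tt.
have rhoN t i j : torus t -> rho t i j * (\prod_l t l) ^+ N = (pN (i, j)).@[t].
  move=> tt; rewrite (NP (i, j) t tt) /pN mevalM rmorphXn rmorph_prod /=.
  rewrite [in RHS](eq_bigr t) => [|l _]; last by rewrite mevalXU.
  have le : (Ne (i, j) <= N)%N by rewrite /N (bigD1 (i, j)) //= leq_addr.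
  rewrite -{1}(subnK le) exprD mulrA mulrAC divfK //.
  by apply: expf_neq0; apply: torusP.
pose B := (\sum_ij msize (pN ij))%N.
have leB ij : (msize (pN ij) <= B)%N by rewrite /B (bigD1 ij) //= leq_addr.
pose J := 'X_{1..r < B}.
pose C (m : J) : 'M[K]_n := \matrix_(i, j) (pN (i, j))@_m.
pose mon (t : 'I_r -> K) (m : J) := \prod_l t l ^+ m l.
pose e (t : 'I_r -> K) := (\prod_l t l) ^+ N.
have eM t u : e (fun l => t l * u l) = e t * e u by rewrite /e big_split exprMn.
have monM t u m : mon (fun l => t l * u l) m = mon t m * mon u m.
  by rewrite /mon -big_split; apply: eq_bigr => l _; rewrite exprMn.
have rhoC t : torus t -> e t *: rho t = \sum_m mon t m *: C m.
  move=> tt; apply/matrixP => i j; rewrite mxE mulrC rhoN // summxE.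
  rewrite (mpolywE (leB (i, j))) raddf_sum; apply: eq_bigr => m _ /=.
  by rewrite !mxE mevalZ mulrC mevalX.
have e_n0 t : torus t -> e t != 0 by move=> tt; apply: expf_neq0; apply: torusP.
have torusM (t u : 'I_r -> K) : torus t -> torus u -> torus (fun l => t l * u l).
  by move=> tt uu l; rewrite mulf_neq0 ?tt ?uu.
(* Linear independence of the characters of the torus. *)
have indep (c : J -> 'M[K]_n) : (forall t, torus t -> \sum_m mon t m *: c m = 0) ->
    forall m, c m = 0.
  move=> c0 m; apply/matrixP => i j; rewrite mxE.
  pose q : {mpoly K[r]} := \sum_(m : J) (c m) i j *: 'X_[m].
  have q0 : q = 0.
    apply: (mpoly_vanish_torus charK0) => t tt.
    have := congr1 (fun M : 'M_n => M i j) (c0 t tt); rewrite mxE summxE => E; rewrite -[RHS]E.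
    rewrite raddf_sum; apply: eq_bigr => m' _ /=.
    by rewrite mevalZ mevalX mxE mulrC.
  have := congr1 (mcoeff m) q0; rewrite mcoeff0 raddf_sum /= (bigD1 m) //=.
  rewrite mcoeffZ mcoeffX eqxx mulr1 big1 ?addr0 // => m' mm'.
  rewrite mcoeffZ mcoeffX; case: eqP => [E|_]; last by rewrite mulr0.
  by case/eqP: mm'; apply: val_inj.
have CC m m' : C m *m C m' = if m == m' then C m else 0.
  have H1 u m1 : torus u -> \sum_m2 mon u m2 *: (C m1 *m C m2 - (if m1 == m2 then C m1 else 0)) = 0.
    move=> uu; pose c m1 := \sum_m2 mon u m2 *: (C m1 *m C m2 - (if m1 == m2 then C m1 else 0)).
    apply: (indep c) => t tt; rewrite /c.
    have cE m3 : \sum_m2 mon u m2 *: (C m3 *m C m2 - (if m3 == m2 then C m3 else 0)) =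
        C m3 *m (e u *: rho u) - mon u m3 *: C m3.
      rewrite rhoC // mulmx_sumr.
      rewrite (eq_bigr (fun m2 => mon u m2 *: (C m3 *m C m2) - mon u m2 *: (if m3 == m2 then C m3 else 0))); last first.
        by move=> m2 _; rewrite scalerBr.
      rewrite sumrB; congr (_ - _); first by apply: eq_bigr => m2 _; rewrite scalemxAr.
      rewrite (bigD1 m3) //= eqxx big1 ?addr0 // => m2 /negPf; rewrite eq_sym => ->.
      by rewrite scaler0.
    rewrite (eq_bigr (fun m3 => (mon t m3 *: C m3) *m (e u *: rho u) - mon (fun l => t l * u l) m3 *: C m3)); last first.
      by move=> m3 _; rewrite cE scalerBr scalemxAl monM scalerA.
    rewrite sumrB -mulmx_suml -!rhoC //; last exact: torusM.
    by rewrite rhoM // eM -scalemxAl -scalemxAr scalerA subrr.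
  have := indep (fun m2 => C m *m C m2 - (if m == m2 then C m else 0)) (fun u uu => H1 u m uu) m'.
  by move/eqP; rewrite subr_eq0 => /eqP.
have C1 : \sum_m C m = 1%:M.
  have t1 : @torus K r (fun=> 1) by move=> l; apply: oner_neq0.
  have := rhoC _ t1; rewrite rho1 /e big1 // expr1n scale1r => ->.
  by apply: eq_bigr => m _; rewrite /mon big1 ?scale1r // => l _; rewrite expr1n.
have [g gu [k kE]] := commuting_idempotents_diagonal CC C1.
exists g => //; exists (fun i l => (k i l)%:Z - N%:Z) => t tt.
apply: (can_inj (scalerK (e_n0 t tt))).
rewrite scalemxAr rhoC // mulmx_sumr.
rewrite (eq_bigr (fun m => (mon t m *: diag_mx (\row_i (k i == m)%:R)) *m g)); last first.
  by move=> m _; rewrite -scalemxAr kE scalemxAl.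
rewrite -mulmx_suml scalemxAl; congr (_ *m g); apply/matrixP => i j.
rewrite summxE !mxE; have [<-|/negPf ij] := eqVneq i j; last first.
  by rewrite mulr0n mulr0 big1 // => m _; rewrite !mxE ij mulr0n mulr0.
rewrite mulr1n (bigD1 (k i)) //= big1 => [|m /negPf mk]; last first.
  by rewrite !mxE eqxx mulr1n eq_sym mk mulr0.
rewrite !mxE !eqxx mulr1n mulr1 addr0 /mon /e /char_val -prodrXl -big_split.
by apply: eq_bigr => l _ /=; rewrite expfzDr ?tt // mulrC -exprnN mulfVK // expf_neq0 ?tt.
Qed.

End Diagonalisation.

Section TorusInvariants.
Variables (K : fieldType) (charK0 : [pchar K] =i pred0) (r n : nat).
Variable rho : ('I_r -> K) -> 'M[K]_n.
Variables (g : 'M[K]_n) (gu : g \in unitmx) (a : 'I_n -> 'I_r -> int).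
Hypothesis gE : forall t, torus t -> g *m rho t = diag_mx (\row_i char_val (a i) t) *m g.

Definition to_weights := mx_subst (invmx g).
Definition of_weights := mx_subst g.
HB.instance Definition _ := GRing.RMorphism.on to_weights.
HB.instance Definition _ := GRing.RMorphism.on of_weights.

Lemma to_weightsK : cancel to_weights of_weights.
Proof. by move=> p; rewrite /of_weights /to_weights mx_substM // mulVmx // mx_subst1. Qed.
Lemma of_weightsK : cancel of_weights to_weights.
Proof. by move=> p; rewrite /of_weights /to_weights mx_substM // mulmxV // mx_subst1. Qed.

Lemma peval_weights p v : peval p v = peval (to_weights p) (g *m v).
Proof. by rewrite /to_weights peval_subst mulmxA mulVmx // mul1mx. Qed.

Lemma mcoeff_diag (d : 'rV[K]_n) p u :
  (mx_subst (diag_mx d) p)@_u = (\prod_i d 0 i ^+ u i) * p@_u.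
Proof.
have XE m : mx_subst (diag_mx d) 'X_[m] = (\prod_i d 0 i ^+ m i) *: 'X_[m].
  rewrite mpolyXE_id rmorph_prod /= -scaler_prod; apply: eq_bigr => i _.
  rewrite rmorphXn /= mx_substX (bigD1 i) //= big1 => [|j /negPf ij].
    by rewrite addr0 mxE eqxx mulr1n exprZn.
  by rewrite mxE eq_sym ij mulr0n scale0r.
rewrite {1}(mpolyE p) rmorph_sum raddf_sum /=.
have [up|up] := boolP (u \in msupp p); last first.
  rewrite (memN_msupp_eq0 up) mulr0 big_seq big1 // => m mp.
  rewrite mx_substZ XE !mcoeffZ mcoeffX; case: eqP => [E|_]; last by rewrite !mulr0.
  by rewrite E (negPf up) in mp.
rewrite (bigD1_seq u) ?msupp_uniq //= big1 ?addr0 => [|m /negPf mu].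
  by rewrite mx_substZ XE !mcoeffZ mcoeffX eqxx mulr1 mulrC.
by rewrite mx_substZ XE !mcoeffZ mcoeffX mu !mulr0.
Qed.

Lemma char_val_prod (u : 'X_{1..n}) (t : 'I_r -> K) : torus t ->
  \prod_i char_val (a i) t ^+ u i = \prod_l t l ^ (\sum_i (u i)%:Z * a i l).
Proof.
move=> tt; rewrite (eq_bigr (fun i => \prod_l t l ^ ((u i)%:Z * a i l))) => [|i _].
  rewrite exchange_big; apply: eq_bigr => l _ /=.
  elim: (index_enum _) => [|i s IH]; first by rewrite !big_nil expr0z.
  by rewrite !big_cons IH expfzDr ?tt.
rewrite /char_val -prodrXl; apply: eq_bigr => l _.
by rewrite exprnP exprz_exp mulrC.
Qed.

(** An element of the torus multiplies each monomial by a character. Characters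
    are tested at points with a single coordinate different from 1, equal to 2,
    which has infinite order. *)
Lemma torus_invariantsE f :
  torus_invariants rho f <-> (forall u, u \in msupp (to_weights f) -> relation a u).
Proof.
pose F := to_weights f.
have act t v : torus t -> peval f (rho t *m v) =
    peval (mx_subst (diag_mx (\row_i char_val (a i) t)) F) (g *m v).
  by move=> tt; rewrite peval_weights mulmxA gE // -mulmxA peval_subst.
split=> [inv u uF|supp].
  have E t : torus t -> mx_subst (diag_mx (\row_i char_val (a i) t)) F = F.
    move=> tt; apply: peval_inj => // w.
    have -> : w = g *m (invmx g *m w) by rewrite mulmxA mulmxV // mul1mx.
    by rewrite -act // inv -?peval_weights //; exists t.
  apply/relationP => l.
  have K2 : (2%:R : K) != 0 by move/pcharf0P: charK0 => ->.
  pose t i : K := if i == l then 2%:R else 1.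
  have tt : torus t by move=> i; rewrite /t; case: ifP => _; rewrite ?oner_neq0.
  have := congr1 (mcoeff u) (E t tt); rewrite mcoeff_diag.
  rewrite (eq_bigr (fun i => char_val (a i) t ^+ u i)) => [|i _]; last by rewrite mxE.
  rewrite char_val_prod // -[RHS]mul1r => /mulIf; rewrite -mcoeff_msupp => /(_ uF).
  rewrite (bigD1 l) //= [X in _ * X = _]big1 => [|i il]; last by rewrite /t ifN // exp1rz.
  rewrite mulr1 /t eqxx; move: (\sum_i _) => z.
  have pow k : (2%:R : K) ^+ k = 1 -> k = 0%N.
    move=> /eqP; rewrite -natrX -[1]/(1%:R) => /eqP/(natr_inj_pchar0 charK0).
    by case: k => // k /eqP; rewrite -[1%N]/(2 ^ 0)%N eqn_exp2l.
  case: z => k /=; first by rewrite -exprnP => /pow ->.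
  by rewrite NegzE -exprnN => /eqP; rewrite invr_eq1 => /eqP/pow.
move=> _ v [t tt <-]; rewrite act // (peval_weights f); congr (peval _ _).
apply/mpolyP => u; rewrite mcoeff_diag.
have [uF|uF] := boolP (u \in msupp F); last by rewrite (memN_msupp_eq0 uF) mulr0.
rewrite (eq_bigr (fun i => char_val (a i) t ^+ u i)) => [|i _]; last by rewrite mxE.
rewrite char_val_prod // big1 ?mul1r // => l _.
by move/relationP: (supp u uF) => ->; rewrite expr0z.
Qed.

End TorusInvariants.

(** * The theorem of Stiemke *)

Section Farkas.
Import Order.TTheory Num.Theory.

(** Bartl's proof, by induction on the number of inequalities. If the last form am
    cannot be dropped, some x1 with am x1 = 1 satisfies the others and ga x1 > 0;
    projecting along x1 onto the kernel of am removes one form. *)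
Lemma farkas (R : realFieldType) (V : lmodType R) m (al : 'I_m -> V -> R) (ga : V -> R) :
  (forall i a x y, al i (a *: x + y) = a * al i x + al i y) ->
  (forall a x y, ga (a *: x + y) = a * ga x + ga y) ->
  (forall x, (forall i, al i x <= 0) -> ga x <= 0) ->
  exists u : 'I_m -> R, (forall i, 0 <= u i) /\ forall x, ga x = \sum_i u i * al i x.
Proof.
elim: m al ga => [|m IH] al ga lal lga H.
  exists (fun=> 0); split=> [[]//|x]; rewrite big_ord0.
  have g0 : ga 0 = 0 by have := lga (-1) 0 0; rewrite scaler0 addr0 mulN1r addNr.
  have := lga (-1) x 0; rewrite addr0 g0 addr0 mulN1r scaleN1r => gN.
  apply/eqP; rewrite eq_le H; last by case.
  by rewrite -oppr_le0 -gN H // => -[].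
pose al' i := al (lift ord_max i).
have [H'|] := EM (forall x, (forall i, al' i x <= 0) -> ga x <= 0).
  have [u [u0 uE]] := IH al' ga (fun i => lal _) lga H'.
  exists (fun i => if unlift ord_max i is Some j then u j else 0); split.
    by move=> i; case: unliftP => [j _|_].
  move=> x; rewrite uE big_ord_recr /= unlift_none mul0r addr0.
  apply: eq_bigr => i _; have -> : widen_ord (leqnSn m) i = lift ord_max i.
    by apply: val_inj; rewrite /= /bump leqNgt ltn_ord.
  by rewrite liftK.
move=> /existsNP[x0 /not_implyP[al0 /negP ga0]].
rewrite -ltNge in ga0.
have am0 : 0 < al ord_max x0.
  rewrite ltNge; apply/negP => le0; move: ga0; rewrite ltNge H // => i.
  by case: (unliftP ord_max i) => [j ->|->]; [apply: al0 | ].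
set am := al ord_max in am0 *.
pose x1 := (am x0)^-1 *: x0.
have am0' : am x0 != 0 by rewrite gt_eqF.
have lin0 (f : V -> R) : (forall a x y, f (a *: x + y) = a * f x + f y) -> forall a x, f (a *: x) = a * f x.
  move=> lf a x; have f0 : f 0 = 0 by have := lf (-1) 0 0; rewrite scaler0 addr0 mulN1r addNr.
  by have := lf a x 0; rewrite !addr0 f0 addr0.
have am1 : am x1 = 1 by rewrite /x1 (lin0 am) ?mulVf //; apply: lal.
have ga1 : 0 < ga x1 by rewrite /x1 (lin0 ga) // mulr_gt0 ?invr_gt0.
have al1 i : al' i x1 <= 0.
  by rewrite /x1 (lin0 (al' i)) ?pmulr_rle0 ?invr_gt0 //; apply: lal.
pose red (f : V -> R) x := f x - f x1 * am x.
have redE f x : (forall a x y, f (a *: x + y) = a * f x + f y) -> red f x = f (- am x *: x1 + x).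
  by move=> lf; rewrite lf /red addrC mulNr mulrC.
have lred f : (forall a x y, f (a *: x + y) = a * f x + f y) ->
    forall a x y, red f (a *: x + y) = a * red f x + red f y.
  by move=> lf a x y; rewrite /red lf [am _]lal -/am; ring.
have [|x Hx|u [u0 uE]] := IH (fun i => red (al' i)) (red ga) _ (lred _ lga).
- by move=> i; apply: lred => a x y; apply: lal.
- rewrite redE //; apply: H => i; case: (unliftP ord_max i) => [j ->|->].
    by rewrite -[al _ _]/(al' j _) -redE //; apply: lal.
  by rewrite -/am [am _]lal -/am am1 mulr1 addNr.
exists (fun i => if unlift ord_max i is Some j then u j else ga x1 - \sum_j u j * al' j x1).
split.
  move=> i; case: unliftP => [j _|_] //; rewrite subr_ge0.
  apply: le_trans (ltW ga1); apply: sumr_le0 => j _; exact: mulr_ge0_le0.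
move=> x; have := uE x; rewrite /red => /eqP; rewrite subr_eq => /eqP ->.
rewrite big_ord_recr /= unlift_none -/am.
rewrite (eq_bigr (fun i => u i * al' i x - (u i * al' i x1) * am x)) => [|i _]; last first.
  by rewrite mulrBr mulrA.
rewrite sumrB -mulr_suml [X in _ = X + _](eq_bigr (fun i => u i * al' i x)) => [|i _]; first by ring.
have -> : widen_ord (leqnSn m) i = lift ord_max i.
  by apply: val_inj; rewrite /= /bump leqNgt ltn_ord.
by rewrite liftK.
Qed.

(** By hypothesis, form j <= 0 on the cone where form i >= 0 for all i in S, so by
    [farkas] form j is a nonnegative combination of the opposites of the forms in S.
    The sum of these relations over j in S has coefficients at least 1 on S. *)
Lemma stiemke n r (W : 'I_n -> 'I_r -> int) (S : pred 'I_n) :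
  (forall lam : 'I_r -> int, (forall j, S j -> 0 <= \sum_l lam l * W j l) ->
     forall j, S j -> \sum_l lam l * W j l = 0) ->
  exists2 u : 'X_{1..n}, relation W u & forall j, (u j == 0%N) = ~~ S j.
Proof.
move=> H.
pose form j (x : 'rV[rat]_r) : rat := \sum_l x 0 l * (W j l)%:~R.
have lform j a x y : form j (a *: x + y) = a * form j x + form j y.
  rewrite /form mulr_sumr -big_split; apply: eq_bigr => l _ /=.
  by rewrite !mxE mulrDl mulrA.
have H' j : S j -> exists u : 'I_n -> rat, (forall i, 0 <= u i) /\
    forall x, form j x = \sum_i u i * (if S i then - form i x else 0).
  move=> Sj; apply: (farkas (al := fun i x => if S i then - form i x else 0)) => //.
    by move=> i a x y; case: (S i); rewrite ?lform ?mulr0 ?addr0 //; ring.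
  (* Clear denominators to use the hypothesis on integral vectors. *)
  move=> x Hx; have [N N0 [z zE]] := rat_row_scale x.
  have E i : (\sum_l z l * W i l)%:~R = N%:R * form i x :> rat.
    rewrite rmorph_sum mulr_sumr; apply: eq_bigr => l _ /=.
    by rewrite rmorphM /= -zE mulrA.
  have z0 i : S i -> 0 <= \sum_l z l * W i l.
    move=> Si; rewrite -(ler0z rat) E mulr_ge0 ?ler0n //.
    by have := Hx i; rewrite Si oppr_le0.
  have := E j; rewrite (H z z0 j Sj) => /esym/eqP; rewrite mulf_eq0 pnatr_eq0 (gtn_eqF N0) /=.
  by move/eqP => ->.
have H2 j : exists u : 'I_n -> rat, (forall i, 0 <= u i) /\ (S j ->
    forall x, form j x = \sum_i u i * (if S i then - form i x else 0)).
  have [/H'[u [u0 uE]]|] := boolP (S j); first by exists u.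
  by exists (fun=> 0).
have [u uP] := choice H2.
have u0 j i : 0 <= u j i by case: (uP j).
pose y : 'rV[rat]_n := \row_i (if S i then 1 + \sum_(j | S j) u j i else 0).
have y0 i : 0 <= y 0 i.
  by rewrite mxE; case: (S i) => //; apply: addr_ge0 => //; apply: sumr_ge0.
have yW : y *m Wq W = 0.
  apply/rowP => l; rewrite [RHS]mxE mxE.
  have fl j : form j (delta_mx 0 l) = (W j l)%:~R.
    rewrite /form (bigD1 l) //= mxE !eqxx mul1r big1 ?addr0 // => l' /negPf ll.
    by rewrite mxE ll andbF mul0r.
  have uE j : S j -> (W j l)%:~R = \sum_i u j i * (if S i then - (W i l)%:~R else 0) :> rat.
    move=> Sj; have [_ /(_ Sj (delta_mx 0 l))] := uP j; rewrite fl => ->.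
    by apply: eq_bigr => i _; case: (S i); rewrite ?fl.
  rewrite (eq_bigr (fun i => (if S i then (W i l)%:~R else 0) +
      \sum_(j | S j) u j i * (if S i then (W i l)%:~R else 0))) => [|i _]; last first.
    rewrite !mxE; case: (S i); last by rewrite mul0r big1 ?addr0 // => j _; rewrite mulr0.
    by rewrite mulrDl mul1r mulr_suml.
  rewrite big_split /= exchange_big /= -big_mkcond -big_split big1 //= => j Sj.
  rewrite {1}uE // -big_split big1 //= => i _.
  by case: (S i); rewrite ?mulr0 ?addr0 // mulrN addNr.
have [N N0 [w Rw wE]] := relation_pull yW y0.
exists w => // j.
have Ew : (w j)%:R = N%:R * y 0 j :> rat.
  by have := congr1 (fun M : 'rV_n => M 0 j) wE; rewrite [vec w 0 j]mxE => ->; rewrite mxE.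
rewrite -(eqr_nat rat) Ew mulf_eq0 pnatr_eq0 (gtn_eqF N0) /= mxE.
case: (S j); last by rewrite eqxx.
by rewrite gt_eqF // ltr_pwDl // sumr_ge0.
Qed.

End Farkas.

(** * Stable vectors *)

Section Stability.
Import Order.TTheory Num.Theory.
Variables (K : fieldType) (charK0 : [pchar K] =i pred0) (r n : nat).
Variable rho : ('I_r -> K) -> 'M[K]_n.
Hypothesis rho1 : rho (fun=> 1) = 1%:M.
Variables (g : 'M[K]_n) (gu : g \in unitmx) (a : 'I_n -> 'I_r -> int).
Hypothesis gE : forall t, torus t -> g *m rho t = diag_mx (\row_i char_val (a i) t) *m g.

Local Notation tau := (to_weights g).
Local Notation sig := (of_weights g).
Definition coord (v : 'cV[K]_n) i := (g *m v) i 0.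
Definition of_coord (c : 'I_n -> K) : 'cV[K]_n := invmx g *m \col_i c i.
Definition pairing (lam : 'I_r -> int) j := \sum_l lam l * a j l.

Lemma of_coordK c i : coord (of_coord c) i = c i.
Proof. by rewrite /coord /of_coord mulmxA mulmxV // mul1mx mxE. Qed.

Lemma coord_inj v w : (forall i, coord v i = coord w i) -> v = w.
Proof.
move=> vw; rewrite -[v]mul1mx -[w]mul1mx -(mulVmx gu) -!mulmxA; congr (_ *m _).
by apply/colP => i; apply: vw.
Qed.

Lemma coord_rho t v i : torus t -> coord (rho t *m v) i = char_val (a i) t * coord v i.
Proof. by move=> tt; rewrite /coord mulmxA gE // -mulmxA mul_diag_mx !mxE. Qed.

Lemma peval_coord f v : peval f v = (tau f).@[coord v].
Proof. exact: (peval_weights gu). Qed.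

Lemma orbit_refl v : orbit_of rho v v.
Proof.
exists 1%:M; last by rewrite mul1mx.
by exists (fun=> 1) => // l; apply: oner_neq0.
Qed.

Lemma char_val_subgroup lam s j : s != 0 ->
  char_val (a j) (fun l => s ^ lam l) = s ^ pairing lam j :> K.
Proof.
move=> s0; rewrite /char_val /pairing.
rewrite (eq_bigr (fun l => s ^ (lam l * a j l))) => [|l _]; last by rewrite exprz_exp.
by elim/big_rec2: _ => [|l x y _ ->]; rewrite ?expr0z // expfzDr.
Qed.

(** The limit of lam(s) v as s tends to 0, when it exists. *)
Definition limit lam v := of_coord (fun j => if pairing lam j == 0 then coord v j else 0).

(** A polynomial that vanishes on the orbit vanishes on the curve lam(s) v for
    s <> 0, so it does at s = 0. *)
Lemma limit_closure lam v : (forall j, coord v j != 0 -> 0 <= pairing lam j) ->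
  closure_of (@zclosed K n) (orbit_of rho v) (limit lam v).
Proof.
move=> lam0 _ [S ->] orbS p Sp.
pose h j : {poly K} := (coord v j)%:P * 'X ^+ `|pairing lam j|%N.
pose P := mmap (@polyC K) h (tau p).
have PE s : P.[s] = (tau p).@[fun j => coord v j * s ^+ `|pairing lam j|%N].
  apply: (@rmorph_mpoly_eq _ _ _ (horner_eval s \o mmap (@polyC K) h) (meval _)) => [c|i] /=.
    by rewrite mmapC /horner_eval hornerC mevalC.
  by rewrite mmapX mmap1U mevalXU /horner_eval /h !hornerE.
have P0 : P = 0.
  apply: (poly_vanish charK0 (f := idfun)) => s s0 /=.
  pose t l := s ^ lam l; have tt : @torus K r t by move=> l; apply: expfz_neq0.
  have := orbS (rho t *m v); rewrite /= => /(_ _ p Sp) H.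
  rewrite PE -[RHS]H; last by exists (rho t) => //; exists t.
  rewrite peval_coord; apply: meval_eq => j; rewrite coord_rho // char_val_subgroup //.
  have [->|vj] := eqVneq (coord v j) 0; first by rewrite mul0r mulr0.
  by rewrite mulrC; congr (_ * _); rewrite exprnP gez0_abs // lam0.
rewrite peval_coord -[RHS](horner0 (0 : K)) -P0 PE; apply: meval_eq => j.
rewrite of_coordK -absz_eq0 expr0n; case: eqP => _; rewrite ?mulr1 ?mulr0 //.
Qed.

(** If lam were positive on a weight of v, the limit of v would leave the orbit of
    v, which is closed. If lam is 0 on the weights of v but not on the weight of a
    coordinate j0, set this coordinate to 1: the vector w so obtained has v as a
    limit, but belongs to another orbit. *)
Lemma stable_pairing v lam : stable_vector rho v ->
  (forall j, coord v j != 0 -> 0 <= pairing lam j) -> forall j, pairing lam j = 0.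
Proof.
move=> [closed_v sep] lam0.
have supp0 j : coord v j != 0 -> pairing lam j = 0.
  move=> vj; apply/eqP/negPn/negP => lj.
  have [_ [t tt <-] E] := limit_closure lam0 closed_v (fun w => id).
  have := congr1 (fun w => coord w j) E; rewrite of_coordK ifN // coord_rho //.
  move/eqP; rewrite mulf_eq0 (negPf vj) orbF => /eqP E0.
  have : char_val (a j) t != 0 by apply/prodf_neq0 => l _; apply: expfz_neq0; apply: tt.
  by rewrite E0 eqxx.
have [//|] := EM (forall j, pairing lam j = 0).
move=> /existsNP[j0 lj0]; exfalso.
have vj0 : coord v j0 = 0 by apply/eqP/negPn/negP => /supp0.
have [mu mu0 muj0] : exists2 mu, (forall j, coord v j != 0 -> pairing mu j = 0) & 0 < pairing mu j0.
  have [l0|l0|//] := ltrgt0P (pairing lam j0); first by exists lam.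
  have E j : pairing (fun l => - lam l) j = - pairing lam j.
    by rewrite /pairing -sumrN; apply: eq_bigr => l _; rewrite mulNr.
  by exists (fun l => - lam l) => [j /supp0|]; rewrite E ?oppr_gt0 // => ->; rewrite oppr0.
pose w := of_coord (fun j => if j == j0 then 1 else coord v j).
have wE j : coord w j = if j == j0 then 1 else coord v j by rewrite of_coordK.
have lw : limit mu w = v.
  apply: coord_inj => j; rewrite of_coordK wE; have [->|jj] := eqVneq j j0.
    by rewrite gt_eqF.
  case: eqP => // mj; apply/esym/eqP/negPn/negP => /mu0 //.
have cl : closure_of (@zclosed K n) (orbit_of rho w) v.
  rewrite -lw; apply: limit_closure => j; rewrite wE; have [->|_] := eqVneq j j0; last by move/mu0 ->.
  by rewrite ltW.
have orb : orbit_of rho w = orbit_of rho v by apply/not_notP => /sep; apply.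
have [_ [t tt <-] E] : orbit_of rho v w by rewrite -orb; apply: orbit_refl.
have := congr1 (fun w => coord w j0) E; rewrite coord_rho // wE eqxx vj0 mulr0 => /eqP.
by rewrite eq_sym oner_eq0.
Qed.

Lemma stable_relation v (S : pred 'I_n) : stable_vector rho v ->
  (forall j, coord v j != 0 -> S j) ->
  exists2 u : 'X_{1..n}, relation a u & forall j, (u j == 0%N) = ~~ S j.
Proof.
move=> vs vS; apply: stiemke => lam lam0 j _.
by apply: (stable_pairing vs) => i /vS /lam0.
Qed.

End Stability.

(** * Purity *)

Section Zariski.
Variables (K : fieldType) (n : nat).
Implicit Types (Y : set 'cV[K]_n) (f : {mpoly K[n]}).

Definition vanish_on Y f := forall v, Y v -> peval f v = 0.

Lemma not_vanish_on Y f : ~ vanish_on Y f -> exists2 v, Y v & peval f v != 0.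
Proof. by move=> /existsNP[v /not_implyP[Yv /eqP fv]]; exists v. Qed.

(** Closed sets are intersections of hypersurfaces. *)
Lemma irreducibleP Y : irreducible (@zclosed K n) Y <-> Y !=set0 /\
  forall f1 f2, vanish_on Y (f1 * f2) -> vanish_on Y f1 \/ vanish_on Y f2.
Proof.
split=> [[Y0 irr]|[Y0 irr]]; split=> //.
  move=> f1 f2 f0; pose Z f := [set v | forall p, [set f] p -> peval p v = 0].
  have [|||YZ|YZ] := irr (Z f1) (Z f2).
  - by exists [set f1].
  - by exists [set f2].
  - move=> v Yv; have /eqP := f0 v Yv; rewrite pevalM mulf_eq0.
    by case/orP => /eqP H; [left|right] => p ->.
  - by left=> v /YZ; apply.
  - by right=> v /YZ; apply.
move=> _ _ [S1 ->] [S2 ->] YS; apply/not_notP => /not_orP[].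
move=> /existsNP[v1 /not_implyP[Yv1 /existsNP[f1 /not_implyP[Sf1 f1v]]]].
move=> /existsNP[v2 /not_implyP[Yv2 /existsNP[f2 /not_implyP[Sf2 f2v]]]].
suff /irr[H|H] : vanish_on Y (f1 * f2); [exact: (f1v (H _ Yv1)) | exact: (f2v (H _ Yv2)) |].
move=> v /YS[|]; rewrite pevalM; first by move/(_ f1 Sf1) => ->; rewrite mul0r.
by move/(_ f2 Sf2) => ->; rewrite mulr0.
Qed.

Section Quotient.
Variable H : set 'M[K]_n.
Local Notation A := (invariants H).

(** The closure of the image of Y in the quotient. *)
Definition image_closure Y : set (point A) :=
  [set x | forall f, A f -> vanish_on Y f -> proj1_sig x f].

Lemma image_closure_quot Y v : Y v -> image_closure Y (quot_map H v).
Proof. by move=> Yv f Af fY; split=> //; apply: fY. Qed.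

Lemma image_closure_irreducible Y : irreducible (@zclosed K n) Y ->
  irreducible_closed (@vclosed K n A) (image_closure Y).
Proof.
move=> /irreducibleP[[v0 Yv0] irr]; split.
  exists [set f | A f /\ vanish_on Y f]; split=> [f []//|].
  by apply/seteqP; split=> x Hx f; [case=> Af fY; apply: Hx|move=> Af fY; apply: Hx].
split; first by exists (quot_map H v0); apply: image_closure_quot.
move=> _ _ [S1 [S1A ->]] [S2 [S2A ->]] YS; apply/not_notP => /not_orP[].
move=> /existsNP[x1 /not_implyP[Yx1 /existsNP[f1 /not_implyP[Sf1 f1x]]]].
move=> /existsNP[x2 /not_implyP[Yx2 /existsNP[f2 /not_implyP[Sf2 f2x]]]].
have [|v Yv] := @not_vanish_on Y (f1 * f2).
  move=> /irr[fY|fY]; first by apply: f1x; apply: Yx1 => //; apply: S1A.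
  by apply: f2x; apply: Yx2 => //; apply: S2A.
rewrite pevalM mulf_eq0 => /norP[f1v f2v].
case: (YS _ (image_closure_quot Yv)) => [/(_ f1 Sf1)|/(_ f2 Sf2)] [_ /eqP].
  by rewrite (negPf f1v).
by rewrite (negPf f2v).
Qed.

End Quotient.
End Zariski.

Section Purity.
Variables (K : fieldType) (charK0 : [pchar K] =i pred0) (r n : nat).
Variable rho : ('I_r -> K) -> 'M[K]_n.
Hypothesis rho1 : rho (fun=> 1) = 1%:M.
Variables (g : 'M[K]_n) (gu : g \in unitmx) (a : 'I_n -> 'I_r -> int).
Hypothesis gE : forall t, torus t -> g *m rho t = diag_mx (\row_i char_val (a i) t) *m g.

Local Notation tau := (to_weights g).
Local Notation sig := (of_weights g).
Local Notation A := (torus_invariants rho).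
Let pE := peval_coord gu.

Definition hyperplane i : set 'cV[K]_n := [set v | coord g v i = 0].

Definition restrict i : {mpoly K[n]} -> {mpoly K[n]} :=
  mmap (@mpolyC n K) (fun j => if j == i then 0 else 'X_j).
HB.instance Definition _ i := GRing.RMorphism.on (restrict i).

Lemma meval_restrict i F c : (restrict i F).@[c] = F.@[fun j => if j == i then 0 else c j].
Proof.
apply: (@rmorph_mpoly_eq _ _ _ (meval c \o restrict i) (meval _)) => [b|j] /=.
  by rewrite /restrict mmapC !mevalC.
by rewrite /restrict mmapX mmap1U mevalXU; case: eqP => _; rewrite ?meval0 ?mevalXU.
Qed.

Lemma mcoeff_restrict i F u : (restrict i F)@_u = if u i == 0%N then F@_u else 0.
Proof.
have XE m : restrict i 'X_[m] = if m i == 0%N then 'X_[m] else 0.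
  rewrite /restrict mmapX /mmap1; case: ifP => [/eqP mi|/negPf mi].
    rewrite [RHS]mpolyXE_id; apply: eq_bigr => j _.
    by case: eqP => // ->; rewrite mi !expr0.
  by rewrite (bigD1 i) //= eqxx expr0n mi mul0r.
rewrite {1}(mpolyE F) rmorph_sum raddf_sum /=.
have tE m : (restrict i (F@_m *: 'X_[m]))@_u =
    if m == u then (if u i == 0%N then F@_u else 0) else 0.
  rewrite -mul_mpolyC rmorphM /= {1}/restrict mmapC XE mul_mpolyC mcoeffZ.
  case: (eqVneq m u) => [->|/negPf mu].
    by case: ifP => _; rewrite ?mcoeff0 ?mulr0 // mcoeffX eqxx mulr1.
  by case: ifP => _; rewrite ?mcoeff0 ?mulr0 // mcoeffX mu mulr0.
rewrite (eq_bigr _ (fun m _ => tE m)).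
have [uF|uF] := boolP (u \in msupp F); last first.
  rewrite (memN_msupp_eq0 uF) if_same big_seq big1 // => m mF.
  by case: eqP => // E; rewrite E (negPf uF) in mF.
rewrite (bigD1_seq u) ?msupp_uniq //= eqxx big1 ?addr0 // => m /negPf ->; done.
Qed.

Lemma vanish_hyperplane i f : vanish_on (hyperplane i) f <-> restrict i (tau f) = 0.
Proof.
split=> [fH|f0 v vi].
  apply: (mpoly_vanish charK0) => c; rewrite meval_restrict.
  rewrite -[RHS](fH (of_coord g (fun j => if j == i then 0 else c j))); last first.
    by rewrite /hyperplane /= of_coordK // eqxx.
  by rewrite pE; apply: meval_eq => j; rewrite of_coordK.
rewrite pE -[RHS](meval0 (coord g v)) -f0 meval_restrict; apply: meval_eq => j.
by case: eqP => // ->.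
Qed.

Lemma vanish_hyperplaneE i f :
  vanish_on (hyperplane i) f <-> forall u, u \in msupp (tau f) -> u i != 0%N.
Proof.
rewrite vanish_hyperplane; split=> [f0 u uf|fu].
  apply: contraTN uf => ui; rewrite -mcoeff_eq0.
  by have := congr1 (mcoeff u) f0; rewrite mcoeff_restrict ui mcoeff0 => ->.
apply/mpolyP => u; rewrite mcoeff_restrict mcoeff0.
case: ifP => // ui; apply: memN_msupp_eq0; apply/negP => /fu.
by rewrite ui.
Qed.

Lemma hyperplane_irreducible i : irreducible (@zclosed K n) (hyperplane i).
Proof.
apply/irreducibleP; split.
  by exists (of_coord g (fun=> 0)); rewrite /hyperplane /= of_coordK.
move=> f1 f2 /vanish_hyperplane; rewrite !rmorphM /= => /eqP.
by rewrite mulf_eq0 => /orP[] /eqP H; [left|right]; apply/vanish_hyperplane.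
Qed.

Lemma space_irreducible : irreducible (@zclosed K n) setT.
Proof.
apply/irreducibleP; split; first by exists 0.
move=> f1 f2 f0; have /eqP : f1 * f2 = 0.
  by apply: (peval_inj charK0) => v; rewrite f0 // pevalC.
by rewrite mulf_eq0 => /orP[] /eqP ->; [left|right] => v _; rewrite pevalC.
Qed.

(** Divide an equation of D by that of the hyperplane as long as possible; when it
    is no longer possible, D lies in the hyperplane. *)
Lemma hyperplane_maximal i D f : irreducible (@zclosed K n) D -> hyperplane i `<=` D ->
  vanish_on D f -> f != 0 -> D `<=` hyperplane i.
Proof.
move=> /irreducibleP[_ irr] HD fD f0.
have f0' : tau f != 0.
  by apply: contraNneq f0 => E; rewrite -(to_weightsK charK0 gu f) E raddf0.
have [k] := ubnP (msize (tau f)).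
elim: k f fD {f0} f0' => // k IH f fD f0 lek.
set F := tau f in f0 lek.
have /vanish_hyperplaneE Fi : vanish_on (hyperplane i) f by move=> v /HD; apply: (fD).
rewrite -/F in Fi.
pose F' := \sum_(u <- msupp F) F@_u *: 'X_[(u - U_(i))%MM].
have FE : F = 'X_i * F'.
  rewrite {1}(mpolyE F) mulr_sumr; apply: eq_big_seq => u uF.
  rewrite -scalerAr -mpolyXD addmC submK //; apply/mnm_lepP => j; rewrite mnm1E.
  by case: eqP => // <-; rewrite lt0n Fi.
have F'0 : F' != 0 by apply: contraNneq f0 => E; rewrite FE E mulr0.
have Xi0 : ('X_i : {mpoly K[n]}) != 0 by rewrite -msize_poly_eq0 msizeX.
have fE : f = sig 'X_i * sig F' by rewrite -rmorphM -FE /F /= (to_weightsK charK0 gu).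
rewrite fE in fD; case/irr: (fD) => [H v Dv|H].
  by have := H v Dv; rewrite pE of_weightsK // mevalXU.
apply: (IH _ H); rewrite of_weightsK //.
by move: lek; rewrite FE msizeM // msizeX mdeg1.
Qed.

Hypothesis pure : pure_representation rho.

(** Otherwise the image of C, being closed, would be the whole quotient, which is
    not properly contained in anything. *)
Lemma divisor_not_dense C : divisor (@vclosed K n A) (quot_map (torus_image rho) @` C) ->
  exists2 f, f != 0 & vanish_on C f.
Proof.
move=> [[[S [SA SE]] _] [[c [[irr strict] c0]] _]].
apply/not_notP => N; have [_] := strict 0%N isT; apply=> x _; rewrite c0 SE => f Sf.
have -> : f = 0; last by case: (proj2_sig x) => -[].
apply/eqP/negPn/negP => f0; apply: N; exists f => // v Cv.
have : [set x : point A | S `<=` proj1_sig x] (quot_map (torus_image rho) v).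
  by rewrite -SE; exists v.
by move=> /(_ f Sf) [].
Qed.

(** If the strictly semistable locus satisfies an equation, [hyperplane_maximal]
    applies. Otherwise it is dense, hence irreducible and its own component, and
    purity makes its image a divisor: this is impossible. *)
Lemma hyperplane_component i : hyperplane i `<=` strictly_semistable_locus rho ->
  irreducible_component (@zclosed K n) (strictly_semistable_locus rho) (hyperplane i).
Proof.
move=> Hi; split=> // [|D irrD DY HD]; first exact: hyperplane_irreducible.
suff [f f0 fY] : exists2 f, f != 0 & vanish_on (strictly_semistable_locus rho) f.
  by apply: (hyperplane_maximal irrD HD _ f0) => v /DY; apply: fY.
apply/not_notP => N.
have [|f f0 fY] := @divisor_not_dense (strictly_semistable_locus rho); last by apply: N; exists f.
apply: (proj2 pure); split=> //.
apply/irreducibleP; split; first by case: irrD => -[v /DY]; exists v.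
move=> f1 f2 f0; have /eqP : f1 * f2 = 0.
  by apply/eqP/negPn/negP => ff; apply: N; exists (f1 * f2).
by rewrite mulf_eq0 => /orP[] /eqP ->; [left|right] => v _; rewrite pevalC.
Qed.

Lemma positive_relation : exists2 p : 'X_{1..n}, relation a p & forall i, (0 < p i)%N.
Proof.
have [[v vs] _] := pure.
have [//|p Rp pE'] := stable_relation charK0 rho1 gu gE (S := predT) vs.
by exists p => // i; rewrite lt0n pE'.
Qed.

Import mathcomp.boot.fintype mathcomp.boot.finset.
Local Open Scope set_scope. Local Open Scope ring_scope.
Local Close Scope classical_set_scope.

(** If some stable vector lies on x_i = 0, some relation vanishes at i only, and
    j = i. Otherwise the image of this hyperplane is a divisor; were the face
    u_i = 0 strictly contained in the face u_j = 0, the images of the hyperplanes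
    x_i = 0 and x_j = 0 would begin a chain of length 2 ending at the whole quotient. *)
Lemma closure_symmetric i j : j \in clos a [set i] -> i \in clos a [set j].
Proof.
have vanish1 u k : vanishes u [set k] = (u k == 0%N).
  by apply/vanishesP/eqP => [->//|uk l]; rewrite ?finset.inE // => /eqP ->.
move=> /closP Hij.
have [[v vs vi]|Ns] := EM (exists2 v, stable_vector rho v & coord g v i = 0).
  have [k vk|u Ru uE] := stable_relation charK0 rho1 gu gE (S := [pred k | k != i]) vs.
    by apply: contraNneq vk => ->; rewrite vi.
  have : u j = 0%N by apply: Hij; rewrite ?vanish1 // uE /= eqxx.
  move/eqP; rewrite uE /= negbK => /eqP ->.
  exact: (fintype.subsetP (sub_clos _ _)) (finset.set11 _).
have Hi : (hyperplane i `<=` strictly_semistable_locus rho)%classic.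
  by move=> v vi vs; apply: Ns; exists v.
have [irr [_ dim]] := proj2 pure _ (hyperplane_component Hi).
apply/negPn/negP => ij.
have [q Rq [qj qi]] : exists2 q, relation a q & q j = 0%N /\ q i != 0%N.
  apply/not_notP => N; case/negP: ij; apply/closP => u Ru; rewrite vanish1 => /eqP uj.
  by apply/eqP/negPn/negP => ui; apply: N; exists u.
have [p Rp p0] := positive_relation.
have monE u v : peval (sig 'X_[u]) v = \prod_k coord g v k ^+ u k.
  by rewrite pE of_weightsK // mevalX.
have monA u : relation a u -> A (sig 'X_[u]).
  move=> Ru; apply/(torus_invariantsE charK0 gu gE) => w.
  by rewrite of_weightsK // msuppX inE => /eqP ->.
pose Z := image_closure (H := torus_image rho).
pose c k := if k is k'.+1 then (if k' is 0%N then Z (hyperplane j) else Z classical_sets.setT)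
  else (quot_map (torus_image rho) @` hyperplane i)%classic.
suff : (2 <= 1)%N by [].
(* A chain of length 2 that starts at the divisor. *)
apply: (dim 2 c) => //; split=> [[//|[|k]] _|[|[|//]] _] /=.
- exact/image_closure_irreducible/hyperplane_irreducible.
- exact/image_closure_irreducible/space_irreducible.
- split.
    move=> _ [v vi <-] f Af /vanish_hyperplaneE fj; split=> //.
    have : vanish_on (hyperplane i) f; last exact.
    apply/vanish_hyperplaneE => u uf; apply: contraNneq (fj u uf) => ui.
    apply/eqP; apply: Hij; last by rewrite vanish1 ui.
    by move/(torus_invariantsE charK0 gu gE): Af; apply.
  move=> sub; pose v := of_coord g (fun k => if k == j then 0 else 1).
  have [|v' v'i E] := sub (quot_map (torus_image rho) v).
    by apply: image_closure_quot; rewrite /hyperplane /= of_coordK // eqxx.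
  have : eval_ideal (torus_image rho) v' (sig 'X_[q]).
    split; first exact: monA.
    by rewrite monE (bigD1 i) //= v'i expr0n (negPf qi) mul0r.
  have -> : eval_ideal (torus_image rho) v' = eval_ideal (torus_image rho) v.
    exact: (congr1 (@proj1_sig _ _) E).
  case=> _; rewrite monE big1 => [/eqP|k _]; first by rewrite oner_eq0.
  by rewrite of_coordK //; case: eqP => [->|_]; rewrite ?qj ?expr0 // expr1n.
- split.
    by move=> x Hx f Af fT; apply: Hx => // v _; apply: fT.
  move=> sub; pose v := of_coord g (fun=> 1).
  have := sub (quot_map (torus_image rho) v) _ (sig 'X_[p]) (monA _ Rp).
  case=> [|w wj|_]; first exact: image_closure_quot.
    by rewrite monE (bigD1 j) //= wj expr0n gtn_eqF ?mul0r.
  rewrite monE big1 => [/eqP|k _]; first by rewrite oner_eq0.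
  by rewrite of_coordK // expr1n.
Qed.

End Purity.

(** * The invariant ring as a polynomial ring *)

Section FreeToric.
Variables (K : fieldType) (n r : nat) (W : 'I_n -> 'I_r -> int).
Variables (k : nat) (b : 'I_k -> 'X_{1..n}) (mk : 'I_k -> 'I_n).
Hypothesis bR : forall c, relation W (b c).
Hypothesis b_mk : forall c, (0 < b c (mk c))%N.
Hypothesis b_disj : forall c c', c' != c -> b c' (mk c) = 0%N.
Hypothesis b_gen : forall u, relation W u ->
  exists nu : 'X_{1..k}, u = (\sum_c b c *+ nu c)%MM.

Definition combination (nu : 'X_{1..k}) : 'X_{1..n} := (\sum_c b c *+ nu c)%MM.

Lemma combination_inj : injective combination.
Proof.
have E nu c : combination nu (mk c) = (b c (mk c) * nu c)%N.
  rewrite /combination mnm_sumE (bigD1 c) //= mulmnE big1 ?addn0 // => c' cc.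
  by rewrite mulmnE b_disj.
move=> nu nu' H; apply/mnmP => c; apply/eqP.
by rewrite -(eqn_pmul2l (b_mk c)) -!E H.
Qed.

Lemma combination_relation nu : relation W (combination nu).
Proof.
apply: (big_ind (fun u => relation W u)) => [|u w|c _]; [exact: relation0|exact: relationD|].
exact: relationMn.
Qed.

(** In weight coordinates, the parametrisation of the invariant ring by a
    polynomial ring. *)
Definition monomial_map : {mpoly K[k]} -> {mpoly K[n]} :=
  mmap (@mpolyC n K) (fun c => 'X_[b c]).
HB.instance Definition _ := GRing.RMorphism.on monomial_map.

Lemma monomial_mapC c : monomial_map c%:MP = c%:MP.
Proof. exact: mmapC. Qed.

Lemma monomial_mapE q : monomial_map q = \sum_(nu <- msupp q) q@_nu *: 'X_[combination nu].
Proof.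
rewrite {1}(mpolyE q) rmorph_sum; apply: eq_bigr => nu _.
rewrite -mul_mpolyC rmorphM /= monomial_mapC mul_mpolyC; congr (_ *: _).
rewrite /monomial_map mmapX /mmap1 /combination.
rewrite (big_morph (fun u => 'X_[u] : {mpoly K[n]}) (@mpolyXD n K) (mpolyX0 n K)).
by apply: eq_bigr => c _; rewrite mpolyXn.
Qed.

Lemma mcoeff_monomial_map q nu : (monomial_map q)@_(combination nu) = q@_nu.
Proof.
rewrite monomial_mapE raddf_sum /=.
have [qnu|qnu] := boolP (nu \in msupp q); last first.
  rewrite (memN_msupp_eq0 qnu) big_seq big1 // => m mq.
  rewrite mcoeffZ mcoeffX; case: eqP => [/combination_inj E|_]; last by rewrite mulr0.
  by rewrite -E mq in qnu.
rewrite (bigD1_seq nu) ?msupp_uniq //= mcoeffZ mcoeffX eqxx mulr1 big1 ?addr0 // => m mn.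
by rewrite mcoeffZ mcoeffX (inj_eq combination_inj) (negPf mn) mulr0.
Qed.

Lemma monomial_map_inj : injective monomial_map.
Proof. by move=> p q pq; apply/mpolyP => nu; rewrite -!mcoeff_monomial_map pq. Qed.

Lemma monomial_map_image (F : {mpoly K[n]}) :
  (forall u, u \in msupp F -> relation W u) <-> exists q, F = monomial_map q.
Proof.
split=> [FR|[q ->] u].
  have pre u : exists nu, u \in msupp F -> u = combination nu.
    have [/FR/b_gen[nu ->]|_] := boolP (u \in msupp F); first by exists nu.
    by exists 0%MM.
  have [nu nuE] := choice pre.
  exists (\sum_(u <- msupp F) F@_u *: 'X_[nu u]).
  rewrite {1}(mpolyE F) rmorph_sum; apply: eq_big_seq => u uF.
  rewrite -mul_mpolyC -[in RHS]mul_mpolyC rmorphM /= monomial_mapC; congr (_ * _).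
  by rewrite monomial_mapE msuppX big_seq1 mcoeffX eqxx scale1r -nuE.
apply: contraLR => Ru; rewrite mcoeff_msupp negbK monomial_mapE raddf_sum /= big1 // => nu _.
rewrite mcoeffZ mcoeffX; case: eqP => [E|_]; last by rewrite mulr0.
by rewrite -E combination_relation in Ru.
Qed.

End FreeToric.

Theorem proposition2p4 (K : closedFieldType) (charK0 : [pchar K] =i pred0)
    (r n : nat) (rho : ('I_r -> K) -> 'M[K]_n) :
  rational_representation rho ->
  pure_representation rho ->
  singular (torus_invariants rho) ->
  ~ finite_quotient_singularities (torus_invariants rho).
Proof.
move=> rat pure [x sing] fqs; apply: sing.
have rho1 : rho (fun=> 1) = 1%:M by case: rat.
have [g gu [a gE]] := weight_basis charK0 rat.
have AE := torus_invariantsE charK0 gu gE.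
have tauC c : to_weights g c%:MP = c%:MP by apply: mx_substC.
have sigC c : of_weights g c%:MP = c%:MP by apply: mx_substC.
have tauK := to_weightsK charK0 gu.
have sigK := of_weightsK charK0 gu.
have algA : subalg_set (torus_invariants rho) := invariants_subalg _.
pose x0 := quot_map (torus_image rho) 0.
have x0E : proj1_sig x0 = mA (to_weights g) (torus_invariants rho).
  have ev f : peval f 0 = (to_weights g f)@_0%MM.
    by rewrite (peval_weights gu) mulmx0 peval0.
  by apply/seteqP; split=> f [Af f0]; split; rewrite // -?ev // ev.
have [d [gT [G [rG iso0]]]] := fqs x0.
have jets N : exists theta, jet_iso x0 (quot_map (group_image rG) 0) N theta.
  have [T1 [ag agE]] := mA_fg (tau := to_weights g) (sig := of_weights g) tauK sigK tauC AE x0E.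
  have [T2 [bg bgE]] := mS_fg charK0 rG.
  have agE0 := etrans x0E agE.
  exact: (formal_jet_iso (y := quot_map (group_image rG) 0) algA (invariants_subalg _) N agE0 bgE iso0).
have submod := delta_submodular (tau := to_weights g) (sig := of_weights g)
  tauK sigK tauC AE x0E charK0 jets.
have [p Rp p0] := positive_relation charK0 rho1 gu gE pure.
have sym := closure_symmetric charK0 rho1 gu gE pure.
have [k [b [mk [bR b_mk b_disj b_gen]]]] := free_monoid Rp p0 sym submod.
have residue f : torus_invariants rho f -> exists c, proj1_sig x (f - c%:MP).
  have [d' [gT' [G' [rG' iso]]]] := fqs x.
  exact: (formal_residue algA (invariants_subalg _) iso (@residue_origin _ _ _ _ _)).
pose Psi : {rmorphism {mpoly K[k]} -> {mpoly K[n]}} := of_weights g \o monomial_map b.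
apply: (polynomial_subalgebra_regular (Psi := Psi) _ _ _ algA residue).
- by move=> c; rewrite /= monomial_mapC sigC.
- by apply: inj_comp; [exact: (can_inj sigK) | exact: (monomial_map_inj b_mk b_disj)].
- move=> f; rewrite AE (monomial_map_image bR b_gen); split=> -[q qE]; exists q.
    by rewrite /= -qE tauK.
  by rewrite qE /= sigK.
Qed.
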